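(* Let $k\in\mathbb{N}_0$, $\alpha\in\mathbb{C}$, and let $\beta,\gamma>-1$ be real numbers such that if $\beta,\gamma\in(-1,0)$ then $\beta+\gamma+1\neq0$. Let $\rho\in\{z\in\mathbb{C}:|z|<1\}\setminus(-1,0]$ and, for $x\in[-1,1]$, put $R:=\sqrt{1+\rho^2-2\rho x}$. Then $$\int_{-1}^1\frac{(1+x)^{\beta/2}(1-x)^\gamma}{R^{\alpha+1}}\,P_\alpha^{-\beta}\!\left(\frac{1+\rho}{R}\right)P_k^{(\gamma,\beta)}(x)\,dx=\frac{2^{\gamma+\beta/2+1}\,\Gamma(\gamma+k+1)\,(\alpha+\beta+1)_{2k}}{(1-\rho)^{\alpha-\gamma}\,\rho^{(\gamma+1)/2}\,k!}\,P_{\gamma-\alpha}^{-\gamma-\beta-2k-1}\!\left(\frac{1+\rho}{1-\rho}\right).$$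
   Context: $\mathbb{N}_0=\{0,1,2,\dots\}$. Square roots and complex powers are principal. $(z)_n:=\prod_{i=1}^n(z+i-1)$ is the Pochhammer symbol. The Jacobi polynomials are $P_n^{(\alpha,\beta)}(z):=\frac{(\alpha+1)_n}{n!}\,{}_2F_1\left(-n,n+\alpha+\beta+1;\alpha+1;\frac{1-z}{2}\right)$. The associated Legendre function of the first kind $P_\nu^\mu:\mathbb{C}\setminus(-\infty,1]\to\mathbb{C}$ is $$P_\nu^\mu(z):=\frac{1}{\Gamma(1-\mu)}\left(\frac{z+1}{z-1}\right)^{\mu/2}{}_2F_1\!\left(-\nu,\nu+1;1-\mu;\frac{1-z}{2}\right),$$ where ${}_2F_1$ denotes the Gauss hypergeometric function, continued analytically to $\mathbb{C}\setminus[1,\infty)$. *)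

(* Defs.v *)
From Stdlib Require Import Factorial Reals ClassicalEpsilon.
From Coquelicot Require Import Coquelicot.

Open Scope R_scope.

Definition Cexp (z : C) : C := (exp (Re z) * cos (Im z), exp (Re z) * sin (Im z)).

(* Values in (-PI, PI]; only meaningful for z <> 0, and so are [Cln], [Cpower]
   and [Csqrt] below. *)
Definition Carg (z : C) : R :=
  if Rle_dec 0 (Im z) then acos (Re z / Cmod z) else - acos (Re z / Cmod z).

Definition Cln (z : C) : C := (ln (Cmod z), Carg z).

Definition Cpower (z s : C) : C := Cexp (s * Cln z)%C.

Definition Csqrt (z : C) : C := Cpower z (RtoC (/ 2)).

Fixpoint pochhammer (z : C) (n : nat) : C :=
  match n with
  | O => RtoC 1
  | S m => (pochhammer z m * (z + INR m))%C
  end.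

(* Euler's limit formula: Gamma z = lim n! n^z / (z (z+1) ... (z+n)). At the
   poles z = 0, -1, -2, ... the value is 0, because division by zero is 0, so
   that [/ Cgamma z] is the entire function 1/Gamma for every z. *)
Definition Cgamma_seq (z : C) (n : nat) : C :=
  (INR (fact n) * Cpower (INR n) z / pochhammer z (S n))%C.

Definition Cgamma (z : C) : C :=
  (real (Lim_seq (fun n => Re (Cgamma_seq z n))),
   real (Lim_seq (fun n => Im (Cgamma_seq z n)))).

Definition analytic_at (f : C -> C) (z0 : C) : Prop :=
  exists (a : nat -> C) (r : R), 0 < r /\
    forall z : C, Cmod (z - z0)%C < r ->
      is_pseries (K := C_AbsRing) (V := C_NormedModule) a (z - z0)%C (f z).

Definition hyp2F1_coef (a b c : C) (n : nat) : C :=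
  (pochhammer a n * pochhammer b n / (pochhammer c n * INR (fact n)))%C.

(* The cut plane C \ [1, +oo). *)
Definition hyp2F1_domain (z : C) : Prop := ~ (Im z = 0 /\ 1 <= Re z).

Definition is_hyp2F1 (a b c : C) (f : C -> C) : Prop :=
  (forall z : C, hyp2F1_domain z -> analytic_at f z) /\
  (forall z : C, Cmod z < 1 ->
     is_pseries (K := C_AbsRing) (V := C_NormedModule) (hyp2F1_coef a b c) z (f z)).

(* The analytic continuation of the Gauss series. For c not in {0, -1, -2, ...},
   [is_hyp2F1 a b c] determines f on [hyp2F1_domain], and only there. *)
Definition hyp2F1 (a b c : C) : C -> C :=
  epsilon (inhabits (fun _ : C => RtoC 0)) (is_hyp2F1 a b c).

(* P_n^(alpha, beta). The series 2F1(-n, n+alpha+beta+1; alpha+1; w) terminates at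
   w^n; it is summed directly because the polynomial is also wanted at arguments
   w = (1-z)/2 on the cut of [hyp2F1]. *)
Definition jacobiP (n : nat) (alpha beta z : C) : C :=
  (pochhammer (alpha + 1) n / INR (fact n) *
   sum_n (fun j => hyp2F1_coef (- INR n) (INR n + alpha + beta + 1) (alpha + 1) j
                   * ((1 - z) / 2) ^ j) n)%C.

(* P_nu^mu (z), meant for z outside (-oo, 1]. *)
Definition legendreP (nu mu z : C) : C :=
  (/ Cgamma (1 - mu) * Cpower ((z + 1) / (z - 1)) (mu / 2)
   * hyp2F1 (- nu) (nu + 1) (1 - mu) ((1 - z) / 2))%C.

(* Main.v *)
Require Import Defs.
From Stdlib Require Import Arith Factorial Reals ClassicalEpsilon Lra Lia Psatz.
From Coquelicot Require Import Coquelicot.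
Open Scope R_scope.

(** Why the identity holds.  Write a = alpha + beta + 1, s = (1 + x) / 2 and
    K(t) = 4 t / (1 + t)^2, the Koebe function, which maps the unit disc onto the plane cut along
    [1, oo).

    Both Legendre functions are quadratic transforms of a Gauss function of K.  For |t| < 1,
    the function 2F1(1 + a - c, c - a; c; - t / (1 - t)) times (1 - t)^-(1 + a - c), and
    2F1(a/2, (a + 1)/2; c; K(t)) times (1 + t)^-a, have the same Taylor series in t; each
    coefficient is a Chu-Vandermonde sum (pfaff_coef, koebe_coef, quadratic_transformation).  On
    the left one takes the t in the unit disc with K(t) = s K(rho); then (1 + rho) / R equals
    (1 + t) / (1 - t), and all the branch factors combine (generating_root, generating_function)
    to give, up to a constant factor,

      (1 + x)^beta (1 - x)^gamma (1 + rho)^-a 2F1(a/2, (a + 1)/2; beta + 1; s K(rho)) P_k(x).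

    On the right t = rho (legendreP_disc).

    It remains to integrate.  For fixed s the Koebe composite is holomorphic in rho on the whole
    unit disc, so its Taylor series in rho converges there; its coefficients are polynomials in s,
    bounded uniformly in s by Cauchy's estimate, and the integral can be taken term by term
    (koebe_jacobi_integral).  Integrating s^m against the Jacobi weight and P_k is a Beta integral
    and another Chu-Vandermonde sum (impint_jacobi_moment); it replaces the m-th coefficient of
    the Gauss series by that of a multiple of
    K^k 2F1(a/2 + k, (a + 1)/2 + k; beta + gamma + 2 k + 2; K) (moment_series), which is the
    right-hand side.  K(rho) may lie outside the disc of convergence of the Gauss series;
    expanding in rho instead covers the whole disc.

    Three bodies of theory support this.  Complex analysis on the disc: strictly differentiable
    functions have convergent Taylor series there (taylor_unit_disc), proved by contracting the
    circle to a point inside Cauchy's integral.  The analytic continuation of the Gauss series to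
    the cut plane (hyp2F1_continuation_exists): Euler's integral, expanded about each point of the
    cut plane, for large parameters, then contiguous relations.  Euler's limit for Gamma on the
    positive axis and its link with the Beta integral (jacobi_mass_gamma). *)

(** * Complex exponential, logarithm and powers *)

Lemma C_ext (z w : C) : Re z = Re w -> Im z = Im w -> z = w.
Proof. destruct z, w; simpl; intros; subst; reflexivity. Qed.

Lemma Cmod_sqr (z : C) : Cmod z * Cmod z = Re z * Re z + Im z * Im z.
Proof.
  unfold Cmod. rewrite sqrt_sqrt; [unfold Re, Im; ring|].
  nra.
Qed.

Lemma Cmod_le_add_abs (z : C) : Cmod z <= Rabs (Re z) + Rabs (Im z).
Proof.
  pose proof (Cmod_sqr z). pose proof (Cmod_ge_0 z).
  pose proof (Rabs_pos (Re z)). pose proof (Rabs_pos (Im z)).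
  assert (Rabs (Re z) * Rabs (Re z) = Re z * Re z) by (rewrite <- Rabs_mult; apply Rabs_pos_eq; nra).
  assert (Rabs (Im z) * Rabs (Im z) = Im z * Im z) by (rewrite <- Rabs_mult; apply Rabs_pos_eq; nra).
  nra.
Qed.

Lemma im_le_Cmod (z : C) : Rabs (Im z) <= Cmod z.
Proof.
  eapply Rle_trans; [|apply (Rmax_Cmod z)]. apply Rmax_r.
Qed.

Lemma Cmod_triangle_sub (x y : C) : Cmod (x - y) <= Cmod x + Cmod y.
Proof.
  unfold Cminus. eapply Rle_trans; [apply Cmod_triangle|]. rewrite Cmod_opp. lra.
Qed.

Lemma Cmod_sub_comm (x y : C) : Cmod (x - y) = Cmod (y - x).
Proof. rewrite <- Cmod_opp. f_equal. ring. Qed.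

Lemma Cexp_plus (z w : C) : Cexp (z + w) = (Cexp z * Cexp w)%C.
Proof.
  unfold Cexp. rewrite re_plus, im_plus, exp_plus, cos_plus, sin_plus.
  apply C_ext; simpl; ring.
Qed.

Lemma Cexp_0 : Cexp 0 = RtoC 1.
Proof. unfold Cexp; simpl. rewrite exp_0, cos_0, sin_0. apply C_ext; simpl; ring. Qed.

Lemma Cmod_Cexp (z : C) : Cmod (Cexp z) = exp (Re z).
Proof.
  unfold Cexp, Cmod; simpl.
  replace (_ + _) with ((exp (Re z))²).
  - apply sqrt_Rsqr. left; apply exp_pos.
  - pose proof (sin2_cos2 (Im z)) as H. unfold Rsqr in *.
    transitivity (exp (Re z) * exp (Re z) * (sin (Im z) * sin (Im z) + cos (Im z) * cos (Im z))).
    + rewrite H; ring.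
    + ring.
Qed.

Lemma Cexp_neq_0 (z : C) : Cexp z <> RtoC 0.
Proof.
  intros H. pose proof (Cmod_Cexp z) as E. rewrite H, Cmod_0 in E.
  pose proof (exp_pos (Re z)). lra.
Qed.

Lemma Cexp_opp (z : C) : Cexp (- z) = (/ Cexp z)%C.
Proof.
  assert (E : (Cexp (- z) * Cexp z)%C = RtoC 1).
  { rewrite <- Cexp_plus, <- Cexp_0. f_equal. ring. }
  rewrite <- (Cmult_1_r (Cexp (- z))), <- (Cinv_r (Cexp z) (Cexp_neq_0 z)).
  rewrite Cmult_assoc, E. ring.
Qed.

(** The exponential is injective on open horizontal strips of height 2 pi, hence principal
    logarithms are determined by their exponentials. *)
Lemma Cexp_inj (z w : C) :
  Rabs (Im z - Im w) < 2 * PI -> Cexp z = Cexp w -> z = w.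
Proof.
  intros Hd E.
  assert (Er : Re z = Re w).
  { apply exp_inv. rewrite <- !Cmod_Cexp. now rewrite E. }
  apply C_ext; [exact Er|].
  unfold Cexp in E. injection E as E1 E2. rewrite Er in E1, E2.
  pose proof (exp_pos (Re w)) as Hp.
  assert (Ec : cos (Im z) = cos (Im w)) by (apply (Rmult_eq_reg_l (exp (Re w))); lra).
  assert (Es : sin (Im z) = sin (Im w)) by (apply (Rmult_eq_reg_l (exp (Re w))); lra).
  assert (H1 : cos (Im z - Im w) = 1).
  { rewrite cos_minus, Ec, Es. pose proof (sin2_cos2 (Im w)). unfold Rsqr in *. lra. }
  set (d := (Im z - Im w) / 2).
  assert (Hd' : Im z - Im w = 2 * d) by (unfold d; field).
  rewrite Hd', cos_2a_sin in H1.
  assert (Hs : sin d = 0) by nra.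
  apply Rabs_def2 in Hd.
  destruct (Rtotal_order d 0) as [Hn|[H0|Hn]]; [|lra|].
  - pose proof (sin_gt_0 (- d)) as Hg. rewrite sin_neg in Hg. lra.
  - pose proof (sin_gt_0 d). lra.
Qed.

Lemma Carg_range (z : C) : - PI < Carg z <= PI.
Proof.
  pose proof PI_RGT_0. unfold Carg.
  pose proof (acos_bound (Re z / Cmod z)).
  destruct Rle_dec as [H1|H1]; [lra|].
  assert (Hz : 0 < Cmod z).
  { apply Cmod_gt_0. intros ->. simpl in H1. lra. }
  split; [|lra].
  assert (Hlt : -1 < Re z / Cmod z).
  { apply Rlt_div_r; [lra|]. pose proof (Cmod_sqr z). nra. }
  assert (Hle : Re z / Cmod z <= 1).
  { apply Rle_div_l; [lra|]. pose proof (Cmod_sqr z). nra. }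
  destruct (Rlt_or_le (acos (Re z / Cmod z)) PI) as [|Hge]; [lra|].
  exfalso. assert (E : acos (Re z / Cmod z) = PI) by lra.
  pose proof (cos_acos (Re z / Cmod z)) as Hc. rewrite E, cos_PI in Hc. lra.
Qed.

Lemma Cexp_Cln (z : C) : z <> 0 -> Cexp (Cln z) = z.
Proof.
  intros Hz. apply Cmod_gt_0 in Hz. unfold Cexp, Cln; simpl.
  rewrite exp_ln by exact Hz.
  pose proof (Cmod_sqr z) as Hsq.
  assert (Hb : -1 <= Re z / Cmod z <= 1).
  { split; [apply Rle_div_r|apply Rle_div_l]; nra. }
  assert (Hs : sqrt (1 - (Re z / Cmod z)²) = Rabs (Im z) / Cmod z).
  { replace (1 - (Re z / Cmod z)²) with ((Rabs (Im z) / Cmod z)²).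
    - apply sqrt_Rsqr. apply Rdiv_le_0_compat; [apply Rabs_pos|lra].
    - unfold Rsqr. replace (Rabs (Im z) / Cmod z * (Rabs (Im z) / Cmod z))
        with (Rabs (Im z) * Rabs (Im z) / (Cmod z * Cmod z)) by (field; lra).
      rewrite <- Rabs_mult, Rabs_pos_eq by nra.
      replace (Im z * Im z) with (Cmod z * Cmod z - Re z * Re z) by lra. field; lra. }
  unfold Carg. destruct Rle_dec as [H|H].
  - rewrite cos_acos, sin_acos by exact Hb. rewrite Hs, Rabs_pos_eq by exact H.
    apply C_ext; simpl; field; lra.
  - rewrite cos_neg, sin_neg, cos_acos, sin_acos by exact Hb.
    rewrite Hs, Rabs_left by lra. apply C_ext; simpl; field; lra.
Qed.

Lemma Cln_unique (z w : C) : - PI < Im w <= PI -> Cexp w = z -> Cln z = w.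
Proof.
  intros Hw E. pose proof (Carg_range z).
  apply Cexp_inj.
  - simpl. apply Rabs_def1; lra.
  - rewrite E. apply Cexp_Cln. rewrite <- E. apply Cexp_neq_0.
Qed.

(** The plane cut along (-oo, 0], where the principal logarithm is continuous. *)
Definition slit (z : C) : Prop := ~ (Im z = 0 /\ Re z <= 0).

Lemma slit_neq_0 (z : C) : slit z -> z <> 0.
Proof. intros H ->. apply H. simpl. lra. Qed.

Lemma slit_Re_pos (z : C) : 0 < Re z -> slit z.
Proof. unfold slit; lra. Qed.

Lemma Carg_lt_PI (z : C) : slit z -> Carg z < PI.
Proof.
  intros Hz. pose proof (Carg_range z) as Hr.
  destruct (Rlt_or_le (Carg z) PI) as [|Hge]; [assumption|exfalso].
  assert (E : Carg z = PI) by lra.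
  pose proof (Cexp_Cln z (slit_neq_0 z Hz)) as H. unfold Cexp, Cln in H; simpl in H.
  rewrite E, cos_PI, sin_PI in H. pose proof (exp_pos (ln (Cmod z))).
  apply Hz. rewrite <- H; simpl. lra.
Qed.

Lemma Cln_sin (z : C) : z <> 0 -> Im z = Cmod z * sin (Carg z).
Proof.
  intros Hz. rewrite <- (Cexp_Cln z Hz) at 1. unfold Cexp, Cln; simpl.
  rewrite exp_ln; [reflexivity|now apply Cmod_gt_0].
Qed.

Lemma Cln_cos (z : C) : z <> 0 -> Re z = Cmod z * cos (Carg z).
Proof.
  intros Hz. rewrite <- (Cexp_Cln z Hz) at 1. unfold Cexp, Cln; simpl.
  rewrite exp_ln; [reflexivity|now apply Cmod_gt_0].
Qed.

Lemma Carg_Im_pos (z : C) : 0 < Im z -> 0 < Carg z < PI.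
Proof.
  intros H. assert (Hz : z <> 0) by (intros ->; simpl in H; lra).
  pose proof (Carg_range z). pose proof (Cln_sin z Hz) as E.
  pose proof (proj1 (Cmod_gt_0 z) Hz).
  assert (0 < sin (Carg z)) by nra.
  destruct (Rle_or_lt (Carg z) 0).
  - pose proof (sin_ge_0 (- Carg z)) as Hs. rewrite sin_neg in Hs. lra.
  - split; [lra|]. apply Carg_lt_PI. intros []. lra.
Qed.

Lemma Carg_Im_neg (z : C) : Im z < 0 -> - PI < Carg z < 0.
Proof.
  intros H. assert (Hz : z <> 0) by (intros ->; simpl in H; lra).
  pose proof (Carg_range z). pose proof (Cln_sin z Hz) as E.
  pose proof (proj1 (Cmod_gt_0 z) Hz).
  assert (sin (Carg z) < 0) by nra.
  destruct (Rle_or_lt 0 (Carg z)).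
  - pose proof (sin_ge_0 (Carg z)) as Hs. lra.
  - lra.
Qed.

Lemma Carg_Re_pos (z : C) : 0 < Re z -> - (PI / 2) < Carg z < PI / 2.
Proof.
  intros H. assert (Hz : z <> 0) by (intros ->; simpl in H; lra).
  pose proof (Carg_range z). pose proof (Cln_cos z Hz) as E.
  pose proof (proj1 (Cmod_gt_0 z) Hz).
  assert (0 < cos (Carg z)) by nra.
  destruct (Rle_or_lt (Carg z) (- (PI / 2))).
  - pose proof (cos_le_0 (- Carg z)) as Hs. rewrite cos_neg in Hs. lra.
  - split; [lra|]. destruct (Rlt_or_le (Carg z) (PI / 2)); [assumption|].
    pose proof (cos_le_0 (Carg z)) as Hs. lra.
Qed.

Lemma Cln_RtoC (x : R) : 0 < x -> Cln x = RtoC (ln x).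
Proof.
  intros Hx. pose proof PI_RGT_0. apply Cln_unique; [simpl; lra|].
  unfold Cexp; simpl. rewrite cos_0, sin_0, exp_ln by exact Hx.
  apply C_ext; simpl; ring.
Qed.

Lemma Cln_mult (z w : C) : z <> 0 -> w <> 0 -> - PI < Carg z + Carg w <= PI ->
  Cln (z * w) = (Cln z + Cln w)%C.
Proof.
  intros Hz Hw H. apply Cln_unique; [exact H|].
  rewrite Cexp_plus, !Cexp_Cln by assumption. reflexivity.
Qed.

Lemma Cln_inv (z : C) : slit z -> Cln (/ z) = (- Cln z)%C.
Proof.
  intros Hz. pose proof (Carg_lt_PI z Hz). pose proof (Carg_range z).
  apply Cln_unique; [simpl; lra|].
  rewrite Cexp_opp, Cexp_Cln; [reflexivity|now apply slit_neq_0].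
Qed.

Lemma Cln_scal (x : R) (z : C) : 0 < x -> z <> 0 -> Cln (x * z) = (ln x + Cln z)%C.
Proof.
  intros Hx Hz. rewrite <- Cln_RtoC by exact Hx. pose proof (Carg_range z).
  apply Cln_mult; [|exact Hz|].
  - intros E. apply (f_equal Re) in E. simpl in E. lra.
  - replace (Carg x) with (Im (Cln x)) by reflexivity. rewrite Cln_RtoC by exact Hx. simpl. lra.
Qed.

(** The principal argument through the half-angle formula; unlike the definition by cases this
    is visibly continuous on the slit plane. *)
Lemma Cln_half_angle (z : C) : slit z ->
  Cln z = (ln (Cmod z), 2 * atan (Im z / (Cmod z + Re z))).
Proof.
  intros Hz. pose proof (slit_neq_0 z Hz) as Hz0.
  pose proof (proj1 (Cmod_gt_0 z) Hz0) as Hm.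
  pose proof (Cmod_sqr z) as Hsq.
  assert (Hp : 0 < Cmod z + Re z).
  { destruct (Req_dec (Im z) 0) as [E|E].
    - destruct (Rle_or_lt (Re z) 0); [exfalso; apply Hz; auto|lra].
    - assert (0 < Im z * Im z) by nra. nra. }
  set (t := Im z / (Cmod z + Re z)).
  pose proof (atan_bound t).
  apply Cln_unique; [simpl; lra|].
  unfold Cexp; simpl. rewrite exp_ln by exact Hm.
  assert (Hc : cos (atan t) * cos (atan t) * (1 + t²) = 1).
  { rewrite cos_atan. assert (0 < 1 + t²) by (unfold Rsqr; nra).
    pose proof (sqrt_sqrt (1 + t²)). pose proof (sqrt_lt_R0 (1 + t²)).
    field_simplify; [|lra]. unfold Rsqr in *. rewrite !pow2_sqrt by nra. field. nra. }
  assert (Hs : sin (atan t) = t * cos (atan t)).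
  { rewrite cos_atan, sin_atan. field.
    assert (0 < 1 + t²) by (unfold Rsqr; nra).
    pose proof (sqrt_lt_R0 (1 + t²)). lra. }
  rewrite cos_2a, sin_2a, Hs.
  assert (Ht : 1 + t² = 2 * Cmod z / (Cmod z + Re z)).
  { unfold t, Rsqr. apply (Rmult_eq_reg_r ((Cmod z + Re z) * (Cmod z + Re z))); [|nra].
    field_simplify; [|lra|lra]. nra. }
  assert (Hcc : cos (atan t) * cos (atan t) = (Cmod z + Re z) / (2 * Cmod z)).
  { rewrite Ht in Hc. apply (Rmult_eq_reg_r (2 * Cmod z / (Cmod z + Re z))).
    - rewrite Hc. field; lra.
    - apply Rgt_not_eq. apply Rdiv_lt_0_compat; lra. }
  apply C_ext; simpl.
  - replace (cos (atan t) * cos (atan t) - t * cos (atan t) * (t * cos (atan t)))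
      with ((cos (atan t) * cos (atan t)) * (2 - (1 + t²))) by (unfold Rsqr; ring).
    rewrite Hcc, Ht. field; lra.
  - replace (2 * (t * cos (atan t)) * cos (atan t))
      with (2 * t * (cos (atan t) * cos (atan t))) by ring.
    rewrite Hcc. unfold t. field; lra.
Qed.

Lemma Cpower_plus (z s t : C) : Cpower z (s + t) = (Cpower z s * Cpower z t)%C.
Proof. unfold Cpower. rewrite <- Cexp_plus. f_equal. ring. Qed.

Lemma Cpower_opp (z s : C) : Cpower z (- s) = (/ Cpower z s)%C.
Proof. unfold Cpower. rewrite <- Cexp_opp. f_equal. ring. Qed.

Lemma Cpower_neq_0 (z s : C) : Cpower z s <> 0.
Proof. apply Cexp_neq_0. Qed.

Lemma Cpower_1 (z : C) : z <> 0 -> Cpower z 1 = z.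
Proof. intros H. unfold Cpower. rewrite Cmult_1_l. now apply Cexp_Cln. Qed.

Lemma Cpower_0 (z : C) : Cpower z 0 = RtoC 1.
Proof. unfold Cpower. rewrite Cmult_0_l. apply Cexp_0. Qed.

Lemma Cpower_nat (z : C) (n : nat) : z <> 0 -> Cpower z (INR n) = (z ^ n)%C.
Proof.
  intros Hz. induction n as [|n IH].
  - apply Cpower_0.
  - rewrite S_INR, RtoC_plus, Cpower_plus, IH, Cpower_1 by exact Hz.
    rewrite Cpow_S. ring.
Qed.

Lemma Cpower_pos_real (x y : R) : 0 < x -> Cpower x y = RtoC (Rpower x y).
Proof.
  intros Hx. unfold Cpower. rewrite Cln_RtoC, <- RtoC_mult by exact Hx.
  unfold Cexp, Rpower; simpl. rewrite cos_0, sin_0. apply C_ext; simpl; ring.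
Qed.

Lemma Cpower_at_1 (s : C) : Cpower 1 s = RtoC 1.
Proof.
  unfold Cpower. rewrite Cln_RtoC, ln_1, Cmult_0_r by lra. apply Cexp_0.
Qed.

Lemma Csqrt_sqr (z : C) : z <> 0 -> (Csqrt z * Csqrt z)%C = z.
Proof.
  intros Hz. unfold Csqrt. rewrite <- Cpower_plus, <- RtoC_plus.
  replace (/ 2 + / 2) with 1 by field. now apply Cpower_1.
Qed.

Lemma Csqrt_of_sqr (z : C) : 0 < Re z -> Csqrt (z * z) = z.
Proof.
  intros Hz. pose proof (Carg_Re_pos z Hz).
  pose proof (slit_neq_0 z (slit_Re_pos z Hz)) as H0.
  unfold Csqrt, Cpower. rewrite Cln_mult by (assumption || lra).
  rewrite <- (Cexp_Cln z H0) at 3. f_equal.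
  replace (/2) with (1/2) by field. rewrite RtoC_div by lra. field.
Qed.

(** Halving a principal argument leaves it principal; this is how the sign of Im under square
    roots is read off below. *)
Lemma Csqrt_arg (z : C) : slit z ->
  Csqrt z <> 0 /\ Carg (Csqrt z) = Carg z / 2.
Proof.
  intros Hz. pose proof (Carg_range z). pose proof (Carg_lt_PI z Hz).
  split; [apply Cpower_neq_0|].
  change (Carg (Csqrt z)) with (Im (Cln (Csqrt z))).
  unfold Csqrt, Cpower.
  rewrite (Cln_unique _ (RtoC (/ 2) * Cln z)%C); [simpl; field| |reflexivity].
  simpl. lra.
Qed.

Lemma Csqrt_Re_pos (z : C) : slit z -> 0 < Re (Csqrt z).
Proof.
  intros Hz. destruct (Csqrt_arg z Hz) as [H0 Ha].
  pose proof (Carg_range z). pose proof (Carg_lt_PI z Hz).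
  rewrite (Cln_cos _ H0), Ha. apply Rmult_lt_0_compat; [now apply Cmod_gt_0|].
  apply cos_gt_0; lra.
Qed.

(** * Strict complex differentiability *)

(** Strict differentiability, in which both points of the difference quotient move. A function
    strictly differentiable on an open set automatically has a continuous derivative there, so
    that this single notion serves as holomorphy. *)
Definition sdiff (f : C -> C) (z l : C) : Prop :=
  forall eps : R, 0 < eps -> exists delta : R, 0 < delta /\
    forall x y : C, Cmod (x - z) < delta -> Cmod (y - z) < delta ->
      Cmod (f x - f y - l * (x - y)) <= eps * Cmod (x - y).

Definition ccont (f : C -> C) (z : C) : Prop :=
  forall eps : R, 0 < eps -> exists delta : R, 0 < delta /\
    forall x : C, Cmod (x - z) < delta -> Cmod (f x - f z) < eps.

Lemma Cmod_diag (z : C) : Cmod (z - z) = 0.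
Proof. replace (z - z)%C with (RtoC 0) by ring. apply Cmod_0. Qed.

Lemma sdiff_lipschitz (f : C -> C) (z l : C) : sdiff f z l ->
  exists delta : R, 0 < delta /\ forall x y : C, Cmod (x - z) < delta -> Cmod (y - z) < delta ->
    Cmod (f x - f y) <= (Cmod l + 1) * Cmod (x - y).
Proof.
  intros H. destruct (H 1 Rlt_0_1) as (d & Hd & Hf). exists d; split; [exact Hd|].
  intros x y Hx Hy. specialize (Hf x y Hx Hy).
  replace (f x - f y)%C with ((f x - f y - l * (x - y)) + l * (x - y))%C by ring.
  eapply Rle_trans; [apply Cmod_triangle|]. rewrite Cmod_mult. lra.
Qed.

Lemma sdiff_ccont (f : C -> C) (z l : C) : sdiff f z l -> ccont f z.
Proof.
  intros H eps He. destruct (sdiff_lipschitz f z l H) as (d & Hd & Hf).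
  pose proof (Cmod_ge_0 l).
  exists (Rmin d (eps / (Cmod l + 1))). split.
  - apply Rmin_glb_lt; [exact Hd|]. apply Rdiv_lt_0_compat; lra.
  - intros x Hx. assert (H1 := Rlt_le_trans _ _ _ Hx (Rmin_l _ _)).
    assert (H2 := Rlt_le_trans _ _ _ Hx (Rmin_r _ _)).
    eapply Rle_lt_trans; [apply Hf; [exact H1|rewrite Cmod_diag; exact Hd]|].
    apply Rlt_div_r in H2; lra.
Qed.

Lemma sdiff_ext_near (f g : C -> C) (z l : C) (d : R) : 0 < d ->
  (forall x, Cmod (x - z) < d -> f x = g x) -> sdiff f z l -> sdiff g z l.
Proof.
  intros Hd E H eps He. destruct (H eps He) as (d' & Hd' & Hf).
  exists (Rmin d d'). split; [now apply Rmin_glb_lt|].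
  intros x y Hx Hy.
  rewrite <- !E by (eapply Rlt_le_trans; [eassumption|apply Rmin_l]).
  apply Hf; eapply Rlt_le_trans; try eassumption; apply Rmin_r.
Qed.

Lemma sdiff_const (c z : C) : sdiff (fun _ => c) z 0.
Proof.
  intros eps He. exists 1. split; [lra|]. intros x y _ _.
  replace (c - c - 0 * (x - y))%C with (RtoC 0) by ring. rewrite Cmod_0.
  pose proof (Cmod_ge_0 (x - y)). nra.
Qed.

Lemma sdiff_id (z : C) : sdiff (fun x => x) z 1.
Proof.
  intros eps He. exists 1. split; [lra|]. intros x y _ _.
  replace (x - y - 1 * (x - y))%C with (RtoC 0) by ring. rewrite Cmod_0.
  pose proof (Cmod_ge_0 (x - y)). nra.
Qed.

Lemma sdiff_plus (f g : C -> C) (z l m : C) : sdiff f z l -> sdiff g z m ->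
  sdiff (fun x => f x + g x)%C z (l + m).
Proof.
  intros Hf Hg eps He.
  destruct (Hf (eps / 2)) as (d1 & Hd1 & H1); [lra|].
  destruct (Hg (eps / 2)) as (d2 & Hd2 & H2); [lra|].
  exists (Rmin d1 d2). split; [now apply Rmin_glb_lt|]. intros x y Hx Hy.
  replace (f x + g x - (f y + g y) - (l + m) * (x - y))%C
    with ((f x - f y - l * (x - y)) + (g x - g y - m * (x - y)))%C by ring.
  eapply Rle_trans; [apply Cmod_triangle|].
  assert (A := H1 x y (Rlt_le_trans _ _ _ Hx (Rmin_l _ _)) (Rlt_le_trans _ _ _ Hy (Rmin_l _ _))).
  assert (B := H2 x y (Rlt_le_trans _ _ _ Hx (Rmin_r _ _)) (Rlt_le_trans _ _ _ Hy (Rmin_r _ _))).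
  lra.
Qed.

Lemma sdiff_comp (f g : C -> C) (z l m : C) : sdiff f z l -> sdiff g (f z) m ->
  sdiff (fun x => g (f x)) z (m * l).
Proof.
  intros Hf Hg eps He.
  pose proof (Cmod_ge_0 l) as Nl; pose proof (Cmod_ge_0 m) as Nm.
  destruct (Hg (eps / 2 / (Cmod l + 1))) as (d1 & Hd1 & H1); [repeat apply Rdiv_lt_0_compat; lra|].
  destruct (Hf (eps / 2 / (Cmod m + 1))) as (d2 & Hd2 & H2); [repeat apply Rdiv_lt_0_compat; lra|].
  destruct (sdiff_ccont f z l Hf d1 Hd1) as (d3 & Hd3 & H3).
  destruct (sdiff_lipschitz f z l Hf) as (d4 & Hd4 & H4).
  set (d := Rmin d2 (Rmin d3 d4)).
  assert (Hdd : d <= d2 /\ d <= d3 /\ d <= d4).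
  { unfold d. repeat split; unfold Rmin; repeat destruct Rle_dec; lra. }
  exists d. split; [unfold d; repeat apply Rmin_glb_lt; assumption|].
  intros x y Hx Hy.
  assert (E1 := H1 (f x) (f y) (H3 x ltac:(lra)) (H3 y ltac:(lra))).
  assert (E2 := H2 x y ltac:(lra) ltac:(lra)). assert (E4 := H4 x y ltac:(lra) ltac:(lra)).
  replace (g (f x) - g (f y) - m * l * (x - y))%C
    with ((g (f x) - g (f y) - m * (f x - f y)) + m * (f x - f y - l * (x - y)))%C by ring.
  eapply Rle_trans; [apply Cmod_triangle|]. rewrite Cmod_mult.
  set (w := Cmod (x - y)) in *. assert (Hw : 0 <= w) by apply Cmod_ge_0.
  assert (P1 : Cmod (g (f x) - g (f y) - m * (f x - f y)) <= eps / 2 * w).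
  { eapply Rle_trans; [exact E1|].
    replace (eps / 2 * w) with (eps / 2 / (Cmod l + 1) * ((Cmod l + 1) * w)) by (field; lra).
    apply Rmult_le_compat_l; [|exact E4]. left; repeat apply Rdiv_lt_0_compat; lra. }
  assert (P2 : Cmod m * Cmod (f x - f y - l * (x - y)) <= eps / 2 * w).
  { replace (eps / 2 * w) with ((Cmod m + 1) * (eps / 2 / (Cmod m + 1) * w)) by (field; lra).
    apply Rmult_le_compat; try apply Cmod_ge_0; lra. }
  lra.
Qed.

Lemma sdiff_linear (c z : C) : sdiff (fun x => c * x)%C z c.
Proof.
  intros eps He. exists 1. split; [lra|]. intros x y _ _.
  replace (c * x - c * y - c * (x - y))%C with (RtoC 0) by ring. rewrite Cmod_0.
  pose proof (Cmod_ge_0 (x - y)). nra.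
Qed.

Lemma sdiff_scal (c : C) (f : C -> C) (z l : C) : sdiff f z l -> sdiff (fun x => c * f x)%C z (c * l).
Proof. intros H. apply (sdiff_comp f (fun x => c * x)%C); [exact H|apply sdiff_linear]. Qed.

Lemma sdiff_minus (f g : C -> C) (z l m : C) : sdiff f z l -> sdiff g z m ->
  sdiff (fun x => f x - g x)%C z (l - m).
Proof.
  intros Hf Hg. replace (l - m)%C with (l + (-1) * m)%C by ring.
  apply (sdiff_ext_near (fun x => f x + (-1) * g x)%C _ z _ 1 Rlt_0_1); [intros; ring|].
  apply sdiff_plus; [exact Hf|now apply sdiff_scal].
Qed.

Lemma sdiff_square (z : C) : sdiff (fun x => x * x)%C z (2 * z).
Proof.
  intros eps He. exists (eps / 2). split; [lra|]. intros x y Hx Hy.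
  replace (x * x - y * y - 2 * z * (x - y))%C with (((x - z) + (y - z)) * (x - y))%C by ring.
  rewrite Cmod_mult. apply Rmult_le_compat_r; [apply Cmod_ge_0|].
  eapply Rle_trans; [apply Cmod_triangle|]. lra.
Qed.

(** By polarization, f g = ((f + g)^2 - (f - g)^2) / 4. *)
Lemma sdiff_mult (f g : C -> C) (z l m : C) : sdiff f z l -> sdiff g z m ->
  sdiff (fun x => f x * g x)%C z (l * g z + f z * m).
Proof.
  intros Hf Hg.
  assert (Hsq : forall h k, sdiff h z k -> sdiff (fun x => h x * h x)%C z (2 * h z * k)).
  { intros h k Hh. exact (sdiff_comp h (fun x => x * x)%C z k _ Hh (sdiff_square (h z))). }
  replace (l * g z + f z * m)%C
    with (/ 4 * (2 * (f z + g z) * (l + m) - 2 * (f z - g z) * (l - m)))%C by field.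
  apply (sdiff_ext_near (fun x => / 4 * ((f x + g x) * (f x + g x) - (f x - g x) * (f x - g x)))%C _ z _ 1 Rlt_0_1).
  - intros x _. field.
  - apply sdiff_scal, sdiff_minus; apply Hsq; [now apply sdiff_plus|now apply sdiff_minus].
Qed.

Lemma sdiff_inv (z : C) : z <> 0 -> sdiff (fun x => / x)%C z (- / (z * z)).
Proof.
  intros Hz eps He. pose proof (proj1 (Cmod_gt_0 z) Hz) as Hm.
  set (r := Cmod z) in *.
  exists (Rmin (r / 2) (eps * (r * r * r) / 8)). split.
  { apply Rmin_glb_lt; [lra|]. assert (0 < r * r * r) by (repeat apply Rmult_lt_0_compat; lra).
    apply Rdiv_lt_0_compat; [apply Rmult_lt_0_compat; assumption|lra]. }
  set (d := Rmin _ _). intros x y Hx Hy.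
  assert (Hd1 : d <= r / 2) by apply Rmin_l. assert (Hd2 : d <= eps * (r * r * r) / 8) by apply Rmin_r.
  assert (Hlow : forall u, Cmod (u - z) < d -> r / 2 < Cmod u).
  { intros u Hu. assert (r <= Cmod u + Cmod (u - z)); [|lra]. unfold r.
    replace z with (u - (u - z))%C at 1 by ring. apply Cmod_triangle_sub. }
  pose proof (Hlow x Hx) as Lx. pose proof (Hlow y Hy) as Ly.
  assert (x <> 0) by (apply Cmod_gt_0; lra). assert (y <> 0) by (apply Cmod_gt_0; lra).
  replace (/ x - / y - - / (z * z) * (x - y))%C
    with ((x - y) * ((x * (y - z) + z * (x - z)) / (z * z * x * y)))%C by (field; auto).
  rewrite Cmod_mult, Rmult_comm. apply Rmult_le_compat_r; [apply Cmod_ge_0|].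
  rewrite Cmod_div by (repeat apply Cmult_neq_0; assumption).
  rewrite !Cmod_mult. fold r.
  apply Rle_div_l; [repeat apply Rmult_lt_0_compat; lra|].
  eapply Rle_trans; [apply Cmod_triangle|]. rewrite !Cmod_mult. fold r.
  assert (Ux : Cmod x <= 2 * r).
  { replace x with ((x - z) + z)%C by ring. eapply Rle_trans; [apply Cmod_triangle|]. fold r; lra. }
  assert (Cmod x * Cmod (y - z) <= Cmod x * d) by (apply Rmult_le_compat_l; lra).
  assert (r * Cmod (x - z) <= Cmod x * 2 * d).
  { apply Rle_trans with (r * d); [apply Rmult_le_compat_l; lra|]. apply Rmult_le_compat_r; [|lra].
    pose proof (Cmod_ge_0 (x-z)). lra. }
  assert (Hk : 3 * d <= eps * (r * r * Cmod y)).
  { assert (eps * (r * r * (r / 2)) <= eps * (r * r * Cmod y)).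
    { repeat apply Rmult_le_compat_l; try nra. }
    assert (0 < eps * (r * r * r)) by (repeat apply Rmult_lt_0_compat; lra).
    lra. }
  assert (Cmod x * (3 * d) <= Cmod x * (eps * (r * r * Cmod y))) by (apply Rmult_le_compat_l; lra).
  lra.
Qed.

(** Used for the logarithm, whose derivative is then forced by that of the exponential. *)
Lemma sdiff_right_inverse (f g : C -> C) (z l : C) (d : R) : 0 < d -> ccont g z ->
  (forall x, Cmod (x - z) < d -> f (g x) = x) -> l <> 0 -> sdiff f (g z) l -> sdiff g z (/ l).
Proof.
  intros Hd Hg E Hl Hf eps He. pose proof (proj1 (Cmod_gt_0 l) Hl) as Hm.
  set (r := Cmod l) in *.
  set (e := Rmin (r / 2) (eps * (r * r) / 2)).
  assert (Hepos : 0 < e).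
  { apply Rmin_glb_lt; [lra|]. assert (0 < r * r) by nra. apply Rdiv_lt_0_compat; [|lra]. nra. }
  destruct (Hf e Hepos) as (d1 & Hd1 & H1).
  destruct (Hg d1 Hd1) as (d2 & Hd2 & H2).
  exists (Rmin d d2). split; [now apply Rmin_glb_lt|]. intros x y Hx Hy.
  assert (Hx1 := Rlt_le_trans _ _ _ Hx (Rmin_l _ _)). assert (Hx2 := Rlt_le_trans _ _ _ Hx (Rmin_r _ _)).
  assert (Hy1 := Rlt_le_trans _ _ _ Hy (Rmin_l _ _)). assert (Hy2 := Rlt_le_trans _ _ _ Hy (Rmin_r _ _)).
  specialize (H1 (g x) (g y) (H2 x Hx2) (H2 y Hy2)). rewrite !E in H1 by assumption.
  assert (Hg1 : r * Cmod (g x - g y) <= 2 * Cmod (x - y)).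
  { unfold r. rewrite <- Cmod_mult.
    replace (l * (g x - g y))%C with ((x - y) - (x - y - l * (g x - g y)))%C by ring.
    pose proof (Cmod_triangle_sub (x - y) (x - y - l * (g x - g y))) as T.
    assert (e * Cmod (g x - g y) <= r / 2 * Cmod (g x - g y)).
    { apply Rmult_le_compat_r; [apply Cmod_ge_0|apply Rmin_l]. }
    assert (T2 : r * Cmod (g x - g y) <= Cmod (x - y) + Cmod (x - y - l * (g x - g y))).
    { unfold r. rewrite <- Cmod_mult.
      replace (l * (g x - g y))%C with ((x - y) - (x - y - l * (g x - g y)))%C at 1 by ring. exact T. }
    eapply Rle_trans; [exact T|]. fold r in T2. lra. }
  replace (g x - g y - / l * (x - y))%C with (- (/ l * (x - y - l * (g x - g y))))%C
    by (field; exact Hl).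
  rewrite Cmod_opp, Cmod_mult, Cmod_inv by exact Hl. fold r.
  assert (H3 : e * Cmod (g x - g y) <= eps * (r * r) / 2 * Cmod (g x - g y)).
  { apply Rmult_le_compat_r; [apply Cmod_ge_0|apply Rmin_r]. }
  apply (Rmult_le_reg_l r); [exact Hm|]. rewrite <- Rmult_assoc, Rinv_r, Rmult_1_l by lra.
  eapply Rle_trans; [exact H1|]. eapply Rle_trans; [exact H3|].
  assert (eps * r * (r * Cmod (g x - g y)) <= eps * r * (2 * Cmod (x - y))).
  { apply Rmult_le_compat_l; [|exact Hg1]. nra. }
  lra.
Qed.

Lemma small_of_derivative (f : R -> R) (l : R) : derivable_pt_lim f 0 l -> f 0 = 0 ->
  forall eps, 0 < eps -> exists d, 0 < d /\ forall h, Rabs h < d -> Rabs (f h - l * h) <= eps * Rabs h.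
Proof.
  intros H H0 eps He. destruct (H eps He) as [d Hd]. exists d. split; [apply cond_pos|].
  intros h Hh. destruct (Req_dec h 0) as [->|Hn].
  - rewrite H0, Rmult_0_r, Rminus_0_r, Rabs_R0. lra.
  - specialize (Hd h Hn Hh). rewrite Rplus_0_l, H0, Rminus_0_r in Hd.
    replace (f h - l * h) with ((f h / h - l) * h) by (field; exact Hn).
    rewrite Rabs_mult. apply Rmult_le_compat_r; [apply Rabs_pos|lra].
Qed.

(** From the real derivatives of exp, cos and sin at 0, applied to the two components. *)
Lemma Cexp_near_0 (eps : R) : 0 < eps ->
  exists d, 0 < d /\ forall w, Cmod w < d -> Cmod (Cexp w - 1 - w) <= eps * Cmod w.
Proof.
  intros He. set (e := Rmin 1 (eps / 8)).
  assert (Hepos : 0 < e) by (apply Rmin_glb_lt; lra).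
  assert (He1 : e <= 1) by apply Rmin_l. assert (He2 : e <= eps / 8) by apply Rmin_r.
  clearbody e.
  destruct (small_of_derivative (fun h => exp h - 1) 1) with (eps := e) as (d1 & Hd1 & H1).
  { replace 1 with (exp 0 - 0) by (rewrite exp_0; ring). apply derivable_pt_lim_minus.
    - apply derivable_pt_lim_exp. - rewrite exp_0. apply derivable_pt_lim_const. }
  { rewrite exp_0; ring. } { exact Hepos. }
  destruct (small_of_derivative (fun h => cos h - 1) 0) with (eps := e) as (d2 & Hd2 & H2).
  { replace 0 with (- sin 0 - 0) at 2 by (rewrite sin_0; ring). apply derivable_pt_lim_minus.
    - apply derivable_pt_lim_cos. - apply derivable_pt_lim_const. }
  { rewrite cos_0; ring. } { exact Hepos. }
  destruct (small_of_derivative sin 1) with (eps := e) as (d3 & Hd3 & H3).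
  { rewrite <- cos_0. apply derivable_pt_lim_sin. } { apply sin_0. } { exact Hepos. }
  set (d := Rmin (Rmin d1 d2) (Rmin d3 e)).
  assert (Hdd : d <= d1 /\ d <= d2 /\ d <= d3 /\ d <= e).
  { unfold d. repeat split; unfold Rmin; repeat destruct Rle_dec; lra. }
  exists d. split; [unfold d; repeat apply Rmin_glb_lt; assumption|].
  intros w Hw. destruct w as [a b].
  pose proof (re_le_Cmod (a, b)) as Ha. pose proof (im_le_Cmod (a, b)) as Hb. simpl in Ha, Hb.
  set (m := Cmod (a, b)) in *.
  specialize (H1 a ltac:(lra)). specialize (H2 b ltac:(lra)). specialize (H3 b ltac:(lra)).
  pose proof (Rabs_pos a); pose proof (Rabs_pos b).
  assert (T1 : Rabs (exp a - 1 - 1 * a) <= e * m) by nra.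
  assert (T2 : Rabs (cos b - 1 - 0 * b) <= e * m) by nra.
  assert (T3 : Rabs (sin b - 1 * b) <= e * m) by nra.
  assert (Hc : Rabs (cos b) <= 1).
  { pose proof (COS_bound b). apply Rabs_le. lra. }
  assert (Hs : Rabs (sin b) <= m + e * m).
  { replace (sin b) with ((sin b - 1 * b) + b) by ring. eapply Rle_trans; [apply Rabs_triang|]. lra. }
  assert (Hea : Rabs (exp a - 1) <= 2 * e).
  { replace (exp a - 1) with ((exp a - 1 - 1 * a) + a) by ring. eapply Rle_trans; [apply Rabs_triang|]. nra. }
  eapply Rle_trans; [apply Cmod_le_add_abs|]. unfold Cexp; simpl.
  assert (Q1 : Rabs (exp a * cos b + - (1) + - a) <= e * m + 2 * (e * m)).
  { replace (exp a * cos b + - (1) + - a)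
      with ((exp a - 1 - 1 * a) * cos b + (1 + a) * (cos b - 1 - 0 * b)) by ring.
    eapply Rle_trans; [apply Rabs_triang|]. rewrite !Rabs_mult.
    assert (Rabs (1 + a) <= 2).
    { eapply Rle_trans; [apply Rabs_triang|]. rewrite Rabs_R1. lra. }
    pose proof (Rabs_pos (exp a - 1 - 1 * a)). pose proof (Rabs_pos (cos b - 1 - 0 * b)). nra. }
  assert (Q2 : Rabs (exp a * sin b + - 0 + - b) <= 5 * (e * m)).
  { replace (exp a * sin b + - 0 + - b) with ((exp a - 1) * sin b + (sin b - 1 * b)) by ring.
    eapply Rle_trans; [apply Rabs_triang|]. rewrite Rabs_mult.
    assert (Rabs (exp a - 1) * Rabs (sin b) <= 2 * e * (m + e * m)).
    { apply Rmult_le_compat; try apply Rabs_pos; lra. }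
    assert (0 <= m) by apply Cmod_ge_0. assert (0 <= e * m) by nra.
    assert (2 * e * (m + e * m) <= 2 * e * (m + m)) by nra.
    nra. }

  assert (0 <= m) by apply Cmod_ge_0.
  assert (8 * (e * m) <= eps * m) by nra. fold m. lra.
Qed.

Lemma sdiff_Cexp (z : C) : sdiff Cexp z (Cexp z).
Proof.
  assert (Hc : ccont Cexp z).
  { intros eps He. pose proof (Cmod_ge_0 (Cexp z)) as Hz.
    destruct (Cexp_near_0 1 Rlt_0_1) as (d & Hd & H).
    exists (Rmin d (eps / (2 * (Cmod (Cexp z) + 1)))). split.
    - apply Rmin_glb_lt; [lra|]. apply Rdiv_lt_0_compat; lra.
    - intros x Hx. assert (H1 := Rlt_le_trans _ _ _ Hx (Rmin_l _ _)).
      assert (H2 := Rlt_le_trans _ _ _ Hx (Rmin_r _ _)). specialize (H _ H1).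
      replace (Cexp x) with (Cexp z * Cexp (x - z))%C
        by (rewrite <- Cexp_plus; f_equal; ring).
      replace (Cexp z * Cexp (x - z) - Cexp z)%C
        with (Cexp z * ((Cexp (x - z) - 1 - (x - z)) + (x - z)))%C by ring.
      rewrite Cmod_mult. apply Rlt_div_r in H2; [|lra].
      pose proof (Cmod_triangle (Cexp (x - z) - 1 - (x - z)) (x - z)) as T.
      pose proof (Cmod_ge_0 (x - z)).
      apply Rle_lt_trans with (Cmod (Cexp z) * (2 * Cmod (x - z))).
      + apply Rmult_le_compat_l; lra.
      + nra. }
  intros eps He. set (A := Cmod (Cexp z) + 1).
  assert (HA : 0 < A) by (unfold A; pose proof (Cmod_ge_0 (Cexp z)); lra).
  destruct (Cexp_near_0 (eps / 2 / A)) as (d1 & Hd1 & H1); [repeat apply Rdiv_lt_0_compat; lra|].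
  destruct (Hc (Rmin 1 (eps / 2))) as (d2 & Hd2 & H2); [apply Rmin_glb_lt; lra|].
  exists (Rmin (d1 / 2) d2). split; [apply Rmin_glb_lt; lra|].
  intros x y Hx Hy.
  assert (Hx1 := Rlt_le_trans _ _ _ Hx (Rmin_l _ _)).
  assert (Hy1 := Rlt_le_trans _ _ _ Hy (Rmin_l _ _)). assert (Hy2 := Rlt_le_trans _ _ _ Hy (Rmin_r _ _)).
  assert (Hxy : Cmod (x - y) < d1).
  { replace (x - y)%C with ((x - z) - (y - z))%C by ring.
    eapply Rle_lt_trans; [apply Cmod_triangle_sub|]. lra. }
  specialize (H1 _ Hxy). specialize (H2 _ Hy2).
  pose proof (Rmin_l 1 (eps / 2)). pose proof (Rmin_r 1 (eps / 2)).
  replace (Cexp x) with (Cexp y * Cexp (x - y))%C by (rewrite <- Cexp_plus; f_equal; ring).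
  replace (Cexp y * Cexp (x - y) - Cexp y - Cexp z * (x - y))%C
    with (Cexp y * (Cexp (x - y) - 1 - (x - y)) + (Cexp y - Cexp z) * (x - y))%C by ring.
  eapply Rle_trans; [apply Cmod_triangle|]. rewrite !Cmod_mult.
  set (w := Cmod (x - y)) in *. assert (Hw : 0 <= w) by apply Cmod_ge_0.
  assert (Hy3 : Cmod (Cexp y) <= A).
  { replace (Cexp y) with ((Cexp y - Cexp z) + Cexp z)%C by ring.
    eapply Rle_trans; [apply Cmod_triangle|]. unfold A; lra. }
  assert (Cmod (Cexp y) * Cmod (Cexp (x - y) - 1 - (x - y)) <= A * (eps / 2 / A * w)).
  { apply Rmult_le_compat; try apply Cmod_ge_0; lra. }
  replace (A * (eps / 2 / A * w)) with (eps / 2 * w) in * by (field; lra).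
  assert (Cmod (Cexp y - Cexp z) * w <= eps / 2 * w) by (apply Rmult_le_compat_r; lra).
  lra.
Qed.

Lemma continuous_eps (f : C -> R) (z : C) :
  continuous (T := C_UniformSpace) (U := R_UniformSpace) f z ->
  forall eps, 0 < eps -> exists d, 0 < d /\ forall x, Cmod (x - z) < d -> Rabs (f x - f z) < eps.
Proof.
  intros H eps He.
  destruct (proj1 (filterlim_locally _ _) H (mkposreal eps He)) as [d Hd].
  exists d. split; [apply cond_pos|]. intros x Hx.
  apply (Hd x). apply C_NormedModule_mixin_compat1. exact Hx.
Qed.

Lemma slit_open (z : C) : slit z -> exists d, 0 < d /\ forall x, Cmod (x - z) < d -> slit x.
Proof.
  intros Hz. destruct (Req_dec (Im z) 0) as [E|E].
  - exists (Re z). assert (Hp : 0 < Re z).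
    { destruct (Rle_or_lt (Re z) 0); [exfalso; apply Hz; auto|assumption]. }
    split; [exact Hp|]. intros x Hx. apply slit_Re_pos.
    pose proof (re_le_Cmod (x - z)) as H. unfold Cminus in H. rewrite re_plus, re_opp in H.
    pose proof (Rabs_le_between (Re x + - Re z) (Cmod (x - z))) as [Q _]. unfold Cminus in *.
    specialize (Q H). lra.
  - exists (Rabs (Im z)). split; [now apply Rabs_pos_lt|]. intros x Hx [H1 H2].
    pose proof (im_le_Cmod (x - z)) as H. unfold Cminus in H. rewrite im_plus, im_opp, H1 in H.
    rewrite Rplus_0_l, Rabs_Ropp in H. unfold Cminus in Hx. lra.
Qed.

Lemma continuous_Re (z : C) : continuous (T := C_UniformSpace) (U := R_UniformSpace) Re z.
Proof. destruct z. apply (continuous_fst (U := R_UniformSpace) (V := R_UniformSpace)). Qed.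

Lemma continuous_Im (z : C) : continuous (T := C_UniformSpace) (U := R_UniformSpace) Im z.
Proof. destruct z. apply (continuous_snd (U := R_UniformSpace) (V := R_UniformSpace)). Qed.

Lemma ccont_Cln (z : C) : slit z -> ccont Cln z.
Proof.
  intros Hz eps He. pose proof (slit_neq_0 z Hz) as Hz0.
  pose proof (proj1 (Cmod_gt_0 z) Hz0) as Hm.
  assert (Hp : 0 < Cmod z + Re z).
  { pose proof (Cmod_sqr z) as Hsq. destruct (Req_dec (Im z) 0) as [E|E].
    - destruct (Rle_or_lt (Re z) 0); [exfalso; apply Hz; auto|lra].
    - assert (0 < Im z * Im z) by nra. nra. }
  assert (Cm : continuous (T := C_UniformSpace) (U := R_UniformSpace) Cmod z).
  { apply (continuous_comp (U := C_UniformSpace) (V := R_UniformSpace) (W := R_UniformSpace)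
             (fun x : C => Re x ^ 2 + Im x ^ 2) sqrt).
    - apply (continuous_plus (U := C_UniformSpace) (V := R_NormedModule)).
      + apply (continuous_comp (U := C_UniformSpace) (V := R_UniformSpace) (W := R_UniformSpace) Re (fun u => u ^ 2));
          [apply continuous_Re|apply (ex_derive_continuous (V := R_NormedModule)); auto_derive; auto].
      + apply (continuous_comp (U := C_UniformSpace) (V := R_UniformSpace) (W := R_UniformSpace) Im (fun u => u ^ 2));
          [apply continuous_Im|apply (ex_derive_continuous (V := R_NormedModule)); auto_derive; auto].
    - apply continuous_sqrt. }
  assert (Cre : continuous (T := C_UniformSpace) (U := R_UniformSpace) Re z)
    by apply continuous_Re.
  assert (Cim : continuous (T := C_UniformSpace) (U := R_UniformSpace) Im z)
    by apply continuous_Im.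
  assert (C1 : continuous (T := C_UniformSpace) (U := R_UniformSpace) (fun x => ln (Cmod x)) z).
  { apply (continuous_comp (U := C_UniformSpace) (V := R_UniformSpace) (W := R_UniformSpace) Cmod ln); [exact Cm|].
    apply (ex_derive_continuous (V := R_NormedModule)). auto_derive. exact Hm. }
  assert (C2 : continuous (T := C_UniformSpace) (U := R_UniformSpace)
                 (fun x => 2 * atan (Im x * / (Cmod x + Re x))) z).
  { apply (continuous_comp (U := C_UniformSpace) (V := R_UniformSpace) (W := R_UniformSpace)
             (fun x => Im x * / (Cmod x + Re x)) (fun u => 2 * atan u)).
    - apply (continuous_mult (U := C_UniformSpace) (K := R_AbsRing)); [exact Cim|].
      apply (continuous_comp (U := C_UniformSpace) (V := R_UniformSpace) (W := R_UniformSpace)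
               (fun x => Cmod x + Re x) Rinv).
      + apply (continuous_plus (U := C_UniformSpace) (V := R_NormedModule)); assumption.
      + apply (ex_derive_continuous (V := R_NormedModule)). auto_derive. lra.
    - apply (ex_derive_continuous (V := R_NormedModule)). auto_derive. auto. }
  destruct (continuous_eps _ _ C1 (eps / 2)) as (d1 & Hd1 & H1); [lra|].
  destruct (continuous_eps _ _ C2 (eps / 2)) as (d2 & Hd2 & H2); [lra|].
  destruct (slit_open z Hz) as (d3 & Hd3 & H3).
  exists (Rmin d3 (Rmin d1 d2)). split; [repeat apply Rmin_glb_lt; assumption|].
  intros x Hx.
  assert (x3 := Rlt_le_trans _ _ _ Hx (Rmin_l _ _)).
  assert (x12 := Rlt_le_trans _ _ _ Hx (Rmin_r _ _)).
  assert (x1 := Rlt_le_trans _ _ _ x12 (Rmin_l _ _)).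
  assert (x2 := Rlt_le_trans _ _ _ x12 (Rmin_r _ _)).
  specialize (H1 x x1). specialize (H2 x x2). specialize (H3 x x3).
  rewrite (Cln_half_angle x H3), (Cln_half_angle z Hz).
  eapply Rle_lt_trans; [apply Cmod_le_add_abs|]. simpl. unfold Rdiv, Rminus in *. lra.
Qed.

Lemma sdiff_Cln (z : C) : slit z -> sdiff Cln z (/ z).
Proof.
  intros Hz. destruct (slit_open z Hz) as (d & Hd & Ho).
  pose proof (slit_neq_0 z Hz) as H0.
  apply (sdiff_right_inverse Cexp Cln z z d Hd (ccont_Cln z Hz)); [|exact H0|].
  - intros x Hx. apply Cexp_Cln, slit_neq_0, Ho, Hx.
  - rewrite <- (Cexp_Cln z H0) at 2. apply sdiff_Cexp.
Qed.

Lemma sdiff_Cpower (s z : C) : slit z -> sdiff (fun x => Cpower x s) z (s * Cpower z (s - 1)).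
Proof.
  intros Hz. pose proof (slit_neq_0 z Hz) as H0.
  assert (E : (s * Cpower z (s - 1))%C = (Cexp (s * Cln z) * (0 * Cln z + s * / z))%C).
  { unfold Cminus. rewrite Cpower_plus, Cpower_opp, Cpower_1 by exact H0.
    unfold Cpower. field. exact H0. }
  rewrite E. unfold Cpower.
  apply (sdiff_comp (fun x => s * Cln x)%C Cexp); [|apply sdiff_Cexp].
  apply sdiff_mult; [apply sdiff_const|now apply sdiff_Cln].
Qed.

Lemma sdiff_div (f g : C -> C) (z l m : C) : sdiff f z l -> sdiff g z m -> g z <> 0 ->
  sdiff (fun x => f x / g x)%C z (l * / g z + f z * (- / (g z * g z) * m)).
Proof.
  intros Hf Hg H0. apply (sdiff_mult f (fun x => / g x)%C); [exact Hf|].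
  apply (sdiff_comp g (fun x => / x)%C); [exact Hg|]. now apply sdiff_inv.
Qed.

Definition cdiff (f : C -> C) (z : C) : Prop := exists l, sdiff f z l.

(** The strict estimate at z constrains the derivatives at all nearby points, by letting the two
    points of the quotient merge there. *)
Lemma sdiff_slope_close (f : C -> C) (z l p m : C) (eps d : R) : 0 < eps ->
  (forall x y : C, Cmod (x - z) < d -> Cmod (y - z) < d ->
     Cmod (f x - f y - l * (x - y)) <= eps * Cmod (x - y)) ->
  Cmod (p - z) < d -> sdiff f p m -> Cmod (m - l) <= eps.
Proof.
  intros He H Hp Hm. apply le_epsilon. intros eta Heta.
  destruct (Hm eta Heta) as (d1 & Hd1 & H1).
  set (h := Rmin (d1 / 2) ((d - Cmod (p - z)) / 2)).
  assert (Hh : 0 < h) by (apply Rmin_glb_lt; lra).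
  assert (Hh1 : h <= d1 / 2) by apply Rmin_l. assert (Hh2 : h <= (d - Cmod (p - z)) / 2) by apply Rmin_r.
  assert (Em : Cmod (p + h - p) = h).
  { replace (p + h - p)%C with (RtoC h) by ring. rewrite Cmod_R. apply Rabs_pos_eq. lra. }
  assert (Q1 : Cmod (f (p + h)%C - f p - m * (p + h - p)) <= eta * h).
  { rewrite <- Em at 3. apply H1; [lra|rewrite Cmod_diag; lra]. }
  assert (Q2 : Cmod (f (p + h)%C - f p - l * (p + h - p)) <= eps * h).
  { rewrite <- Em at 3. apply H; [|lra].
    replace (p + h - z)%C with ((p - z) + h)%C by ring. eapply Rle_lt_trans; [apply Cmod_triangle|].
    rewrite Cmod_R, Rabs_pos_eq by lra. lra. }
  apply (Rmult_le_reg_r h); [exact Hh|]. rewrite <- Em at 1. rewrite <- Cmod_mult.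
  replace ((m - l) * (p + h - p))%C
    with ((f (p + h)%C - f p - l * (p + h - p)) - (f (p + h)%C - f p - m * (p + h - p)))%C by ring.
  eapply Rle_trans; [apply Cmod_triangle_sub|]. lra.
Qed.

Lemma sdiff_unique (f : C -> C) (z l m : C) : sdiff f z l -> sdiff f z m -> l = m.
Proof.
  intros Hl Hm. apply Ceq_minus, Cmod_eq_0, Rle_antisym; [|apply Cmod_ge_0]. apply le_epsilon. intros eps He.
  destruct (Hm eps He) as (d & Hd & H). rewrite Rplus_0_l.
  apply (sdiff_slope_close f z m z l eps d He H); [rewrite Cmod_diag; exact Hd|exact Hl].
Qed.

(** * Complex series *)

Definition cser (a : nat -> C) (l : C) : Prop := is_series (K := C_AbsRing) (V := C_NormedModule) a l.

Definition csum (a : nat -> C) (n : nat) : C := sum_n (G := C_AbelianMonoid) a n.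

Lemma csum_0 (a : nat -> C) : csum a 0 = a O.
Proof. apply sum_O. Qed.

Lemma csum_S (a : nat -> C) (n : nat) : csum a (S n) = (csum a n + a (S n))%C.
Proof. exact (sum_Sn (G := C_AbelianMonoid) a n). Qed.

Lemma filterlim_C_eps {T : Type} (F : (T -> Prop) -> Prop) (FF : Filter F) (f : T -> C) (l : C) :
  filterlim f F (locally (T := C_UniformSpace) l) <->
  (forall eps, 0 < eps -> F (fun x => Cmod (f x - l) < eps)).
Proof.
  split.
  - intros H eps He.
    apply (proj1 (filterlim_locally_ball_norm (K := C_AbsRing) (U := C_NormedModule) f l) H (mkposreal eps He)).
  - intros H. apply (filterlim_locally_ball_norm (K := C_AbsRing) (U := C_NormedModule)).
    intros [eps He]. apply (H eps He).
Qed.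

Lemma cser_eps (a : nat -> C) (l : C) :
  cser a l <-> forall eps, 0 < eps -> exists N, forall n, (N <= n)%nat -> Cmod (csum a n - l) < eps.
Proof. apply (filterlim_C_eps eventually _). Qed.

Lemma cser_unique (a : nat -> C) (l m : C) : cser a l -> cser a m -> l = m.
Proof. intros H1 H2. exact (filterlim_locally_unique (V := C_NormedModule) _ _ _ H1 H2). Qed.

Lemma cser_ext (a b : nat -> C) (l : C) : (forall n, a n = b n) -> cser a l -> cser b l.
Proof. intros E. apply is_series_ext. exact E. Qed.

Lemma cser_plus (a b : nat -> C) (l m : C) : cser a l -> cser b m -> cser (fun n => a n + b n)%C (l + m).
Proof. apply (is_series_plus (K := C_AbsRing) (V := C_NormedModule)). Qed.

Lemma cser_scal (c : C) (a : nat -> C) (l : C) : cser a l -> cser (fun n => c * a n)%C (c * l).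
Proof. apply (is_series_scal (K := C_AbsRing) (V := C_NormedModule) c). Qed.

Lemma cser_incr_1 (a : nat -> C) (l : C) : cser a l -> cser (fun n => a (S n)) (l - a O).
Proof.
  intros H. apply (is_series_incr_1 (K := C_AbsRing) (V := C_NormedModule)).
  change (cser a ((l - a O) + a O)%C).
  replace ((l - a O) + a O)%C with l by ring. exact H.
Qed.

Lemma cser_decr_1 (a : nat -> C) (l : C) : cser (fun n => a (S n)) (l - a O) -> cser a l.
Proof.
  intros H. apply (is_series_decr_1 (K := C_AbsRing) (V := C_NormedModule)). exact H.
Qed.

Lemma csum_ext_le (a b : nat -> C) (n : nat) : (forall k, (k <= n)%nat -> a k = b k) -> csum a n = csum b n.
Proof. apply sum_n_ext_loc. Qed.

Lemma csum_scal (c : C) (a : nat -> C) (n : nat) : csum (fun k => c * a k)%C n = (c * csum a n)%C.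
Proof.
  induction n as [|n IH]; [rewrite !csum_0; reflexivity|]. rewrite !csum_S, IH. ring.
Qed.

Lemma csum_plus (a b : nat -> C) (n : nat) : csum (fun k => a k + b k)%C n = (csum a n + csum b n)%C.
Proof.
  induction n as [|n IH]; [rewrite !csum_0; reflexivity|]. rewrite !csum_S, IH. ring.
Qed.

Lemma csum_shift (a : nat -> C) (n : nat) : csum a (S n) = (a O + csum (fun k => a (S k)) n)%C.
Proof.
  induction n as [|n IH].
  - rewrite csum_S, !csum_0. reflexivity.
  - rewrite csum_S, IH, csum_S. ring.
Qed.

Lemma geometric_gap (a : nat -> C) (M q : R) (n m : nat) : 0 <= q < 1 -> 0 <= M ->
  (forall k, (n < k)%nat -> Cmod (a k) <= M * q ^ k) ->
  Cmod (csum a (n + m) - csum a n) <= M * q ^ (S n) / (1 - q).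
Proof.
  intros Hq HM H.
  assert (Hg : Cmod (csum a (n + m) - csum a n) <= M * q ^ (S n) * (1 - q ^ m) / (1 - q)).
  { induction m as [|m IH].
    - rewrite Nat.add_0_r, Cmod_diag. simpl. replace (1 - 1) with 0 by ring.
      unfold Rdiv. rewrite Rmult_0_r, Rmult_0_l. lra.
    - replace (n + S m)%nat with (S (n + m)) by lia. rewrite csum_S.
      replace (csum a (n + m) + a (S (n + m)) - csum a n)%C
        with ((csum a (n + m) - csum a n) + a (S (n + m)))%C by ring.
      eapply Rle_trans; [apply Cmod_triangle|].
      specialize (H (S (n + m)) ltac:(lia)).
      assert (E : M * q ^ S n * (1 - q ^ S m) / (1 - q)
                = M * q ^ S n * (1 - q ^ m) / (1 - q) + M * q ^ S (n + m)).
      { simpl. rewrite pow_add. field. lra. }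
      lra. }
  eapply Rle_trans; [exact Hg|]. unfold Rdiv.
  apply Rmult_le_compat_r; [left; apply Rinv_0_lt_compat; lra|].
  pose proof (pow_le q m (proj1 Hq)). pose proof (pow_le q (S n) (proj1 Hq)).
  assert (0 <= M * q ^ S n) by nra. nra.
Qed.

Lemma cser_tail (a : nat -> C) (l : C) (M q : R) (n : nat) : 0 <= q < 1 -> 0 <= M ->
  (forall k, (n < k)%nat -> Cmod (a k) <= M * q ^ k) -> cser a l ->
  Cmod (csum a n - l) <= M * q ^ (S n) / (1 - q).
Proof.
  intros Hq HM H Hl. apply le_epsilon. intros eps He.
  destruct (proj1 (cser_eps a l) Hl eps He) as [N HN].
  specialize (HN (n + N)%nat ltac:(lia)).
  pose proof (geometric_gap a M q n N Hq HM H) as G.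
  replace (csum a n - l)%C with ((csum a (n + N) - l) - (csum a (n + N) - csum a n))%C by ring.
  eapply Rle_trans; [apply Cmod_triangle_sub|]. lra.
Qed.

Lemma cser_geometric_ex (a : nat -> C) (M q : R) : 0 <= q < 1 ->
  (forall k, Cmod (a k) <= M * q ^ k) -> exists l, cser a l.
Proof.
  intros Hq H.
  destruct (ex_series_le (K := C_AbsRing) (V := C_CompleteNormedModule) a (fun k => M * q ^ k)) as [l Hl].
  - exact H.
  - apply (ex_series_scal (K := R_AbsRing) (V := R_NormedModule) M). exists (/ (1 - q)).
    apply is_series_geom. rewrite Rabs_pos_eq; lra.
  - exists l. exact Hl.
Qed.

Lemma cser_terms_bounded (a : nat -> C) (l : C) : cser a l -> exists M, 0 < M /\ forall n, Cmod (a n) <= M.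
Proof.
  intros H. destruct (proj1 (cser_eps a l) H 1 Rlt_0_1) as [N HN].
  assert (Hs : exists B, 0 < B /\ forall n, Cmod (csum a n) <= B).
  { assert (HB : exists B, 0 < B /\ forall n, (n <= N)%nat -> Cmod (csum a n) <= B).
    { clear HN. induction N as [|N [B [HB1 HB]]].
      - exists (Cmod (csum a 0) + 1). split; [pose proof (Cmod_ge_0 (csum a 0)); lra|].
        intros n Hn. replace n with O by lia. lra.
      - exists (B + Cmod (csum a (S N))). split; [pose proof (Cmod_ge_0 (csum a (S N))); lra|].
        intros n Hn. destruct (Nat.eq_dec n (S N)) as [->|Hne]; [lra|].
        specialize (HB n ltac:(lia)). pose proof (Cmod_ge_0 (csum a (S N))); lra. }
    destruct HB as [B [HB1 HB]]. exists (B + Cmod l + 1).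
    pose proof (Cmod_ge_0 l). split; [lra|]. intros n.
    destruct (Nat.le_gt_cases N n) as [Hn|Hn].
    - specialize (HN n Hn). replace (csum a n) with ((csum a n - l) + l)%C by ring.
      eapply Rle_trans; [apply Cmod_triangle|]. lra.
    - specialize (HB n ltac:(lia)). lra. }
  destruct Hs as [B [HB1 HB]]. exists (2 * B). split; [lra|].
  intros [|n].
  - specialize (HB O). rewrite csum_0 in HB. lra.
  - replace (a (S n)) with (csum a (S n) - csum a n)%C by (rewrite csum_S; ring).
    eapply Rle_trans; [apply Cmod_triangle_sub|]. pose proof (HB (S n)). pose proof (HB n). lra.
Qed.

(** * Power series *)

Lemma pow_n_Cpow (z : C) (n : nat) : pow_n (K := C_Ring) z n = (z ^ n)%C.
Proof. induction n as [|n IH]; [reflexivity|]. rewrite Cpow_S, <- IH. reflexivity. Qed.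

Lemma is_pseries_cser (a : nat -> C) (z l : C) :
  is_pseries (K := C_AbsRing) (V := C_NormedModule) a z l <-> cser (fun n => a n * z ^ n)%C l.
Proof.
  unfold is_pseries.
  assert (E : forall n, (pow_n (K := C_Ring) z n * a n = a n * z ^ n)%C).
  { intros n. rewrite pow_n_Cpow. ring. }
  split; apply is_series_ext; intros n.
  - exact (E n).
  - symmetry. exact (E n).
Qed.

Definition power_series_on (r : R) (a : nat -> C) (f : C -> C) : Prop :=
  forall z, Cmod z < r -> cser (fun n => a n * z ^ n)%C (f z).

Lemma power_series_bound (r rho : R) (a : nat -> C) (f : C -> C) : 0 < rho < r ->
  power_series_on r a f -> exists M, 0 < M /\ forall n, Cmod (a n) <= M / rho ^ n.
Proof.
  intros Hr H.
  destruct (cser_terms_bounded _ _ (H (RtoC rho) ltac:(rewrite Cmod_R, Rabs_pos_eq; lra))) as [M [HM HMn]].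
  exists M. split; [exact HM|]. intros n. specialize (HMn n).
  rewrite Cmod_mult, Cmod_pow, Cmod_R, Rabs_pos_eq in HMn by lra.
  apply Rle_div_r; [apply pow_lt; lra|exact HMn].
Qed.

Lemma Cpow_diff_bound (x y : C) (d : R) (n : nat) : Cmod x <= d -> Cmod y <= d ->
  Cmod (x ^ S n - y ^ S n) <= INR (S n) * d ^ n * Cmod (x - y).
Proof.
  intros Hx Hy. assert (Hd : 0 <= d) by (pose proof (Cmod_ge_0 x); lra).
  induction n as [|n IH].
  - rewrite !Cpow_1_r. simpl. lra.
  - rewrite (Cpow_S x (S n)), (Cpow_S y (S n)).
    replace (x * x ^ S n - y * y ^ S n)%C with (x * (x ^ S n - y ^ S n) + (x - y) * y ^ S n)%C by ring.
    eapply Rle_trans; [apply Cmod_triangle|]. rewrite !Cmod_mult, Cmod_pow.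
    assert (Cmod x * Cmod (x ^ S n - y ^ S n) <= d * (INR (S n) * d ^ n * Cmod (x - y))).
    { apply Rmult_le_compat; try apply Cmod_ge_0; assumption. }
    assert (Cmod (x - y) * Cmod y ^ S n <= Cmod (x - y) * d ^ S n).
    { apply Rmult_le_compat_l; [apply Cmod_ge_0|]. apply pow_incr. split; [apply Cmod_ge_0|exact Hy]. }
    rewrite (S_INR (S n)). simpl (d ^ S n) in *. nra.
Qed.

Lemma INR_le_pow2 (n : nat) : INR n <= 2 ^ n.
Proof.
  induction n as [|n IH]; [simpl; lra|]. rewrite S_INR. simpl.
  pose proof (pow_R1_Rle 2 n ltac:(lra)). lra.
Qed.

(** Beyond the linear term, the difference of the n-th powers is at most n d^(n-1) |x - y| on
    the disc of radius d; a geometric majorant makes the sum small against |x - y|. *)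
Lemma power_series_sdiff_0 (r : R) (a : nat -> C) (f : C -> C) : 0 < r ->
  power_series_on r a f -> sdiff f 0 (a 1%nat).
Proof.
  intros Hr H.
  destruct (power_series_bound r (r / 2) a f ltac:(lra) H) as [M [HM Ha]].
  set (R0 := r / 2) in *. assert (HR : 0 < R0) by (unfold R0; lra).
  intros eps He. set (q := Rmin (1 / 2) (eps * R0 / (4 * M))).
  assert (Hq : 0 < q).
  { apply Rmin_glb_lt; [lra|]. apply Rdiv_lt_0_compat; nra. }
  assert (Hq1 : q <= 1 / 2) by apply Rmin_l. assert (Hq2 : q <= eps * R0 / (4 * M)) by apply Rmin_r.
  set (d := q * R0 / 2). assert (Hd : 0 < d) by (unfold d; nra).
  assert (Hdr : d < r) by (unfold d, R0 in *; nra).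
  exists d. split; [exact Hd|]. intros x y Hx Hy.
  replace (x - 0)%C with x in Hx by ring. replace (y - 0)%C with y in Hy by ring.
  pose proof (H x ltac:(lra)) as Sx. pose proof (H y ltac:(lra)) as Sy.
  assert (Sd : cser (fun n => a n * (x ^ n - y ^ n))%C (f x - f y)).
  {
    replace (f x - f y)%C with (f x + (-1) * f y)%C by ring.
    eapply cser_ext; [|exact (cser_plus _ _ _ _ Sx (cser_scal (-1) _ _ Sy))].
    intros n. simpl. ring. }
  set (w := Cmod (x - y)). assert (Hw : 0 <= w) by apply Cmod_ge_0.
  assert (T := cser_tail (fun n => a n * (x ^ n - y ^ n))%C (f x - f y)%C (2 * M / (R0 * q) * w) q 1 ltac:(lra)
    ltac:(apply Rmult_le_pos; [left; apply Rdiv_lt_0_compat; nra|exact Hw])).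
  replace (f x - f y - a 1%nat * (x - y))%C
    with (- (csum (fun n => a n * (x ^ n - y ^ n))%C 1 - (f x - f y)))%C
    by (rewrite csum_S, csum_0, !Cpow_1_r; simpl; ring).
  rewrite Cmod_opp. eapply Rle_trans; [apply T; [|exact Sd]|].
  - intros [|k] Hk; [lia|]. rewrite Cmod_mult.
    assert (B1 := Ha (S k)). assert (B2 := Cpow_diff_bound x y d k ltac:(lra) ltac:(lra)). fold w in B2.
    apply Rle_trans with (M / R0 ^ S k * (2 ^ S k * d ^ k * w)).
    + apply Rmult_le_compat; try apply Cmod_ge_0; [exact B1|].
      eapply Rle_trans; [exact B2|]. apply Rmult_le_compat_r; [exact Hw|].
      apply Rmult_le_compat_r; [apply pow_le; lra|]. apply INR_le_pow2.
    + right. unfold d. unfold Rdiv at 2. rewrite !Rpow_mult_distr, pow_inv. simpl.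
      field. repeat split; try lra; apply pow_nonzero; lra.
  - assert (P : 2 * M / (R0 * q) * w * q ^ 2 / (1 - q) = (2 * M * q / (R0 * (1 - q))) * w) by (field; lra).
    rewrite P. apply Rmult_le_compat_r; [exact Hw|].
    apply Rle_div_l; [apply Rmult_lt_0_compat; lra|].
    apply Rle_div_r in Hq2; [|lra].
    assert (0 < eps * R0) by nra. nra.
Qed.

(** By induction on the index, dividing out one power of z at a time. *)
Lemma power_series_unique (r : R) (a b : nat -> C) (f : C -> C) : 0 < r ->
  power_series_on r a f -> power_series_on r b f -> forall n, a n = b n.
Proof.
  intros Hr. revert a b f.
  assert (H0 : forall a b f, power_series_on r a f -> power_series_on r b f -> a O = b O).
  { intros a b f Ha Hb.
    assert (E : forall c : nat -> C, power_series_on r c f -> c O = f 0).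
    { intros c Hc. apply (cser_unique (fun n => c n * 0 ^ n)%C); [|apply Hc; rewrite Cmod_0; exact Hr].
      apply cser_eps. intros eps He. exists O. intros n _.
      replace (csum (fun n0 => c n0 * 0 ^ n0)%C n) with (c O).
      - rewrite Cmod_diag. exact He.
      - induction n as [|n IH]; [rewrite csum_0; simpl; ring|].
        rewrite csum_S, <- IH, Cpow_S. ring. }
    rewrite (E a Ha), (E b Hb). reflexivity. }
  assert (Hs : forall n a b f, power_series_on r a f -> power_series_on r b f -> a n = b n).
  { induction n as [|n IH]; intros a b f Ha Hb; [exact (H0 a b f Ha Hb)|].
    pose proof (H0 a b f Ha Hb) as E0.
    (* at the origin the quotient is the derivative, which the two series share *)
    pose proof (power_series_sdiff_0 r a f Hr Ha) as Da.
    set (g := fun z : C => if Ceq_dec z 0 then a 1%nat else ((f z - a O) / z)%C).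
    assert (Q : forall c : nat -> C, power_series_on r c f -> c O = a O -> c 1%nat = a 1%nat ->
                power_series_on r (fun k => c (S k)) g).
    { intros c Hc E1 E2 z Hz. unfold g. destruct (Ceq_dec z 0) as [->|Hz0].
      - rewrite <- E2. apply cser_eps. intros eps He. exists O. intros m _.
        replace (csum (fun n0 => c (S n0) * 0 ^ n0)%C m) with (c 1%nat).
        + rewrite Cmod_diag. exact He.
        + induction m as [|m IHm]; [rewrite csum_0; simpl; ring|].
          rewrite csum_S, <- IHm, Cpow_S. ring.
      - pose proof (cser_scal (/ z) _ _ (cser_incr_1 _ _ (Hc z Hz))) as S1. simpl in S1.
        replace ((f z - a O) / z)%C with (/ z * (f z - c O * 1))%C by (rewrite E1; field; exact Hz0).
        eapply cser_ext; [|exact S1]. intros k. simpl. rewrite ?Cpow_S. field. exact Hz0. }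
    assert (E1 : b 1%nat = a 1%nat) by exact (sdiff_unique _ _ _ _ (power_series_sdiff_0 r b f Hr Hb) Da).
    apply (IH (fun k => a (S k)) (fun k => b (S k)) g); apply Q; auto. }
  intros a b f Ha Hb n. exact (Hs n a b f Ha Hb).
Qed.

Lemma sdiff_shift (f : C -> C) (z0 z l : C) : sdiff (fun w => f (z0 + w)%C) (z - z0) l -> sdiff f z l.
Proof.
  intros H.
  replace l with (l * (1 - 0))%C by ring.
  apply (sdiff_ext_near (fun x => f (z0 + (x - z0))%C) f z _ 1 Rlt_0_1).
  - intros x _. f_equal. ring.
  - apply (sdiff_comp (fun x => x - z0)%C (fun w => f (z0 + w)%C)); [|exact H].
    apply sdiff_minus; [apply sdiff_id|apply sdiff_const].
Qed.

(** Differentiability is only read off at the centre of the local series; an analytic function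
    has a series centred at each point. *)
Lemma analytic_at_cdiff (f : C -> C) (z : C) : analytic_at f z -> cdiff f z.
Proof.
  intros (a & r & Hr & H). exists (a 1%nat).
  apply (sdiff_shift f z z). replace (z - z)%C with (RtoC 0) by ring.
  apply (power_series_sdiff_0 r); [exact Hr|]. intros w Hw.
  specialize (H (z + w)%C). replace (z + w - z)%C with w in H by ring.
  apply is_pseries_cser, H, Hw.
Qed.

(** * Complex-valued functions of a real variable *)

Definition rcont (g : R -> C) (t : R) : Prop :=
  forall eps, 0 < eps -> exists d, 0 < d /\ forall s, Rabs (s - t) < d -> Cmod (g s - g t) < eps.

Definition cderiv (g : R -> C) (t : R) (l : C) : Prop :=
  forall eps, 0 < eps -> exists d, 0 < d /\ forall s, Rabs (s - t) < d ->
    Cmod (g s - g t - RtoC (s - t) * l) <= eps * Rabs (s - t).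

Lemma norm_CR (z : C) : norm (V := C_R_NormedModule) z = Cmod z.
Proof.
  unfold norm; simpl. unfold prod_norm, Cmod, norm; simpl. unfold abs; simpl.
  f_equal. rewrite !Rmult_1_r. rewrite <- !Rabs_mult, !Rabs_pos_eq by nra. reflexivity.
Qed.

Lemma rcont_continuous (g : R -> C) (t : R) :
  rcont g t <-> continuous (T := R_UniformSpace) (U := C_R_NormedModule) g t.
Proof.
  unfold continuous.
  split.
  - intros H. apply (filterlim_C_eps _ _). intros eps He.
    destruct (H eps He) as (d & Hd & Hg). exists (mkposreal d Hd). intros s Hs. apply Hg. exact Hs.
  - intros H eps He. destruct (proj1 (filterlim_C_eps _ _ _ _) H eps He) as [d Hd].
    exists d. split; [apply cond_pos|]. intros s Hs. apply Hd. exact Hs.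
Qed.

Lemma cderiv_is_derive (g : R -> C) (t : R) (l : C) :
  cderiv g t l <-> is_derive (K := R_AbsRing) (V := C_R_NormedModule) g t l.
Proof.
  assert (E : forall s, norm (V := C_R_NormedModule)
     (minus (minus (g s) (g t)) (scal (minus (G := R_AbelianGroup) s t) l)) = Cmod (g s - g t - RtoC (s - t) * l)).
  { intros s. rewrite norm_CR. f_equal. rewrite <- scal_R_Cmult. reflexivity. }
  split.
  - intros H. split; [apply is_linear_scal_l|]. intros x Hx.
    apply (is_filter_lim_locally_unique (K := R_AbsRing) (V := R_NormedModule)) in Hx. subst x.
    intros [eps He]. destruct (H eps He) as (d & Hd & Hg). exists (mkposreal d Hd).
    intros s Hs. eapply Rle_trans; [right; exact (E s)|exact (Hg s Hs)].
  - intros [_ H] eps He.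
    assert (Hl : is_filter_lim (locally (T := R_UniformSpace) t) t) by (intros P HP; exact HP).
    destruct (H t Hl (mkposreal eps He)) as [d Hd]. exists d. split; [apply cond_pos|].
    intros s Hs. eapply Rle_trans; [right; symmetry; exact (E s)|exact (Hd s Hs)].
Qed.

Lemma rcont_const (c : C) (t : R) : rcont (fun _ => c) t.
Proof. intros eps He. exists 1. split; [lra|]. intros. rewrite Cmod_diag. exact He. Qed.

Lemma rcont_comp (g : R -> C) (f : C -> C) (t : R) : rcont g t -> ccont f (g t) -> rcont (fun s => f (g s)) t.
Proof.
  intros Hg Hf eps He. destruct (Hf eps He) as (d1 & Hd1 & H1).
  destruct (Hg d1 Hd1) as (d2 & Hd2 & H2). exists d2. split; [exact Hd2|]. auto.
Qed.

Lemma rcont_plus (f g : R -> C) (t : R) : rcont f t -> rcont g t -> rcont (fun s => f s + g s)%C t.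
Proof.
  intros Hf Hg. apply rcont_continuous in Hf, Hg. apply rcont_continuous.
  exact (continuous_plus (V := C_R_NormedModule) f g t Hf Hg).
Qed.

Lemma rcont_ext (f g : R -> C) (t : R) : (forall s, f s = g s) -> rcont f t -> rcont g t.
Proof.
  intros E H eps He. destruct (H eps He) as (d & Hd & Hf). exists d. split; [exact Hd|].
  intros s Hs. rewrite <- !E. auto.
Qed.

Lemma rcont_scal (c : C) (f : R -> C) (t : R) : rcont f t -> rcont (fun s => c * f s)%C t.
Proof. intros H. exact (rcont_comp f (fun x => c * x)%C t H (sdiff_ccont _ _ _ (sdiff_linear c (f t)))). Qed.

Lemma rcont_mult (f g : R -> C) (t : R) : rcont f t -> rcont g t -> rcont (fun s => f s * g s)%C t.
Proof.
  intros Hf Hg.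
  assert (Hsq : forall h, rcont h t -> rcont (fun s => h s * h s)%C t).
  { intros h Hh. exact (rcont_comp h (fun x => x * x)%C t Hh (sdiff_ccont _ _ _ (sdiff_square (h t)))). }
  apply (rcont_ext (fun s => / 4 * ((f s + g s) * (f s + g s) + -1 * ((f s + -1 * g s) * (f s + -1 * g s))))%C).
  - intros s. field.
  - apply rcont_scal, rcont_plus; [|apply rcont_scal]; apply Hsq, rcont_plus; try assumption.
    now apply rcont_scal.
Qed.

Lemma rcont_pow (f : R -> C) (n : nat) (t : R) : rcont f t -> rcont (fun s => f s ^ n)%C t.
Proof.
  intros H. induction n as [|n IH].
  - exact (rcont_const 1 t).
  - exact (rcont_mult f (fun s => f s ^ n)%C t H IH).
Qed.

Lemma rcont_real (h : R -> R) (t : R) : continuous h t -> rcont (fun s => RtoC (h s)) t.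
Proof.
  intros H eps He. destruct (proj1 (filterlim_locally _ _) H (mkposreal eps He)) as [d Hd].
  exists d. split; [apply cond_pos|]. intros s Hs.
  rewrite <- RtoC_minus, Cmod_R. apply Hd, Hs.
Qed.

Lemma rcont_RtoC (t : R) : rcont RtoC t.
Proof. apply (rcont_real (fun s => s)). apply continuous_id. Qed.

Lemma cderiv_rcont (g : R -> C) (t : R) (l : C) : cderiv g t l -> rcont g t.
Proof.
  intros H. apply rcont_continuous. apply (ex_derive_continuous (V := C_R_NormedModule)).
  exists l. now apply cderiv_is_derive.
Qed.

Lemma cderiv_comp (g : R -> C) (f : C -> C) (t : R) (l m : C) :
  cderiv g t l -> sdiff f (g t) m -> cderiv (fun s => f (g s)) t (m * l).
Proof.
  intros Hg Hf eps He. pose proof (cderiv_rcont g t l Hg) as Hc.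
  pose proof (Cmod_ge_0 l) as Nl. pose proof (Cmod_ge_0 m) as Nm.
  destruct (Hf (eps / 2 / (Cmod l + 1))) as (d1 & Hd1 & H1); [repeat apply Rdiv_lt_0_compat; lra|].
  destruct (Hg (Rmin 1 (eps / 2 / (Cmod m + 1)))) as (d2 & Hd2 & H2).
  { apply Rmin_glb_lt; [lra|]. repeat apply Rdiv_lt_0_compat; lra. }
  destruct (Hc d1 Hd1) as (d3 & Hd3 & H3).
  exists (Rmin d2 d3). split; [now apply Rmin_glb_lt|]. intros s Hs.
  specialize (H2 s (Rlt_le_trans _ _ _ Hs (Rmin_l _ _))). specialize (H3 s (Rlt_le_trans _ _ _ Hs (Rmin_r _ _))).
  specialize (H1 (g s) (g t) H3 ltac:(rewrite Cmod_diag; exact Hd1)).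
  pose proof (Rmin_l 1 (eps / 2 / (Cmod m + 1))) as M1. pose proof (Rmin_r 1 (eps / 2 / (Cmod m + 1))) as M2.
  set (k := Rmin 1 (eps / 2 / (Cmod m + 1))) in *.
  pose proof (Rabs_pos (s - t)) as Np. set (p := Rabs (s - t)) in *.
  replace (f (g s) - f (g t) - RtoC (s - t) * (m * l))%C
    with ((f (g s) - f (g t) - m * (g s - g t)) + m * (g s - g t - RtoC (s - t) * l))%C by ring.
  eapply Rle_trans; [apply Cmod_triangle|]. rewrite Cmod_mult.
  assert (Q : Cmod (g s - g t) <= (Cmod l + 1) * p).
  { replace (g s - g t)%C with ((g s - g t - RtoC (s - t) * l) + RtoC (s - t) * l)%C by ring.
    eapply Rle_trans; [apply Cmod_triangle|]. rewrite Cmod_mult, Cmod_R. fold p. nra. }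
  assert (Q1 : eps / 2 / (Cmod l + 1) * Cmod (g s - g t) <= eps / 2 * p).
  { replace (eps / 2 * p) with (eps / 2 / (Cmod l + 1) * ((Cmod l + 1) * p)) by (field; lra).
    apply Rmult_le_compat_l; [left; repeat apply Rdiv_lt_0_compat; lra|exact Q]. }
  assert (Q2 : Cmod m * Cmod (g s - g t - RtoC (s - t) * l) <= eps / 2 * p).
  { apply Rle_trans with ((Cmod m + 1) * (eps / 2 / (Cmod m + 1) * p)).
    - apply Rmult_le_compat; try apply Cmod_ge_0; [lra|].
      eapply Rle_trans; [exact H2|]. apply Rmult_le_compat_r; lra.
    - right. field. lra. }
  lra.
Qed.

Lemma cderiv_pair (g : R -> C) (t : R) (l : C) :
  derivable_pt_lim (fun s => Re (g s)) t (Re l) -> derivable_pt_lim (fun s => Im (g s)) t (Im l) ->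
  cderiv g t l.
Proof.
  intros H1 H2 eps He.
  destruct (H1 (eps / 2) ltac:(lra)) as [d1 Hd1]. destruct (H2 (eps / 2) ltac:(lra)) as [d2 Hd2].
  exists (Rmin d1 d2). split; [apply Rmin_glb_lt; apply cond_pos|]. intros s Hs.
  destruct (Req_dec (s - t) 0) as [E|E].
  - replace s with t by lra. replace (g t - g t - RtoC (t - t) * l)%C with (RtoC 0).
    + rewrite Cmod_0. replace (t - t) with 0 by ring. rewrite Rabs_R0. lra.
    + replace (t - t) with 0 by ring. ring.
  - specialize (Hd1 (s - t) E (Rlt_le_trans _ _ _ Hs (Rmin_l _ _))).
    specialize (Hd2 (s - t) E (Rlt_le_trans _ _ _ Hs (Rmin_r _ _))).
    replace (t + (s - t)) with s in * by ring.
    eapply Rle_trans; [apply Cmod_le_add_abs|].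
    assert (Q1 : Rabs (Re (g s - g t - RtoC (s - t) * l)) <= eps / 2 * Rabs (s - t)).
    { replace (Re (g s - g t - RtoC (s - t) * l)) with (((Re (g s) - Re (g t)) / (s - t) - Re l) * (s - t)).
      - rewrite Rabs_mult. apply Rmult_le_compat_r; [apply Rabs_pos|lra].
      - unfold Cminus. rewrite !re_plus, !re_opp, re_scal_l. field. exact E. }
    assert (Q2 : Rabs (Im (g s - g t - RtoC (s - t) * l)) <= eps / 2 * Rabs (s - t)).
    { replace (Im (g s - g t - RtoC (s - t) * l)) with (((Im (g s) - Im (g t)) / (s - t) - Im l) * (s - t)).
      - rewrite Rabs_mult. apply Rmult_le_compat_r; [apply Rabs_pos|lra].
      - unfold Cminus. rewrite !im_plus, !im_opp, im_scal_l. field. exact E. }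
    lra.
Qed.

Lemma cderiv_plus (f g : R -> C) (t : R) (l m : C) :
  cderiv f t l -> cderiv g t m -> cderiv (fun s => f s + g s)%C t (l + m).
Proof.
  intros Hf Hg. apply cderiv_is_derive in Hf, Hg. apply cderiv_is_derive.
  exact (is_derive_plus (V := C_R_NormedModule) f g t l m Hf Hg).
Qed.

Lemma cderiv_scal (c : C) (f : R -> C) (t : R) (l : C) : cderiv f t l -> cderiv (fun s => c * f s)%C t (c * l).
Proof. intros H. exact (cderiv_comp f (fun x => c * x)%C t l c H (sdiff_linear c (f t))). Qed.

Lemma cderiv_mult (f g : R -> C) (t : R) (l m : C) :
  cderiv f t l -> cderiv g t m -> cderiv (fun s => f s * g s)%C t (l * g t + f t * m).
Proof.
  intros Hf Hg.
  assert (Hsq : forall h k, cderiv h t k -> cderiv (fun s => h s * h s)%C t (2 * h t * k)).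
  { intros h k Hh. exact (cderiv_comp h (fun x => x * x)%C t k _ Hh (sdiff_square (h t))). }
  assert (P := cderiv_scal (/ 4) _ _ _ (cderiv_plus _ _ _ _ _ (Hsq _ _ (cderiv_plus _ _ _ _ _ Hf Hg))
    (cderiv_scal (-1) _ _ _ (Hsq _ _ (cderiv_plus _ _ _ _ _ Hf (cderiv_scal (-1) _ _ _ Hg)))))).
  replace (l * g t + f t * m)%C
    with (/ 4 * (2 * (f t + g t) * (l + m) + -1 * (2 * (f t + -1 * g t) * (l + -1 * m))))%C by field.
  intros eps He. destruct (P eps He) as (d & Hd & H). exists d. split; [exact Hd|]. intros s Hs.
  specialize (H s Hs). cbv beta in H.
  replace (f s * g s - f t * g t)%C
    with (/ 4 * ((f s + g s) * (f s + g s) + -1 * ((f s + -1 * g s) * (f s + -1 * g s)))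
          - / 4 * ((f t + g t) * (f t + g t) + -1 * ((f t + -1 * g t) * (f t + -1 * g t))))%C by field.
  exact H.
Qed.

Lemma cderiv_const (c : C) (t : R) : cderiv (fun _ => c) t 0.
Proof. apply cderiv_pair; simpl; apply derivable_pt_lim_const. Qed.

(** * Integrals of complex-valued functions *)

Definition cint (f : R -> C) (a b : R) (l : C) : Prop := is_RInt (V := C_R_NormedModule) f a b l.

Lemma cint_unique (f : R -> C) (a b : R) (l m : C) : cint f a b l -> cint f a b m -> l = m.
Proof.
  intros H1 H2. rewrite <- (is_RInt_unique (V := C_R_CompleteNormedModule) f a b l H1).
  apply (is_RInt_unique (V := C_R_CompleteNormedModule) f a b m H2).
Qed.

Lemma cint_ex (f : R -> C) (a b : R) : a <= b -> (forall t, a <= t <= b -> rcont f t) -> exists l, cint f a b l.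
Proof.
  intros Hab H. apply (ex_RInt_continuous (V := C_R_CompleteNormedModule)).
  rewrite Rmin_left, Rmax_right by exact Hab. intros t Ht. apply rcont_continuous, H, Ht.
Qed.

Lemma cint_ext (f g : R -> C) (a b : R) (l : C) : a <= b -> (forall t, a < t < b -> f t = g t) ->
  cint f a b l -> cint g a b l.
Proof.
  intros Hab E. apply is_RInt_ext. rewrite Rmin_left, Rmax_right by exact Hab. exact E.
Qed.

Lemma cint_plus (f g : R -> C) (a b : R) (l m : C) : cint f a b l -> cint g a b m ->
  cint (fun t => f t + g t)%C a b (l + m).
Proof. apply (is_RInt_plus (V := C_R_NormedModule)). Qed.

Lemma cint_scal (c : C) (f : R -> C) (a b : R) (l : C) : cint f a b l -> cint (fun t => c * f t)%C a b (c * l).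
Proof.
  intros H.
  pose proof (is_RInt_fct_extend_fst f a b l H) as H1. pose proof (is_RInt_fct_extend_snd f a b l H) as H2.
  apply (is_RInt_fct_extend_pair (U := R_NormedModule) (V := R_NormedModule)).
  - simpl. apply (is_RInt_minus (V := R_NormedModule)); apply (is_RInt_scal (V := R_NormedModule)); assumption.
  - simpl. apply (is_RInt_plus (V := R_NormedModule)); apply (is_RInt_scal (V := R_NormedModule)); assumption.
Qed.

Lemma cint_minus (f g : R -> C) (a b : R) (l m : C) : cint f a b l -> cint g a b m ->
  cint (fun t => f t - g t)%C a b (l - m).
Proof. apply (is_RInt_minus (V := C_R_NormedModule)). Qed.

Lemma cint_const (c : C) (a b : R) : cint (fun _ => c) a b (RtoC (b - a) * c).
Proof. rewrite <- scal_R_Cmult. apply (is_RInt_const (V := C_R_NormedModule)). Qed.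

Lemma cint_norm (f : R -> C) (a b M : R) (l : C) : a <= b -> (forall t, a <= t <= b -> Cmod (f t) <= M) ->
  cint f a b l -> Cmod l <= (b - a) * M.
Proof.
  intros Hab HM H. rewrite <- norm_CR. apply (norm_RInt_le_const (V := C_R_NormedModule) f a b); [exact Hab| |exact H].
  intros t Ht. rewrite norm_CR. apply HM, Ht.
Qed.

Lemma cint_FTC (g dg : R -> C) (a b : R) : a <= b ->
  (forall t, a <= t <= b -> cderiv g t (dg t)) -> (forall t, a <= t <= b -> rcont dg t) ->
  cint dg a b (g b - g a).
Proof.
  intros Hab H1 H2. apply (is_RInt_derive (V := C_R_CompleteNormedModule) g dg a b);
    rewrite Rmin_left, Rmax_right by exact Hab; intros t Ht.
  - apply cderiv_is_derive, H1, Ht.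
  - apply rcont_continuous, H2, Ht.
Qed.

Lemma cint_csum (f : nat -> R -> C) (l : nat -> C) (a b : R) (n : nat) :
  (forall k, cint (f k) a b (l k)) -> cint (fun t => csum (fun k => f k t) n) a b (csum l n).
Proof.
  intros H. induction n as [|n IH].
  - rewrite csum_0. apply is_RInt_ext with (f 0%nat); [|apply H]. intros; now rewrite csum_0.
  - rewrite csum_S. eapply is_RInt_ext; [|apply (cint_plus _ _ _ _ _ _ IH (H (S n)))].
    intros t _. simpl. now rewrite csum_S.
Qed.

(** The geometric bound gives uniform convergence on [a,b]. *)
Lemma cint_series (g : nat -> R -> C) (G : R -> C) (l : nat -> C) (L : C) (a b M q : R) :
  a <= b -> 0 <= q < 1 -> 0 <= M ->
  (forall n t, a <= t <= b -> Cmod (g n t) <= M * q ^ n) ->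
  (forall t, a <= t <= b -> cser (fun n => g n t) (G t)) ->
  (forall n, cint (g n) a b (l n)) -> cint G a b L -> cser l L.
Proof.
  intros Hab Hq HM Hb Hs Hl HL. apply cser_eps. intros eps He.
  set (A := (b - a) * M / (1 - q)).
  assert (HA : 0 <= A) by (unfold A; apply Rdiv_le_0_compat; nra).
  destruct (pow_lt_1_zero q ltac:(rewrite Rabs_pos_eq; lra) (eps / (A + 1)) ltac:(apply Rdiv_lt_0_compat; lra)) as [N HN].
  exists N. intros n Hn.
  pose proof (cint_minus _ _ _ _ _ _ (cint_csum g l a b n Hl) HL) as Hd.
  assert (B := cint_norm _ a b (M * q ^ S n / (1 - q)) _ Hab
     (fun t Ht => cser_tail (fun k => g k t) (G t) M q n Hq HM (fun k _ => Hb k t Ht) (Hs t Ht)) Hd).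
  eapply Rle_lt_trans; [exact B|].
  specialize (HN (S n) ltac:(lia)). rewrite Rabs_pos_eq in HN by (apply pow_le; lra).
  replace ((b - a) * (M * q ^ S n / (1 - q))) with (A * q ^ S n) by (unfold A; field; lra).
  apply Rlt_div_r in HN; [|lra].
  pose proof (pow_le q (S n) (proj1 Hq)). nra.
Qed.

Lemma rcont_bounded (g : R -> C) (a b : R) : a <= b -> (forall t, a <= t <= b -> rcont g t) ->
  exists M, 0 < M /\ forall t, a <= t <= b -> Cmod (g t) <= M.
Proof.
  intros Hab H.
  destruct (continuity_ab_maj (fun t => Cmod (g t)) a b Hab) as (x & Hx & _).
  - intros t Ht eps He. destruct (H t Ht eps He) as (d & Hd & Hg). exists d. split; [exact Hd|].
    intros s [_ Hs]. simpl in *. unfold Rdist in *. specialize (Hg s Hs).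
    eapply Rle_lt_trans; [|exact Hg]. apply Rabs_le.
    pose proof (Cmod_triangle (g s - g t) (g t)) as T1.
    pose proof (Cmod_triangle (g t - g s) (g s)) as T2. rewrite (Cmod_sub_comm (g t)) in T2.
    replace (g s - g t + g t)%C with (g s) in T1 by ring. replace (g t - g s + g s)%C with (g t) in T2 by ring.
    lra.
  - exists (Cmod (g x) + 1). split; [pose proof (Cmod_ge_0 (g x)); lra|].
    intros t Ht. specialize (Hx t Ht). lra.
Qed.

(** * Taylor expansion in the unit disc *)

Definition cis (t : R) : C := (cos t, sin t).

Lemma cis_plus (s t : R) : cis (s + t) = (cis s * cis t)%C.
Proof. unfold cis. rewrite cos_plus, sin_plus. apply C_ext; simpl; ring. Qed.

Lemma cis_0 : cis 0 = RtoC 1.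
Proof. unfold cis. rewrite cos_0, sin_0. reflexivity. Qed.

Lemma Cmod_cis (t : R) : Cmod (cis t) = 1.
Proof.
  replace (cis t) with (Cexp (0, t)).
  - rewrite Cmod_Cexp. apply exp_0.
  - unfold Cexp, cis; simpl. rewrite exp_0, !Rmult_1_l. reflexivity.
Qed.

Lemma cis_neq_0 (t : R) : cis t <> 0.
Proof. apply Cmod_gt_0. rewrite Cmod_cis. lra. Qed.

Lemma cis_pow (t : R) (n : nat) : (cis t ^ n)%C = cis (INR n * t).
Proof.
  induction n as [|n IH].
  - simpl. rewrite Rmult_0_l, cis_0. reflexivity.
  - rewrite Cpow_S, IH, S_INR, <- cis_plus. f_equal. ring.
Qed.

Lemma cis_period (n : nat) : cis (INR n * (2 * PI)) = RtoC 1.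
Proof.
  rewrite <- cis_pow. replace (cis (2 * PI)) with (RtoC 1); [apply Cpow_1_l|].
  unfold cis. rewrite cos_2PI, sin_2PI. reflexivity.
Qed.

Lemma cis_opp_inv (t : R) : cis (- t) = (/ cis t)%C.
Proof.
  assert (E : (cis (- t) * cis t)%C = RtoC 1).
  { rewrite <- cis_plus, <- cis_0. f_equal. ring. }
  rewrite <- (Cmult_1_r (cis (- t))), <- (Cinv_r (cis t) (cis_neq_0 t)), Cmult_assoc, E. ring.
Qed.

Lemma cderiv_cis (k t : R) : cderiv (fun s => cis (k * s)) t (k * Ci * cis (k * t)).
Proof.
  apply cderiv_pair; simpl; apply is_derive_Reals; auto_derive; auto; ring.
Qed.

Lemma rcont_cis (k t : R) : rcont (fun s => cis (k * s)) t.
Proof. exact (cderiv_rcont _ _ _ (cderiv_cis k t)). Qed.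

Lemma rcont_cis1 (t : R) : rcont cis t.
Proof. apply (rcont_ext (fun s => cis (1 * s))); [intros; f_equal; ring|apply rcont_cis]. Qed.

Lemma rcont_cis_opp (t : R) : rcont (fun s => cis (- s)) t.
Proof. apply (rcont_ext (fun s => cis (-1 * s))); [intros; f_equal; ring|apply rcont_cis]. Qed.

Lemma two_pi_pos : 0 < 2 * PI.
Proof. pose proof PI_RGT_0. lra. Qed.

Lemma cint_cis_orthogonal (m n : nat) :
  cint (fun t => cis t ^ m * cis (- t) ^ n)%C 0 (2 * PI) (if Nat.eq_dec m n then RtoC (2 * PI) else 0).
Proof.
  pose proof two_pi_pos as Hpi.
  assert (E : forall t, (cis t ^ m * cis (- t) ^ n)%C = cis ((INR m - INR n) * t)).
  { intros t. rewrite !cis_pow, <- cis_plus. f_equal. ring. }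
  destruct (Nat.eq_dec m n) as [->|Hmn].
  - apply (cint_ext (fun _ => RtoC 1)); [lra| |].
    + intros t _. rewrite E. replace ((INR n - INR n) * t) with 0 by ring. now rewrite cis_0.
    + replace (RtoC (2 * PI)) with (RtoC (2 * PI - 0) * 1)%C by (rewrite Rminus_0_r; ring).
      apply cint_const.
  - assert (Hk : INR m - INR n <> 0) by (intros H; apply Hmn, INR_eq; lra).
    set (k := INR m - INR n) in *.
    assert (Hk' : RtoC k <> 0) by (intros H; apply Hk; now apply RtoC_inj).
    apply (cint_ext (fun t => / (k * Ci) * (k * Ci * cis (k * t)))%C); [lra| |].
    + intros t _. rewrite E. fold k. field. split; [apply Ci_nz|exact Hk'].
    + replace (RtoC 0) with (/ (k * Ci) * (cis (k * (2 * PI)) - cis (k * 0)))%C.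
      * apply cint_scal.
        apply (cint_FTC (fun t => cis (k * t))); [lra| |]; intros t _; [apply cderiv_cis|].
        apply rcont_mult; [apply rcont_const|apply rcont_cis].
      * rewrite Rmult_0_r, cis_0. unfold k.
        replace ((INR m - INR n) * (2 * PI)) with (INR m * (2 * PI) + - (INR n * (2 * PI))) by ring.
        rewrite cis_plus, cis_opp_inv, !cis_period. field. split; [apply Ci_nz|exact Hk'].
Qed.

Lemma derivative_ccont (f f' : C -> C) (z : C) (r : R) : 0 < r ->
  (forall p, Cmod (p - z) < r -> sdiff f p (f' p)) -> ccont f' z.
Proof.
  intros Hr H eps He.
  destruct (H z ltac:(rewrite Cmod_diag; exact Hr) (eps / 2) ltac:(lra)) as (d & Hd & Hf).
  exists (Rmin d r). split; [now apply Rmin_glb_lt|]. intros p Hp.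
  eapply Rle_lt_trans.
  - apply (sdiff_slope_close f z (f' z) p (f' p) (eps / 2) d); [lra|exact Hf| |].
    + eapply Rlt_le_trans; [exact Hp|apply Rmin_l].
    + apply H. eapply Rlt_le_trans; [exact Hp|apply Rmin_r].
  - lra.
Qed.

(** Compactness makes the linear approximation uniform along a closed arc. *)
Lemma uniform_linearization (f f' : C -> C) (g : R -> C) (a b : R) :
  (forall t, a <= t <= b -> rcont g t) -> (forall t, a <= t <= b -> sdiff f (g t) (f' (g t))) ->
  forall eps, 0 < eps -> exists d, 0 < d /\ forall t w, a <= t <= b -> Cmod (w - g t) < d ->
    Cmod (f w - f (g t) - f' (g t) * (w - g t)) <= eps * Cmod (w - g t).
Proof.
  intros Hg Hf eps He.
  assert (Hloc : forall t, exists e : posreal, a <= t <= b ->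
    forall s w, a <= s <= b -> Rabs (s - t) < e -> Cmod (w - g s) < e ->
      Cmod (f w - f (g s) - f' (g s) * (w - g s)) <= eps * Cmod (w - g s)).
  { intros t. destruct (classic (a <= t <= b)) as [Ht|Ht]; [|exists (mkposreal 1 Rlt_0_1); tauto].
    destruct (Hf t Ht (eps / 2) ltac:(lra)) as (d1 & Hd1 & H1).
    destruct (Hg t Ht (d1 / 2) ltac:(lra)) as (d2 & Hd2 & H2).
    assert (Hpos : 0 < Rmin d2 (d1 / 2)) by (apply Rmin_glb_lt; lra).
    exists (mkposreal _ Hpos). simpl. intros _ s w Hs Hst Hw.
    assert (A1 := H2 s (Rlt_le_trans _ _ _ Hst (Rmin_l _ _))).
    assert (A2 := Rlt_le_trans _ _ _ Hw (Rmin_r _ _)).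
    assert (Hw1 : Cmod (w - g t) < d1).
    { replace (w - g t)%C with ((w - g s) + (g s - g t))%C by ring.
      eapply Rle_lt_trans; [apply Cmod_triangle|]. lra. }
    assert (B1 := H1 w (g s) Hw1 ltac:(lra)).
    assert (B2 := sdiff_slope_close f (g t) (f' (g t)) (g s) (f' (g s)) (eps / 2) d1 ltac:(lra) H1 ltac:(lra) (Hf s Hs)).
    replace (f w - f (g s) - f' (g s) * (w - g s))%C
      with ((f w - f (g s) - f' (g t) * (w - g s)) - (f' (g s) - f' (g t)) * (w - g s))%C by ring.
    eapply Rle_trans; [apply Cmod_triangle_sub|]. rewrite Cmod_mult.
    pose proof (Cmod_ge_0 (w - g s)). nra. }
  set (delta := fun t => proj1_sig (constructive_indefinite_description _ (Hloc t))).
  assert (Hdelta : forall t, a <= t <= b ->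
    forall s w, a <= s <= b -> Rabs (s - t) < delta t -> Cmod (w - g s) < delta t ->
      Cmod (f w - f (g s) - f' (g s) * (w - g s)) <= eps * Cmod (w - g s)).
  { intros t. unfold delta. destruct constructive_indefinite_description; simpl. assumption. }
  destruct (compactness_value_1d a b delta) as [d Hd].
  exists d. split; [apply cond_pos|]. intros s w Hs Hw.
  apply NNPP. intros Hn. apply (Hd s Hs). intros (t & Ht & Hst & Hdt).
  apply Hn. apply (Hdelta t Ht s w Hs Hst). lra.
Qed.

Section Homotopy.

Variables (f f' : C -> C) (q : R) (z : C).
Hypothesis Hf : forall w, Cmod w < 1 -> sdiff f w (f' w).
Hypothesis Hz : Cmod z < q.
Hypothesis Hq : q < 1.

Let homotopy (l t : R) : C := (z + l * (q * cis t - z))%C.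
Let cauchy_kernel (t : R) : C := (q * cis t / (q * cis t - z))%C.

Let Hq0 : 0 < q.
Proof. pose proof (Cmod_ge_0 z). lra. Qed.

Lemma circle_far (t : R) : q - Cmod z <= Cmod (q * cis t - z).
Proof.
  assert (Cmod (q * cis t) <= Cmod (q * cis t - z) + Cmod z).
  { replace (q * cis t)%C with ((q * cis t - z) + z)%C at 1 by ring. apply Cmod_triangle. }
  rewrite Cmod_mult, Cmod_cis, Cmod_R, Rabs_pos_eq in H by lra. lra.
Qed.

Lemma circle_near (t : R) : Cmod (q * cis t - z) <= 2.
Proof.
  eapply Rle_trans; [apply Cmod_triangle_sub|]. rewrite Cmod_mult, Cmod_cis, Cmod_R, Rabs_pos_eq by lra. lra.
Qed.

Lemma circle_neq (t : R) : (q * cis t - z)%C <> 0.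
Proof. apply Cmod_gt_0. pose proof (circle_far t). lra. Qed.

Lemma cauchy_kernel_bound (t : R) : Cmod (cauchy_kernel t) <= q / (q - Cmod z).
Proof.
  unfold cauchy_kernel. rewrite Cmod_div by apply circle_neq.
  rewrite Cmod_mult, Cmod_cis, Cmod_R, Rabs_pos_eq, Rmult_1_r by lra.
  unfold Rdiv. apply Rmult_le_compat_l; [lra|]. apply Rinv_le_contravar; [lra|apply circle_far].
Qed.

Lemma homotopy_in_disc (l t : R) : 0 <= l <= 1 -> Cmod (homotopy l t) <= q.
Proof.
  intros Hl. unfold homotopy. replace (z + l * (q * cis t - z))%C with (RtoC (1 - l) * z + RtoC (l * q) * cis t)%C.
  - eapply Rle_trans; [apply Cmod_triangle|]. rewrite !Cmod_mult, Cmod_cis, !Cmod_R, !Rabs_pos_eq by nra. nra.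
  - rewrite RtoC_minus, RtoC_mult. ring.
Qed.

Lemma rcont_homotopy (l t : R) : rcont (homotopy l) t.
Proof.
  unfold homotopy. apply rcont_plus; [apply rcont_const|]. apply rcont_mult; [apply rcont_const|].
  apply (rcont_plus _ (fun _ => (- z)%C)); [|apply rcont_const].
  apply rcont_mult; [apply rcont_const|apply rcont_cis1].
Qed.

Lemma rcont_cauchy_kernel (t : R) : rcont cauchy_kernel t.
Proof.
  assert (A : rcont (fun s => q * cis s)%C t) by (apply rcont_mult; [apply rcont_const|apply rcont_cis1]).
  unfold cauchy_kernel. apply rcont_mult; [exact A|].
  apply (rcont_comp (fun s => q * cis s - z)%C (fun w => / w)%C).
  - apply (rcont_plus _ (fun _ => (- z)%C)); [exact A|apply rcont_const].
  - eapply sdiff_ccont, sdiff_inv, circle_neq.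
Qed.

Lemma homotopy_integrable (l : R) : (forall t, Cmod (homotopy l t) < 1) ->
  exists homotopy_integral, cint (fun t => f (homotopy l t) * cauchy_kernel t)%C 0 (2 * PI) homotopy_integral.
Proof.
  intros H. apply cint_ex; [pose proof two_pi_pos; lra|]. intros t _.
  apply rcont_mult; [|apply rcont_cauchy_kernel].
  apply (rcont_comp (homotopy l) f); [apply rcont_homotopy|]. eapply sdiff_ccont, Hf, H.
Qed.

(** Up to the factor l i the integrand is the derivative of f along a closed loop. *)
Lemma loop_integral_0 (l : R) : 0 <= l <= 1 ->
  cint (fun t => f' (homotopy l t) * (q * cis t))%C 0 (2 * PI) 0.
Proof.
  intros Hl. pose proof two_pi_pos as Hpi.
  destruct (Req_dec l 0) as [->|Hl0].
  - apply (cint_ext (fun t => (f' z * q) * (cis t ^ 1 * cis (- t) ^ 0))%C); [lra| |].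
    + intros t _. unfold homotopy. replace (z + 0 * (q * cis t - z))%C with z by ring. rewrite Cpow_1_r. simpl. ring.
    + replace (RtoC 0) with ((f' z * q) * 0)%C by ring. apply cint_scal.
      apply (cint_cis_orthogonal 1 0).
  - assert (Hl' : RtoC l <> 0) by (intros E; apply Hl0; now apply RtoC_inj).
    apply (cint_ext (fun t => / (l * Ci) * (f' (homotopy l t) * (l * (q * (Ci * cis t)))))%C); [lra| |].
    + intros t _. field. split; [apply Ci_nz|exact Hl'].
    + replace (RtoC 0) with (/ (l * Ci) * (f (homotopy l (2 * PI)) - f (homotopy l 0)))%C.
      * apply cint_scal. apply (cint_FTC (fun t => f (homotopy l t))); [lra| |]; intros t _.
        -- apply cderiv_comp; [|apply Hf; pose proof (homotopy_in_disc l t Hl); lra].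
           apply cderiv_pair; unfold homotopy, cis, RtoC, Ci; simpl; apply is_derive_Reals; auto_derive; auto; ring.
        -- apply rcont_mult.
           ++ apply (rcont_comp (homotopy l) f'); [apply rcont_homotopy|].
              apply (derivative_ccont f f' _ (1 - q)); [lra|]. intros p Hp. apply Hf.
              replace p with ((p - homotopy l t) + homotopy l t)%C by ring.
              eapply Rle_lt_trans; [apply Cmod_triangle|]. pose proof (homotopy_in_disc l t Hl). lra.
           ++ repeat (apply rcont_mult; [apply rcont_const|]). apply rcont_cis1.
      * unfold homotopy. replace (cis (2 * PI)) with (cis 0).
        -- field. split; [apply Ci_nz|exact Hl'].
        -- rewrite cis_0. unfold cis. rewrite cos_2PI, sin_2PI. reflexivity.
Qed.

Let homotopy_integral (l : R) : C := RInt (V := C_R_CompleteNormedModule) (fun t => f (homotopy l t) * cauchy_kernel t)%C 0 (2 * PI).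

Lemma homotopy_integral_correct (l : R) : (forall t, Cmod (homotopy l t) < 1) -> cint (fun t => f (homotopy l t) * cauchy_kernel t)%C 0 (2 * PI) (homotopy_integral l).
Proof.
  intros H. destruct (homotopy_integrable l H) as [j Hj].
  apply (RInt_correct (V := C_R_CompleteNormedModule)). exists j. exact Hj.
Qed.

Lemma homotopy_integral_stationary (l : R) : 0 <= l <= 1 -> cderiv homotopy_integral l 0.
Proof.
  intros Hl eps He. pose proof two_pi_pos as Hpi.
  set (B := 2 * (q / (q - Cmod z))).
  assert (HB : 0 < B) by (unfold B; apply Rmult_lt_0_compat; [lra|]; apply Rdiv_lt_0_compat; lra).
  destruct (uniform_linearization f f' (homotopy l) 0 (2 * PI)) with (eps := eps / (2 * PI * B)) as (d & Hd & H).
  { intros; apply rcont_homotopy. }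
  { intros t _. apply Hf. pose proof (homotopy_in_disc l t Hl). lra. }
  { apply Rdiv_lt_0_compat; [lra|]. apply Rmult_lt_0_compat; lra. }
  exists (Rmin (d / 2) ((1 - q) / 2)). split; [apply Rmin_glb_lt; lra|]. intros s Hs.
  assert (Hs1 := Rlt_le_trans _ _ _ Hs (Rmin_l _ _)). assert (Hs2 := Rlt_le_trans _ _ _ Hs (Rmin_r _ _)).
  assert (Hdiff : forall t, (homotopy s t - homotopy l t)%C = (RtoC (s - l) * (q * cis t - z))%C).
  { intros t. unfold homotopy. rewrite RtoC_minus. ring. }
  assert (Hdm : forall t, Cmod (homotopy s t - homotopy l t) <= Rabs (s - l) * 2).
  { intros t. rewrite Hdiff, Cmod_mult, Cmod_R. apply Rmult_le_compat_l; [apply Rabs_pos|apply circle_near]. }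
  assert (Hin : forall t, Cmod (homotopy s t) < 1).
  { intros t. replace (homotopy s t) with ((homotopy s t - homotopy l t) + homotopy l t)%C by ring.
    eapply Rle_lt_trans; [apply Cmod_triangle|]. pose proof (homotopy_in_disc l t Hl). pose proof (Hdm t). lra. }
  pose proof (homotopy_integral_correct s Hin) as I1.
  pose proof (homotopy_integral_correct l (fun t => Rle_lt_trans _ _ _ (homotopy_in_disc l t Hl) Hq)) as I2.
  pose proof (cint_scal (RtoC (s - l)) _ _ _ _ (loop_integral_0 l Hl)) as I3.
  pose proof (cint_minus _ _ _ _ _ _ (cint_minus _ _ _ _ _ _ I1 I2) I3) as I4.
  eapply Rle_trans.
  - refine (cint_norm _ 0 (2 * PI) (eps / (2 * PI * B) * (Rabs (s - l) * B)) _ ltac:(lra) _ I4).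
    intros t Ht. cbv beta.
    assert (Ek : (q * cis t)%C = ((q * cis t - z) * cauchy_kernel t)%C).
    { unfold cauchy_kernel. field. apply circle_neq. }
    replace (f (homotopy s t) * cauchy_kernel t - f (homotopy l t) * cauchy_kernel t - RtoC (s - l) * (f' (homotopy l t) * (q * cis t)))%C
      with ((f (homotopy s t) - f (homotopy l t) - f' (homotopy l t) * (homotopy s t - homotopy l t)) * cauchy_kernel t)%C
      by (rewrite Ek, Hdiff; ring).
    rewrite Cmod_mult.
    assert (A1 := H t (homotopy s t) Ht ltac:(pose proof (Hdm t); lra)).
    apply Rle_trans with (eps / (2 * PI * B) * (Rabs (s - l) * 2) * (q / (q - Cmod z))).
    + apply Rmult_le_compat; try apply Cmod_ge_0; [|apply cauchy_kernel_bound].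
      eapply Rle_trans; [exact A1|]. apply Rmult_le_compat_l; [|apply Hdm].
      left. apply Rdiv_lt_0_compat; [lra|]. apply Rmult_lt_0_compat; lra.
    + right. unfold B. ring.
  - right. field. split; lra.
Qed.

(** The circle is contracted linearly to the point z, keeping the kernel of the centred circle;
    the derivative in the homotopy parameter is the integral of an exact form around a loop. *)
Lemma homotopy_invariance : homotopy_integral 1 = homotopy_integral 0.
Proof.
  symmetry. apply (eq_is_derive (V := C_R_NormedModule)); [|lra].
  intros t Ht. apply cderiv_is_derive. apply homotopy_integral_stationary, Ht.
Qed.

Lemma cauchy_formula :
  cint (fun t => f (q * cis t) * cauchy_kernel t)%C 0 (2 * PI) (homotopy_integral 0).
Proof.
  rewrite <- homotopy_invariance. pose proof two_pi_pos.
  apply (cint_ext (fun t => f (homotopy 1 t) * cauchy_kernel t)%C); [lra| |].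
  - intros t _. unfold homotopy. f_equal. f_equal. ring.
  - apply homotopy_integral_correct. intros t. pose proof (homotopy_in_disc 1 t ltac:(lra)). lra.
Qed.

Lemma homotopy_integral_0 (L : C) : cint cauchy_kernel 0 (2 * PI) L -> homotopy_integral 0 = (f z * L)%C.
Proof.
  intros HL. pose proof two_pi_pos.
  apply (cint_unique (fun t => f (homotopy 0 t) * cauchy_kernel t)%C 0 (2 * PI)).
  - apply homotopy_integral_correct. intros t. pose proof (homotopy_in_disc 0 t ltac:(lra)). lra.
  - apply (cint_ext (fun t => f z * cauchy_kernel t)%C); [lra| |now apply cint_scal].
    intros t _. unfold homotopy. f_equal. f_equal. ring.
Qed.

Lemma cauchy_kernel_series (t : R) : cser (fun n => (z / q) ^ n * cis (- t) ^ n)%C (cauchy_kernel t).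
Proof.
  assert (Hq' : RtoC q <> 0) by (intros E; apply RtoC_inj in E; lra).
  set (u := (z / q * cis (- t))%C).
  assert (Hu : Cmod u < 1).
  { unfold u. rewrite Cmod_mult, Cmod_cis, Cmod_div, Cmod_R, Rabs_pos_eq, Rmult_1_r by (assumption || lra).
    apply Rlt_div_l; lra. }
  assert (Hu1 : (1 - u)%C <> 0).
  { intros E. assert (u = 1) by (replace u with (1 - (1 - u))%C by ring; rewrite E; ring).
    rewrite H, Cmod_1 in Hu. lra. }
  assert (Ek : cauchy_kernel t = (/ (1 - u))%C).
  { unfold cauchy_kernel, u. rewrite cis_opp_inv. field.
    pose proof (cis_neq_0 t). pose proof (circle_neq t). repeat split; assumption. }
  rewrite Ek. apply (cser_ext (fun n => u ^ n)%C).
  { intros n. unfold u. rewrite Cpow_mult_l. reflexivity. }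
  destruct (cser_geometric_ex (fun n => u ^ n)%C 1 (Cmod u)) as [l Hl].
  { pose proof (Cmod_ge_0 u). lra. }
  { intros k. rewrite Cmod_pow. lra. }
  replace (/ (1 - u))%C with l; [exact Hl|].
  pose proof (cser_incr_1 _ _ Hl) as H1. pose proof (cser_scal u _ _ Hl) as H2. simpl in H1.
  assert (E : (l - 1)%C = (u * l)%C).
  { apply (cser_unique (fun n => u * u ^ n)%C); [|exact H2].
    eapply cser_ext; [|exact H1]. intros n. reflexivity. }
  assert (E2 : (l * (1 - u))%C = RtoC 1).
  { replace (l * (1 - u))%C with (l - u * l)%C by ring. rewrite <- E. ring. }
  transitivity (l * (1 - u) * / (1 - u))%C; [field; exact Hu1|]. rewrite E2. ring.
Qed.

Lemma cauchy_series_aux (g : C -> C) (l : nat -> C) (L : C) : (forall t, rcont (fun s => g (q * cis s)%C) t) ->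
  (forall n, cint (fun t => g (q * cis t) * cis (- t) ^ n)%C 0 (2 * PI) (l n)) ->
  cint (fun t => g (q * cis t) * cauchy_kernel t)%C 0 (2 * PI) L ->
  cser (fun n => (z / q) ^ n * l n)%C L.
Proof.
  intros Hg Hl HL. pose proof two_pi_pos.
  assert (Hq' : RtoC q <> 0) by (intros E; apply RtoC_inj in E; lra).
  destruct (rcont_bounded (fun s => g (q * cis s)%C) 0 (2 * PI)) as [M [HM HMb]]; [lra|auto|].
  apply (cint_series (fun n t => (z / q) ^ n * (g (q * cis t) * cis (- t) ^ n))%C
           (fun t => g (q * cis t) * cauchy_kernel t)%C _ _ 0 (2 * PI) M (Cmod z / q)); try lra.
  - split; [apply Rdiv_le_0_compat; [apply Cmod_ge_0|lra]|]. apply Rlt_div_l; lra.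
  - intros n t Ht. rewrite !Cmod_mult, !Cmod_pow, Cmod_cis, pow1, Rmult_1_r.
    rewrite Cmod_div, Cmod_R, Rabs_pos_eq by (assumption || lra).
    rewrite Rmult_comm. apply Rmult_le_compat_r; [|now apply HMb].
    apply pow_le, Rdiv_le_0_compat; [apply Cmod_ge_0|lra].
  - intros t _. eapply cser_ext; [|apply (cser_scal (g (q * cis t)%C) _ _ (cauchy_kernel_series t))].
    intros n. simpl. ring.
  - intros n. apply cint_scal, Hl.
  - exact HL.
Qed.

(** Cauchy's series for the constant function 1 already contains the value of the kernel
    integral. *)
Lemma cauchy_kernel_integral : cint cauchy_kernel 0 (2 * PI) (2 * PI).
Proof.
  pose proof two_pi_pos.
  destruct (cint_ex cauchy_kernel 0 (2 * PI)) as [L HL]; [lra|intros; apply rcont_cauchy_kernel|].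
  assert (HS : cser (fun n => (z / q) ^ n * (if Nat.eq_dec 0 n then RtoC (2 * PI) else 0))%C L).
  { apply (cauchy_series_aux (fun _ => RtoC 1)).
    - intros; apply rcont_const.
    - intros n. eapply cint_ext; [lra| |apply (cint_cis_orthogonal 0 n)]. intros t _. reflexivity.
    - apply (cint_ext cauchy_kernel); [lra| |exact HL]. intros; ring. }
  replace (RtoC 2 * RtoC PI)%C with L; [exact HL|].
  apply (cser_unique _ _ _ HS). apply cser_eps. intros eps He. exists O. intros n _.
  replace (csum _ n) with (RtoC 2 * RtoC PI)%C; [rewrite Cmod_diag; exact He|].
  induction n as [|n IH].
  - rewrite csum_0. destruct (Nat.eq_dec 0 0); [|lia]. rewrite RtoC_mult. simpl. ring.
  - rewrite csum_S, <- IH. destruct (Nat.eq_dec 0 (S n)); [lia|]. ring.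
Qed.

Lemma cauchy_series (l : nat -> C) :
  (forall n, cint (fun t => f (q * cis t) * cis (- t) ^ n)%C 0 (2 * PI) (l n)) ->
  cser (fun n => (z / q) ^ n * l n)%C (f z * (2 * PI)).
Proof.
  intros Hl. apply (cauchy_series_aux f); [|exact Hl|].
  - intros t. apply (rcont_comp (fun s => q * cis s)%C f).
    + apply rcont_mult; [apply rcont_const|apply rcont_cis1].
    + eapply sdiff_ccont, Hf. rewrite Cmod_mult, Cmod_cis, Cmod_R, Rabs_pos_eq; lra.
  - rewrite <- (homotopy_integral_0 _ cauchy_kernel_integral). apply cauchy_formula.
Qed.

End Homotopy.

(** The Cauchy integrals over different circles give the same coefficients, because all of them
    are the coefficients of a power series of f near 0. *)
Lemma taylor_unit_disc (f : C -> C) : (forall w, Cmod w < 1 -> cdiff f w) ->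
  exists a, power_series_on 1 a f /\
    forall q n, 0 < q < 1 -> cint (fun t => f (q * cis t) * cis (- t) ^ n)%C 0 (2 * PI) (2 * PI * q ^ n * a n).
Proof.
  intros H. pose proof two_pi_pos as Hpi.
  assert (Hpi' : (2 * PI)%C <> 0) by (rewrite <- RtoC_mult; intros E; apply RtoC_inj in E; lra).
  set (f' := fun w => epsilon (inhabits (RtoC 0)) (sdiff f w)).
  assert (Hf : forall w, Cmod w < 1 -> sdiff f w (f' w)).
  { intros w Hw. apply epsilon_spec, H, Hw. }
  set (L := (fun q n => RInt (V := C_R_CompleteNormedModule) (fun t => f (q * cis t) * cis (- t) ^ n)%C 0 (2 * PI)) : R -> nat -> C).
  assert (HL : forall q n, 0 < q < 1 -> cint (fun t => f (q * cis t) * cis (- t) ^ n)%C 0 (2 * PI) (L q n)).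
  { intros q n Hq. apply (RInt_correct (V := C_R_CompleteNormedModule)).
    apply cint_ex; [lra|]. intros t _. apply rcont_mult; [|apply rcont_pow, rcont_cis_opp].
    apply (rcont_comp (fun s => q * cis s)%C f).
    - apply rcont_mult; [apply rcont_const|apply rcont_cis1].
    - eapply sdiff_ccont, Hf. rewrite Cmod_mult, Cmod_cis, Cmod_R, Rabs_pos_eq; lra. }
  set (c := fun q n => (L q n / (2 * PI * q ^ n))%C).
  assert (Hq0 : forall q, 0 < q < 1 -> RtoC q <> 0) by (intros q Hq E; apply RtoC_inj in E; lra).
  assert (Hc : forall q, 0 < q < 1 -> power_series_on q (c q) f).
  { intros q Hq z Hz.
    pose proof (cauchy_series f f' q z Hf Hz (proj2 Hq) (L q) (fun n => HL q n Hq)) as S.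
    apply (cser_scal (/ (2 * PI))) in S.
    replace (f z) with (/ (2 * PI) * (f z * (2 * PI)))%C by (field; repeat split; auto; intros E; apply RtoC_inj in E; lra).
    eapply cser_ext; [|exact S]. intros n. unfold c. simpl.
    unfold Cdiv at 1. rewrite Cpow_mult_l, Cpow_inv by auto. field.
    repeat split; try (apply Cpow_nz; auto); intros E; apply RtoC_inj in E; lra. }
  assert (Hcc : forall q n, 0 < q < 1 -> c q n = c (1 / 2) n).
  { intros q n Hq. apply (power_series_unique (Rmin q (1 / 2)) _ _ f).
    - apply Rmin_glb_lt; lra.
    - intros z Hz. apply Hc; [exact Hq|]. eapply Rlt_le_trans; [exact Hz|apply Rmin_l].
    - intros z Hz. apply Hc; [lra|]. eapply Rlt_le_trans; [exact Hz|apply Rmin_r]. }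
  exists (c (1 / 2)). split.
  - intros z Hz. pose proof (Cmod_ge_0 z).
    eapply cser_ext; [|apply (Hc ((Cmod z + 1) / 2)); lra].
    intros n. simpl. rewrite Hcc by lra. reflexivity.
  - intros q n Hq. rewrite <- (Hcc q n Hq). unfold c.
    replace (2 * PI * q ^ n * (L q n / (2 * PI * q ^ n)))%C with (L q n); [apply HL, Hq|].
    field. repeat split; try (apply Cpow_nz; auto); intros E; apply RtoC_inj in E; lra.
Qed.

Lemma cauchy_estimate (a : C) (f : C -> C) (q M : R) (n : nat) : 0 < q ->
  cint (fun t => f (q * cis t) * cis (- t) ^ n)%C 0 (2 * PI) (2 * PI * q ^ n * a) ->
  (forall t, 0 <= t <= 2 * PI -> Cmod (f (q * cis t)%C) <= M) -> Cmod a <= M / q ^ n.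
Proof.
  intros Hq H HM. pose proof PI_RGT_0. pose proof (pow_lt q n Hq).
  assert (HM' : forall t, 0 <= t <= 2 * PI -> Cmod (f (q * cis t)%C * cis (- t) ^ n) <= M).
  { intros t Ht. rewrite Cmod_mult, Cmod_pow, Cmod_cis, pow1, Rmult_1_r. now apply HM. }
  pose proof (cint_norm _ 0 (2 * PI) M _ ltac:(lra) HM' H) as B.
  rewrite !Cmod_mult, Cmod_pow, !Cmod_R, !Rabs_pos_eq in B by lra.
  apply Rle_div_r; [assumption|]. apply (Rmult_le_reg_l (2 * PI)); lra.
Qed.

(** * Pochhammer symbols and the Chu-Vandermonde sum *)

Lemma RtoC_neq_0 (x : R) : x <> 0 -> RtoC x <> 0.
Proof. intros H E. apply H. now apply RtoC_inj. Qed.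

Lemma fact_C_neq_0 (n : nat) : RtoC (INR (fact n)) <> 0.
Proof. apply RtoC_neq_0, INR_fact_neq_0. Qed.

Lemma INR_S_C_neq_0 (n : nat) : RtoC (INR (S n)) <> 0.
Proof. apply RtoC_neq_0, not_0_INR. lia. Qed.

Lemma fact_S_C (n : nat) : RtoC (INR (fact (S n))) = (INR (S n) * INR (fact n))%C.
Proof. rewrite <- RtoC_mult, <- mult_INR. reflexivity. Qed.

Lemma INR_S_C (n : nat) : RtoC (INR (S n)) = (INR n + 1)%C.
Proof. rewrite S_INR, RtoC_plus. reflexivity. Qed.

Lemma INR_plus_C (n m : nat) : RtoC (INR (n + m)) = (INR n + INR m)%C.
Proof. rewrite plus_INR, RtoC_plus. reflexivity. Qed.

Lemma pochhammer_S (z : C) (n : nat) : pochhammer z (S n) = (pochhammer z n * (z + INR n))%C.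
Proof. reflexivity. Qed.

Lemma pochhammer_S_l (z : C) (n : nat) : pochhammer z (S n) = (z * pochhammer (z + 1) n)%C.
Proof.
  induction n as [|n IH].
  - simpl. ring.
  - rewrite pochhammer_S, IH, pochhammer_S, INR_S_C. ring.
Qed.

Lemma pochhammer_add (z : C) (m n : nat) :
  pochhammer z (m + n) = (pochhammer z m * pochhammer (z + INR m) n)%C.
Proof.
  induction n as [|n IH].
  - rewrite Nat.add_0_r. simpl. ring.
  - rewrite Nat.add_succ_r, !pochhammer_S, IH, INR_plus_C. ring.
Qed.

Definition no_pole (c : C) : Prop := forall n : nat, (c + INR n)%C <> 0.

Lemma no_pole_shift (c : C) (m : nat) : no_pole c -> no_pole (c + INR m).
Proof. intros H n. rewrite <- Cplus_assoc, <- INR_plus_C. apply H. Qed.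

Lemma no_pole_S (c : C) : no_pole c -> no_pole (c + 1).
Proof. intros H. exact (no_pole_shift c 1 H). Qed.

Lemma no_pole_0 (c : C) : no_pole c -> c <> 0.
Proof. intros H E. apply (H O). rewrite E. simpl. ring. Qed.

Lemma no_pole_pos (c : R) : 0 < c -> no_pole c.
Proof.
  intros Hc n. rewrite <- RtoC_plus. apply RtoC_neq_0. pose proof (pos_INR n). lra.
Qed.

Lemma pochhammer_neq_0 (c : C) (n : nat) : no_pole c -> pochhammer c n <> 0.
Proof.
  intros H. induction n as [|n IH].
  - simpl. apply RtoC_neq_0. lra.
  - rewrite pochhammer_S. apply Cmult_neq_0; [exact IH|apply H].
Qed.

Lemma pochhammer_neg_nat_0 (n k : nat) : (n < k)%nat -> pochhammer (- INR n) k = 0.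
Proof.
  intros H. replace k with (n + S (k - S n))%nat by lia. rewrite pochhammer_add, pochhammer_S_l. ring.
Qed.

Lemma pochhammer_neg_nat (n k : nat) : (k <= n)%nat ->
  pochhammer (- INR n) k = ((-1) ^ k * INR (fact n) / INR (fact (n - k)))%C.
Proof.
  induction k as [|k IH]; intros H.
  - rewrite Nat.sub_0_r. simpl. field. apply fact_C_neq_0.
  - rewrite pochhammer_S, IH by lia.
    replace (n - k)%nat with (S (n - S k)) by lia. rewrite fact_S_C, Cpow_S.
    assert (E : (- INR n + INR k)%C = (- INR (S (n - S k)))%C).
    { replace n with (S (n - S k) + k)%nat at 1 by lia. rewrite INR_plus_C. ring. }
    rewrite E. field. split; [apply fact_C_neq_0|apply INR_S_C_neq_0].
Qed.

Lemma pochhammer_reflect (z : C) (n : nat) :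
  pochhammer z n = ((-1) ^ n * pochhammer (1 - z - INR n) n)%C.
Proof.
  revert z. induction n as [|n IH]; intros z.
  - simpl. ring.
  - rewrite pochhammer_S, IH, Cpow_S, pochhammer_S_l, INR_S_C.
    replace (1 - z - (INR n + 1) + 1)%C with (1 - z - INR n)%C by ring. ring.
Qed.

Lemma pochhammer_double (a : C) (m : nat) :
  (4 ^ m * pochhammer (a / 2) m * pochhammer ((a + 1) / 2) m)%C = pochhammer a (2 * m).
Proof.
  induction m as [|m IH].
  - simpl. ring.
  - replace (2 * S m)%nat with (S (S (2 * m))) by lia.
    rewrite !pochhammer_S, <- IH, Cpow_S, INR_S_C.
    replace (2 * m)%nat with (m + m)%nat by lia. rewrite INR_plus_C. field.
Qed.

(** Pascal's rule turns the sum for n+1 into two sums for n, one of them with both other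
    parameters raised. *)
Lemma chu_vandermonde (n : nat) (b c : C) : no_pole c ->
  csum (hyp2F1_coef (- INR n) b c) n = (pochhammer (c - b) n / pochhammer c n)%C.
Proof.
  revert b c. induction n as [|n IH]; intros b c Hc.
  - rewrite csum_0. unfold hyp2F1_coef. simpl. field.
  - pose proof (no_pole_0 c Hc) as Hc0.
    assert (Hp : forall k, pochhammer c k <> 0) by (intros; now apply pochhammer_neq_0).
    assert (Hp1 : forall k, pochhammer (c + 1) k <> 0) by (intros; apply pochhammer_neq_0; now apply no_pole_S).
    assert (T : forall j, hyp2F1_coef (- INR (S n)) b c (S j) =
       (hyp2F1_coef (- INR n) b c (S j) + (- (b / c)) * hyp2F1_coef (- INR n) (b + 1) (c + 1) j)%C).
    { intros j. unfold hyp2F1_coef. rewrite (pochhammer_S_l b), (pochhammer_S_l c), fact_S_C.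
      rewrite (pochhammer_S (- INR n)), (pochhammer_S_l (- INR (S n))), !INR_S_C.
      replace (- (INR n + 1) + 1)%C with (- INR n)%C by ring. field.
      pose proof (INR_S_C_neq_0 j) as Hj. rewrite INR_S_C in Hj.
      repeat split; auto. apply fact_C_neq_0. }
    assert (E : csum (hyp2F1_coef (- INR (S n)) b c) (S n) =
       (csum (hyp2F1_coef (- INR n) b c) (S n) + (- (b / c)) * csum (hyp2F1_coef (- INR n) (b + 1) (c + 1)) n)%C).
    { rewrite !csum_shift, <- csum_scal. rewrite <- Cplus_assoc, <- csum_plus.
      f_equal.
      apply csum_ext_le. intros k _. apply T. }
    rewrite E, csum_S, (IH b c Hc), (IH (b + 1)%C (c + 1)%C (no_pole_S c Hc)).
    unfold hyp2F1_coef at 1. rewrite pochhammer_neg_nat_0 by lia.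
    replace (c + 1 - (b + 1))%C with (c - b)%C by ring.
    rewrite (pochhammer_S (c - b)).
    assert (E2 : (c * pochhammer (c + 1) n)%C = (pochhammer c n * (c + INR n))%C)
      by (rewrite <- pochhammer_S_l; reflexivity).
    assert (E3 : pochhammer (c + 1) n = (pochhammer c n * (c + INR n) / c)%C) by (rewrite <- E2; field; exact Hc0).
    rewrite E3, (pochhammer_S c). field. repeat split; auto; try apply fact_C_neq_0.
Qed.

(** * Binomial series *)

(** Integration by parts around a circle relates the Cauchy integrals of a function and of its
    derivative. *)
Lemma taylor_derivative (f f' : C -> C) (a a' : nat -> C) :
  (forall w, Cmod w < 1 -> sdiff f w (f' w)) -> (forall w, Cmod w < 1 -> cdiff f' w) ->
  power_series_on 1 a f -> power_series_on 1 a' f' -> forall n, a' n = (INR (S n) * a (S n))%C.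
Proof.
  intros Hf Hf' Ha Ha' n. pose proof two_pi_pos as Hpi.
  destruct (taylor_unit_disc f (fun w Hw => ex_intro _ _ (Hf w Hw))) as (b & Hb & Ib).
  destruct (taylor_unit_disc f' Hf') as (b' & Hb' & Ib').
  rewrite (power_series_unique 1 a b f Rlt_0_1 Ha Hb (S n)), (power_series_unique 1 a' b' f' Rlt_0_1 Ha' Hb' n).
  set (q := / 2). assert (Hq : 0 < q < 1) by (unfold q; lra).
  assert (Hq0 : RtoC q <> 0) by (apply RtoC_neq_0; lra).
  specialize (Ib q (S n) Hq). specialize (Ib' q n Hq).
  assert (Hin : forall t, Cmod (q * cis t) < 1).
  { intros t. rewrite Cmod_mult, Cmod_cis, Cmod_R, Rabs_pos_eq; lra. }
  assert (Hce : forall t, (cis (- t) ^ S n)%C = cis (- INR (S n) * t)).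
  { intros t. rewrite cis_pow. f_equal. ring. }
  (* the boundary terms of an integration by parts around the circle cancel *)
  assert (I : cint (fun t => f' (q * cis t) * (q * (Ci * cis t)) * cis (- INR (S n) * t)
        + f (q * cis t) * (RtoC (- INR (S n)) * Ci * cis (- INR (S n) * t)))%C 0 (2 * PI)
        (f (q * cis (2 * PI)) * cis (- INR (S n) * (2 * PI)) - f (q * cis 0) * cis (- INR (S n) * 0))%C).
  { apply (cint_FTC (fun t => f (q * cis t) * cis (- INR (S n) * t))%C); [lra| |]; intros t _.
    - apply (cderiv_mult (fun t => f (q * cis t)%C) (fun t => cis (- INR (S n) * t))); [|apply cderiv_cis].
      apply (cderiv_comp (fun t => q * cis t)%C f); [|apply Hf, Hin].
      apply cderiv_pair; unfold cis, RtoC, Ci; simpl; apply is_derive_Reals; auto_derive; auto; ring.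
    - assert (R1 : rcont (fun s => q * cis s)%C t) by (apply rcont_mult; [apply rcont_const|apply rcont_cis1]).
      apply rcont_plus; repeat apply rcont_mult; try apply rcont_const; try apply rcont_cis; try apply rcont_cis1.
      + apply (rcont_comp (fun s => q * cis s)%C f'); [exact R1|].
        destruct (Hf' _ (Hin t)) as [l Hl]. eapply sdiff_ccont, Hl.
      + apply (rcont_comp (fun s => q * cis s)%C f); [exact R1|]. eapply sdiff_ccont, Hf, Hin. }
  assert (I2 := cint_plus _ _ _ _ _ _ (cint_scal (q * Ci) _ _ _ _ Ib') (cint_scal (RtoC (- INR (S n)) * Ci) _ _ _ _ Ib)).
  assert (E : (f (q * cis (2 * PI)) * cis (- INR (S n) * (2 * PI)) - f (q * cis 0) * cis (- INR (S n) * 0))%C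
            = (q * Ci * (2 * PI * q ^ n * b' n) + RtoC (- INR (S n)) * Ci * (2 * PI * q ^ S n * b (S n)))%C).
  { eapply cint_unique; [exact I|]. eapply cint_ext; [lra| |exact I2].
    intros t _. cbv beta. rewrite <- Hce, (Cpow_S (cis (- t)) n), cis_opp_inv. field. apply cis_neq_0. }
  replace (cis (2 * PI)) with (cis 0) in E by (unfold cis; rewrite cos_2PI, sin_2PI, cos_0, sin_0; reflexivity).
  replace (cis (- INR (S n) * (2 * PI))) with (cis (- INR (S n) * 0)) in E.
  2: { rewrite Rmult_0_r, cis_0. replace (- INR (S n) * (2 * PI)) with (- (INR (S n) * (2 * PI))) by ring.
       rewrite cis_opp_inv, cis_period. field. }
  rewrite RtoC_opp, Cpow_S in E.
  assert (E' : (q * Ci * (2 * PI * q ^ n) * (b' n - INR (S n) * b (S n)))%C = 0).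
  { transitivity (q * Ci * (2 * PI * q ^ n * b' n) + - INR (S n) * Ci * (2 * PI * (q * q ^ n) * b (S n)))%C; [ring|].
    rewrite <- E. ring. }
  apply Ceq_minus.
  destruct (Ceq_dec (b' n - INR (S n) * b (S n)) 0) as [|Hne]; [assumption|exfalso].
  revert E'. pose proof (Cpow_nz q n Hq0). pose proof PI_RGT_0.
  repeat apply Cmult_neq_0; auto; try apply Ci_nz; apply RtoC_neq_0; lra.
Qed.

Lemma disc_Re_pos (t : C) : Cmod t < 1 -> 0 < Re (1 - t).
Proof.
  intros H. pose proof (re_le_Cmod t) as Hr. unfold Cminus. rewrite re_plus, re_opp, re_RtoC.
  pose proof (Rle_abs (Re t)). lra.
Qed.

Lemma sdiff_binomial (b w : C) : slit (1 - w) ->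
  sdiff (fun t => Cpower (1 - t) (- b)) w (b * Cpower (1 - w) (- (b + 1))).
Proof.
  intros Hw.
  replace (b * Cpower (1 - w) (- (b + 1)))%C with (- b * Cpower (1 - w) (- b - 1) * (0 - 1))%C.
  - apply (sdiff_comp (fun t => 1 - t)%C (fun x => Cpower x (- b))).
    + apply sdiff_minus; [apply sdiff_const|apply sdiff_id].
    + now apply sdiff_Cpower.
  - replace (- (b + 1))%C with (- b - 1)%C by ring. ring.
Qed.

(** The derivative of (1 - t)^-c is c (1 - t)^-(c+1), so the n-th coefficient is obtained by n
    steps that each raise the exponent parameter. *)
Lemma binomial_series (b : C) :
  power_series_on 1 (fun n => pochhammer b n / INR (fact n))%C (fun t => Cpower (1 - t) (- b)).
Proof.
  assert (Hs : forall c w, Cmod w < 1 -> sdiff (fun t => Cpower (1 - t) (- c)) w (c * Cpower (1 - w) (- (c + 1)))).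
  { intros c w Hw. apply sdiff_binomial, slit_Re_pos, disc_Re_pos, Hw. }
  assert (Hex : forall c, exists a, power_series_on 1 a (fun t => Cpower (1 - t) (- c))).
  { intros c. destruct (taylor_unit_disc (fun t => Cpower (1 - t) (- c))) as (a & Ha & _).
    - intros w Hw. eexists. apply Hs, Hw.
    - now exists a. }
  assert (Hco : forall n c a, power_series_on 1 a (fun t => Cpower (1 - t) (- c)) ->
    a n = (pochhammer c n / INR (fact n))%C).
  { induction n as [|n IH]; intros c a Ha.
    - pose proof (Ha 0 ltac:(rewrite Cmod_0; lra)) as H0.
      cbv beta in H0.
      replace (a O) with (csum (fun k => a k * 0 ^ k)%C 0) by (rewrite csum_0; simpl; ring).
      replace (Cpower (1 - 0) (- c)) with (RtoC 1) in H0.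
      2: { replace (1 - 0)%C with (RtoC 1) by ring. now rewrite Cpower_at_1. }
      simpl. transitivity (RtoC 1); [|field].
      eapply cser_unique; [|exact H0]. apply cser_eps. intros eps He. exists O. intros m _.
      replace (csum (fun k => a k * 0 ^ k)%C m) with (csum (fun k => a k * 0 ^ k)%C 0); [rewrite Cmod_diag; exact He|].
      induction m as [|m IHm]; [reflexivity|]. rewrite csum_S, <- IHm, Cpow_S. ring.
    - destruct (Hex (c + 1)%C) as [a1 Ha1].
      assert (D := taylor_derivative (fun t => Cpower (1 - t) (- c)) (fun w => c * Cpower (1 - w) (- (c + 1)))%C
                     a (fun k => c * a1 k)%C (Hs c)).
      assert (D1 : forall k, (c * a1 k)%C = (INR (S k) * a (S k))%C).
      { apply D; [|exact Ha|].
        - intros w Hw. eexists. apply sdiff_mult; [apply sdiff_const|apply Hs, Hw].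
        - intros z Hz. eapply cser_ext; [|apply (cser_scal c _ _ (Ha1 z Hz))]. intros; simpl; ring. }
      specialize (D1 n). rewrite (IH _ _ Ha1) in D1.
      rewrite pochhammer_S_l, fact_S_C.
      assert (HS := INR_S_C_neq_0 n). assert (HF := fact_C_neq_0 n).
      transitivity (INR (S n) * a (S n) / INR (S n))%C; [field; exact HS|]. rewrite <- D1. field. auto. }
  destruct (Hex b) as [a Ha]. intros z Hz.
  eapply cser_ext; [|apply (Ha z Hz)]. intros n. simpl. rewrite (Hco n b a Ha). reflexivity.
Qed.

(** * Composition with a Moebius-type map *)

(** Multiplication of a power series by t^m. *)
Definition pshift (m : nat) (c : nat -> C) (n : nat) : C := if le_dec m n then c (n - m)%nat else 0.

Lemma power_series_shift (r : R) (m : nat) (c : nat -> C) (h : C -> C) :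
  power_series_on r c h -> power_series_on r (pshift m c) (fun t => t ^ m * h t)%C.
Proof.
  intros H z Hz. induction m as [|m IH].
  - replace (z ^ 0 * h z)%C with (h z) by (simpl; ring).
    eapply cser_ext; [|exact (H z Hz)]. intros n. unfold pshift.
    destruct le_dec; [|lia]. rewrite Nat.sub_0_r. reflexivity.
  - apply cser_decr_1. replace (z ^ S m * h z - pshift (S m) c 0 * z ^ 0)%C with (z * (z ^ m * h z))%C.
    + eapply cser_ext; [|apply (cser_scal z _ _ IH)]. intros n. simpl.
      unfold pshift. destruct (le_dec m n), (le_dec (S m) (S n)); try lia; [|ring].
      replace (S n - S m)%nat with (n - m)%nat by lia. ring.
    + unfold pshift. destruct (le_dec (S m) 0); [lia|]. rewrite Cpow_S. ring.
Qed.

Lemma cser_finite (a : nat -> C) (n : nat) : (forall k, (n < k)%nat -> a k = 0) -> cser a (csum a n).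
Proof.
  intros H. apply cser_eps. intros eps He. exists n. intros m Hm.
  replace (csum a m) with (csum a n); [rewrite Cmod_diag; exact He|].
  induction Hm as [|m Hm IH]; [reflexivity|]. rewrite csum_S, <- IH, H by lia. ring.
Qed.

(** The Taylor coefficients at 0 of (1 - eps t)^-b F (kappa t / (1 - eps t)^e), where f lists
    those of F. *)
Definition moebius_coef (f : nat -> C) (kappa b eps : C) (e n : nat) : C :=
  csum (fun m => f m * kappa ^ m *
    (pochhammer (b + INR e * INR m) (n - m) / INR (fact (n - m)) * eps ^ (n - m)))%C n.

Lemma moebius_small_circle (kappa eps : C) (e : nat) : Cmod eps <= 1 ->
  exists q, 0 < q < 1 /\ forall t, Cmod (kappa * (q * cis t) / (1 - eps * (q * cis t)) ^ e) <= / 4.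
Proof.
  intros Heps.
  set (D := 4 * 2 ^ e * (Cmod kappa + 1)).
  pose proof (Cmod_ge_0 kappa) as Nk. pose proof (pow_lt 2 e ltac:(lra)) as P2e.
  assert (HD : 4 <= D).
  { unfold D. pose proof (pow_R1_Rle 2 e ltac:(lra)). nra. }
  exists (/ D). assert (HD0 : 0 < / D) by (apply Rinv_0_lt_compat; lra).
  assert (HD1 : / D <= / 4) by (apply Rinv_le_contravar; lra).
  split; [lra|]. intros t.
  set (w := (RtoC (/ D) * cis t)%C).
  assert (Hw : Cmod w = / D) by (unfold w; rewrite Cmod_mult, Cmod_cis, Cmod_R, Rabs_pos_eq; lra).
  assert (Hlow : / 2 <= Cmod (1 - eps * w)).
  { assert (1 <= Cmod (1 - eps * w) + Cmod (eps * w)).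
    { pose proof (Cmod_triangle (1 - eps * w) (eps * w)) as Tr.
      replace (1 - eps * w + eps * w)%C with (RtoC 1) in Tr by ring. rewrite Cmod_1 in Tr. exact Tr. }
    rewrite Cmod_mult, Hw in H. pose proof (Cmod_ge_0 eps). nra. }
  assert (Hne : (1 - eps * w)%C <> 0) by (apply Cmod_gt_0; lra).
  rewrite Cmod_div by (apply Cpow_nz, Hne). rewrite Cmod_pow, Cmod_mult, Hw.
  assert (Hpl : (/ 2) ^ e <= Cmod (1 - eps * w) ^ e) by (apply pow_incr; lra).
  rewrite pow_inv in Hpl.
  assert (0 < / 2 ^ e) by (apply Rinv_0_lt_compat; lra).
  apply Rle_div_l; [lra|].
  apply Rle_trans with (/ 4 * / 2 ^ e); [|lra].
  apply (Rmult_le_reg_r (D * 2 ^ e)); [apply Rmult_lt_0_compat; lra|].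
  field_simplify; [|lra|lra]. unfold D. nra.
Qed.

(** Once holomorphy on the whole disc is known, the Taylor coefficients may be computed on an
    arbitrarily small circle, where the outer series converges uniformly. *)
Lemma moebius_series (f : nat -> C) (F : C -> C) (kappa b eps : C) (e : nat) :
  Cmod eps <= 1 -> power_series_on 1 f F ->
  (forall t, Cmod t < 1 -> cdiff (fun t => Cpower (1 - eps * t) (- b) * F (kappa * t / (1 - eps * t) ^ e))%C t) ->
  power_series_on 1 (moebius_coef f kappa b eps e)
    (fun t => Cpower (1 - eps * t) (- b) * F (kappa * t / (1 - eps * t) ^ e))%C.
Proof.
  intros Heps HF Hd. pose proof two_pi_pos as Hpi.
  set (g := fun t => (Cpower (1 - eps * t) (- b) * F (kappa * t / (1 - eps * t) ^ e))%C) in *.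
  destruct (taylor_unit_disc g Hd) as (a & Ha & Ia).
  assert (Hea : forall t, Cmod t < 1 -> Cmod (eps * t) < 1).
  { intros t Ht. rewrite Cmod_mult. pose proof (Cmod_ge_0 t). pose proof (Cmod_ge_0 eps). nra. }
  destruct (moebius_small_circle kappa eps e Heps) as (q & Hq & Hsmall).
  assert (Hin : forall t, Cmod (q * cis t) < 1).
  { intros t. rewrite Cmod_mult, Cmod_cis, Cmod_R, Rabs_pos_eq; lra. }
  assert (Hq0 : RtoC q <> 0) by (apply RtoC_neq_0; lra).
  assert (Hslit : forall t, Cmod t < 1 -> slit (1 - eps * t)).
  { intros t Ht. apply slit_Re_pos, disc_Re_pos, Hea, Ht. }
  assert (Hpre : forall s t, Cmod t < 1 -> cdiff (fun t => Cpower (1 - eps * t) s) t).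
  { intros s t Ht. eexists. apply (sdiff_comp (fun t => 1 - eps * t)%C (fun x => Cpower x s)).
    - apply sdiff_minus; [apply sdiff_const|apply (sdiff_mult (fun _ => eps)); [apply sdiff_const|apply sdiff_id]].
    - apply sdiff_Cpower, Hslit, Ht. }
  assert (Hbin : forall s, power_series_on 1 (fun n => pochhammer s n / INR (fact n) * eps ^ n)%C
                   (fun t => Cpower (1 - eps * t) (- s))).
  { intros s z Hz. eapply cser_ext; [|apply (binomial_series s (eps * z)%C), Hea, Hz].
    intros n. simpl. rewrite Cpow_mult_l. ring. }
  set (T := fun m t => (f m * kappa ^ m * (t ^ m * Cpower (1 - eps * t) (- (b + INR e * INR m))))%C).
  assert (HTg : forall m t, Cmod t < 1 -> T m t =
     (Cpower (1 - eps * t) (- b) * (f m * (kappa * t / (1 - eps * t) ^ e) ^ m))%C).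
  { intros m t Ht. unfold T. pose proof (slit_neq_0 _ (Hslit t Ht)) as Hne.
    rewrite Copp_plus_distr, Cpower_plus. unfold Cdiv.
    rewrite !Cpow_mult_l, Cpow_inv by (apply Cpow_nz, Hne).
    rewrite <- Cpow_mult_r, (Cpower_opp _ (INR e * INR m)), <- RtoC_mult, <- mult_INR, Cpower_nat by exact Hne. ring. }
  assert (HTs : forall m, power_series_on 1
     (fun n => f m * kappa ^ m * pshift m (fun k => pochhammer (b + INR e * INR m) k / INR (fact k) * eps ^ k) n)%C (T m)).
  { intros m z Hz. unfold T.
    eapply cser_ext; [|apply (cser_scal (f m * kappa ^ m) _ _ (power_series_shift 1 m _ _ (Hbin (b + INR e * INR m)%C) z Hz))].
    intros n. simpl. ring. }
  assert (HTd : forall m t, Cmod t < 1 -> cdiff (T m) t).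
  { intros m t Ht. unfold T.
    assert (Hp : forall k, cdiff (fun x => x ^ k)%C t).
    { induction k as [|k [l IHk]]; [exists 0; apply (sdiff_const 1)|].
      eexists. apply (sdiff_mult (fun x => x) (fun x => x ^ k)%C); [apply sdiff_id|exact IHk]. }
    destruct (Hp m) as [l1 H1]. destruct (Hpre (- (b + INR e * INR m))%C t Ht) as [l2 H2].
    eexists. apply sdiff_mult; [apply sdiff_const|]. apply sdiff_mult; [exact H1|exact H2]. }
  destruct (power_series_bound 1 (/ 2) f F ltac:(lra) HF) as (M & HM & HfM).
  destruct (rcont_bounded (fun t => Cpower (1 - eps * (q * cis t)) (- b)) 0 (2 * PI)) as (B & HB & HBb); [lra| |].
  { intros t _. apply (rcont_comp (fun s => q * cis s)%C (fun t => Cpower (1 - eps * t) (- b))).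
    - apply rcont_mult; [apply rcont_const|apply rcont_cis1].
    - destruct (Hpre (- b)%C _ (Hin t)) as [l Hl]. eapply sdiff_ccont, Hl. }
  assert (Hfin : forall n, a n = moebius_coef f kappa b eps e n).
  { intros n. specialize (Ia q n Hq).
    set (co := fun m => (f m * kappa ^ m * pshift m (fun k => pochhammer (b + INR e * INR m) k / INR (fact k) * eps ^ k) n)%C).
    assert (HcT : forall m, cint (fun t => T m (q * cis t) * cis (- t) ^ n)%C 0 (2 * PI) (2 * PI * q ^ n * co m)).
    { intros m. destruct (taylor_unit_disc (T m) (HTd m)) as (c & Hc & Ic).
      replace (co m) with (c n); [apply Ic, Hq|].
      apply (power_series_unique 1 c _ (T m) Rlt_0_1 Hc (HTs m)). }
    assert (HS : cser (fun m => 2 * PI * q ^ n * co m)%C (2 * PI * q ^ n * a n)).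
    { refine (cint_series (fun m t => T m (q * cis t) * cis (- t) ^ n)%C _ _ _ 0 (2 * PI) (B * M) (/ 2) _ _ _ _ _ HcT Ia).
      - lra. - lra. - nra.
      - intros m t Ht. rewrite HTg by apply Hin.
        rewrite !Cmod_mult, !Cmod_pow, Cmod_cis, pow1, Rmult_1_r.
        specialize (HBb t Ht). specialize (HfM m). specialize (Hsmall t).
        assert (P : Cmod (kappa * (q * cis t) / (1 - eps * (q * cis t)) ^ e) ^ m <= (/ 4) ^ m).
        { apply pow_incr. split; [apply Cmod_ge_0|exact Hsmall]. }
        apply Rle_trans with (B * (M / (/ 2) ^ m * (/ 4) ^ m)).
        + apply Rmult_le_compat; try apply Cmod_ge_0; [|exact HBb|].
          * apply Rmult_le_pos; [apply Cmod_ge_0|apply pow_le, Cmod_ge_0].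
          * apply Rmult_le_compat; try apply Cmod_ge_0; [apply pow_le, Cmod_ge_0|exact HfM|exact P].
        + right. replace (/ 4) with (/ 2 * / 2) by lra. rewrite Rpow_mult_distr. field. apply pow_nonzero. lra.
      - intros t Ht. set (w := (kappa * (q * cis t) / (1 - eps * (q * cis t)) ^ e)%C).
        assert (Hw : Cmod w < 1) by (specialize (Hsmall t); unfold w; lra).
        pose proof (cser_scal (Cpower (1 - eps * (q * cis t)) (- b) * cis (- t) ^ n)%C _ _ (HF w Hw)) as S1.
        replace (g (q * cis t)%C * cis (- t) ^ n)%C
          with (Cpower (1 - eps * (q * cis t)) (- b) * cis (- t) ^ n * F w)%C by (unfold g; fold w; ring).
        eapply cser_ext; [|exact S1]. intros m. cbv beta. rewrite HTg by apply Hin. fold w. ring. }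
    set (K := (2 * PI * q ^ n)%C) in *.
    assert (HK : K <> 0).
    { unfold K. pose proof (Cpow_nz q n Hq0). pose proof PI_RGT_0.
      repeat apply Cmult_neq_0; auto; apply RtoC_neq_0; lra. }
    assert (E : (K * a n)%C = (K * moebius_coef f kappa b eps e n)%C).
    { rewrite (cser_unique _ _ _ HS (cser_finite (fun m => K * co m)%C n ltac:(
        intros m Hm; unfold co, pshift; destruct le_dec; [lia|ring]))).
      rewrite csum_scal. f_equal. apply csum_ext_le. intros m Hm.
      unfold co, pshift. destruct le_dec; [reflexivity|lia]. }
    transitivity (K * a n / K)%C; [field; exact HK|]. rewrite E. field. exact HK. }
  intros z Hz. eapply cser_ext; [|apply (Ha z Hz)]. intros n. simpl. rewrite Hfin. reflexivity.
Qed.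

(** * Transformations of the Gauss function *)

Lemma is_hyp2F1_cdiff (a b c : C) (F : C -> C) (z : C) : is_hyp2F1 a b c F -> hyp2F1_domain z -> cdiff F z.
Proof. intros [H _] Hz. apply analytic_at_cdiff, H, Hz. Qed.

Lemma is_hyp2F1_series (a b c : C) (F : C -> C) : is_hyp2F1 a b c F -> power_series_on 1 (hyp2F1_coef a b c) F.
Proof. intros [_ H] z Hz. apply is_pseries_cser, H, Hz. Qed.

Lemma hyp2F1_coef_sym (a b c : C) (n : nat) : hyp2F1_coef a b c n = hyp2F1_coef b a c n.
Proof. unfold hyp2F1_coef. f_equal. ring. Qed.

Lemma is_hyp2F1_sym (a b c : C) (F : C -> C) : is_hyp2F1 a b c F -> is_hyp2F1 b a c F.
Proof.
  intros [H1 H2]. split; [exact H1|]. intros z Hz. specialize (H2 z Hz).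
  apply is_pseries_cser. apply is_pseries_cser in H2. eapply cser_ext; [|exact H2].
  intros n. simpl. now rewrite hyp2F1_coef_sym.
Qed.

Lemma pfaff_domain (t : C) : Cmod t < 1 -> hyp2F1_domain (- t / (1 - t)).
Proof.
  intros Ht [H1 H2]. pose proof (disc_Re_pos t Ht) as Hp.
  pose proof (slit_neq_0 _ (slit_Re_pos _ Hp)) as Hne.
  set (w := (- t / (1 - t))%C) in *.
  assert (E : ((1 - w) * (1 - t))%C = RtoC 1) by (unfold w; field; exact Hne).
  apply (f_equal Re) in E. rewrite re_mult in E. unfold Cminus in E at 1 3.
  rewrite re_plus, im_plus, re_opp, im_opp, H1 in E. simpl (Re 1) in E. simpl (Im 1) in E.
  assert ((1 + - Re w) * Re (1 - t) <= 0) by nra. simpl in *. lra.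
Qed.

Definition koebe (t : C) : C := (4 * t / ((1 + t) * (1 + t)))%C.

Lemma disc_Re_pos_plus (t : C) : Cmod t < 1 -> 0 < Re (1 + t).
Proof.
  intros H. replace (1 + t)%C with (1 - - t)%C by ring. apply disc_Re_pos. now rewrite Cmod_opp.
Qed.

(** 1 - K(t) is the square of (1 - t)/(1 + t), which has positive real part; so K omits [1, oo),
    and the cut plane is star-shaped about 0. *)
Lemma koebe_domain (t : C) (s : R) : Cmod t < 1 -> 0 <= s <= 1 ->
  hyp2F1_domain (s * koebe t).
Proof.
  intros Ht Hs [H1 H2]. rewrite im_scal_l in H1. rewrite re_scal_l in H2.
  set (w := koebe t) in *.
  assert (Hs0 : 0 < s) by (destruct (Req_dec s 0) as [->|]; lra).
  assert (Hw1 : Im w = 0) by (apply Rmult_integral in H1; lra).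
  assert (Hw2 : 1 <= Re w) by nra.
  assert (Hp1 : 0 < Re (1 - t)) by now apply disc_Re_pos.
  assert (Hp2 : 0 < Re (1 + t)) by now apply disc_Re_pos_plus.
  pose proof (slit_neq_0 _ (slit_Re_pos _ Hp2)) as Hne.
  set (u := ((1 - t) / (1 + t))%C).
  assert (E : (u * u)%C = (1 - w)%C) by (unfold u, w, koebe; field; exact Hne).
  assert (Hu : 0 < Re u).
  { assert (Eu : (u * (1 + t))%C = (1 - t)%C) by (unfold u; field; exact Hne).
    assert (Hc : Re (u * (Cmod (1 + t) * Cmod (1 + t))) = 1 - Cmod t * Cmod t).
    { assert (Hcc : (RtoC (Cmod (1 + t)) * Cmod (1 + t))%C = ((1 + t) * Cconj (1 + t))%C).
      { rewrite <- Cmod2_conj. rewrite RtoC_pow. ring. }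
      rewrite Hcc, Cmult_assoc, Eu, Cmod_sqr.
      destruct t as [x y]; simpl; ring. }
    rewrite <- RtoC_mult, re_scal_r in Hc. pose proof (Cmod_ge_0 t).
    pose proof (proj1 (Cmod_gt_0 (1 + t)) Hne). nra. }
  assert (E1 := f_equal Im E). assert (E2 := f_equal Re E).
  unfold Cminus in E1, E2. rewrite im_mult, im_plus, im_opp, Hw1 in E1. rewrite re_mult, re_plus, re_opp in E2.
  simpl (Im 1) in E1. simpl (Re 1) in E2.
  assert (Im u = 0) by nra. nra.
Qed.

Lemma Cpow_m1_sub (n m : nat) : (m <= n)%nat -> ((-1) ^ (n - m) = (-1) ^ n * (-1) ^ m)%C.
Proof.
  intros H. replace n with ((n - m) + m)%nat at 2 by lia. rewrite Cpow_add_r, <- Cmult_assoc, <- Cpow_mult_l.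
  replace (-1 * -1)%C with (RtoC 1) by ring. rewrite Cpow_1_l. ring.
Qed.

(** The Pochhammer symbols of p combine into (p)_n, leaving a Chu-Vandermonde sum over m. *)
Lemma pfaff_coef (p b c : C) (n : nat) : no_pole c ->
  moebius_coef (hyp2F1_coef p b c) (-1) p 1 1 n = hyp2F1_coef p (c - b) c n.
Proof.
  intros Hc. unfold moebius_coef.
  transitivity (csum (fun m => pochhammer p n / INR (fact n) * hyp2F1_coef (- INR n) b c m)%C n).
  - apply csum_ext_le. intros m Hm. unfold hyp2F1_coef.
    replace (p + INR 1 * INR m)%C with (p + INR m)%C by (simpl; ring).
    assert (E : pochhammer p n = (pochhammer p m * pochhammer (p + INR m) (n - m))%C).
    { rewrite <- pochhammer_add. f_equal. lia. }
    rewrite E, Cpow_1_l, pochhammer_neg_nat by exact Hm.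
    pose proof (fact_C_neq_0 m). pose proof (fact_C_neq_0 n). pose proof (fact_C_neq_0 (n - m)).
    pose proof (pochhammer_neq_0 c m Hc). field. auto.
  - rewrite csum_scal, chu_vandermonde by exact Hc. unfold hyp2F1_coef.
    pose proof (fact_C_neq_0 n). pose proof (pochhammer_neq_0 c n Hc). field. auto.
Qed.

(** The duplication formula turns 4^m (a/2)_m ((a+1)/2)_m into (a)_(2m); what remains is a Chu-
    Vandermonde sum with upper parameter a + n. *)
Lemma koebe_coef (a c : C) (n : nat) : no_pole c ->
  moebius_coef (hyp2F1_coef (a / 2) ((a + 1) / 2) c) 4 a (-1) 2 n = hyp2F1_coef a (1 + a - c) c n.
Proof.
  intros Hc. unfold moebius_coef.
  transitivity (csum (fun m => (-1) ^ n * pochhammer a n / INR (fact n) * hyp2F1_coef (- INR n) (a + INR n) c m)%C n).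
  - apply csum_ext_le. intros m Hm. unfold hyp2F1_coef.
    replace (a + INR 2 * INR m)%C with (a + INR (2 * m))%C.
    2: { f_equal. rewrite <- RtoC_mult, <- mult_INR. reflexivity. }
    assert (E : (pochhammer a n * pochhammer (a + INR n) m)%C
              = (4 ^ m * pochhammer (a / 2) m * pochhammer ((a + 1) / 2) m * pochhammer (a + INR (2 * m)) (n - m))%C).
    { rewrite pochhammer_double, <- !pochhammer_add. f_equal. lia. }
    rewrite Cpow_m1_sub, pochhammer_neg_nat by exact Hm.
    pose proof (fact_C_neq_0 m). pose proof (fact_C_neq_0 n). pose proof (fact_C_neq_0 (n - m)).
    pose proof (pochhammer_neq_0 c m Hc).
    transitivity ((4 ^ m * pochhammer (a / 2) m * pochhammer ((a + 1) / 2) m * pochhammer (a + INR (2 * m)) (n - m))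
       * ((-1) ^ n * (-1) ^ m) / (pochhammer c m * INR (fact m) * INR (fact (n - m))))%C; [field; auto|].
    rewrite <- E. field. auto.
  - rewrite csum_scal, chu_vandermonde by exact Hc. unfold hyp2F1_coef.
    rewrite (pochhammer_reflect (1 + a - c)).
    replace (1 - (1 + a - c) - INR n)%C with (c - (a + INR n))%C by ring.
    pose proof (fact_C_neq_0 n). pose proof (pochhammer_neq_0 c n Hc). field. auto.
Qed.

Lemma pfaff_series (p b c : C) (F : C -> C) : no_pole c -> is_hyp2F1 p b c F ->
  power_series_on 1 (hyp2F1_coef p (c - b) c) (fun t => Cpower (1 - t) (- p) * F (- t / (1 - t)))%C.
Proof.
  intros Hc HF z Hz.
  assert (E : forall t, (Cpower (1 - t) (- p) * F (- t / (1 - t)))%C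
                      = (Cpower (1 - 1 * t) (- p) * F (-1 * t / (1 - 1 * t) ^ 1))%C).
  { intros t. rewrite Cpow_1_r. replace (1 - 1 * t)%C with (1 - t)%C by ring. do 2 f_equal. f_equal. ring. }
  apply (cser_ext (fun n => moebius_coef (hyp2F1_coef p b c) (-1) p 1 1 n * z ^ n)%C).
  { intros n. now rewrite pfaff_coef. }
  cbv beta. rewrite E.
  apply (moebius_series _ F (-1) p 1 1); [rewrite Cmod_1; lra|exact (is_hyp2F1_series _ _ _ _ HF)| |exact Hz].
  intros t Ht. pose proof (slit_Re_pos _ (disc_Re_pos t Ht)) as Hs.
  destruct (is_hyp2F1_cdiff _ _ _ _ _ HF (pfaff_domain t Ht)) as [l Hl].
  assert (D : sdiff (fun t => 1 - t)%C t (0 - 1)) by (apply sdiff_minus; [apply sdiff_const|apply sdiff_id]).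
  assert (N : sdiff (fun t => - t)%C t (-1)).
  { apply (sdiff_ext_near (fun t => -1 * t)%C _ _ _ 1 Rlt_0_1); [intros; ring|apply sdiff_linear]. }
  eexists. eapply (sdiff_ext_near _ _ _ _ 1 Rlt_0_1 (fun x _ => E x)). apply sdiff_mult.
  - apply (sdiff_comp (fun t => 1 - t)%C (fun x => Cpower x (- p))); [exact D|now apply sdiff_Cpower].
  - apply (sdiff_comp (fun t => - t / (1 - t))%C F); [|exact Hl].
    apply (sdiff_div (fun t => - t)%C (fun t => 1 - t)%C); [exact N|exact D|now apply slit_neq_0].
Qed.

Lemma koebe_cdiff (t : C) : Cmod t < 1 -> cdiff koebe t.
Proof.
  intros Ht. pose proof (slit_neq_0 _ (slit_Re_pos _ (disc_Re_pos_plus t Ht))) as Hne. eexists.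
  assert (D : sdiff (fun t => 1 + t)%C t (0 + 1)) by (apply sdiff_plus; [apply sdiff_const|apply sdiff_id]).
  apply (sdiff_div (fun t => 4 * t)%C (fun t => (1 + t) * (1 + t))%C).
  - apply (sdiff_mult (fun _ => RtoC 4)); [apply sdiff_const|apply sdiff_id].
  - apply (sdiff_mult (fun t => 1 + t)%C (fun t => 1 + t)%C); exact D.
  - now apply Cmult_neq_0.
Qed.

Lemma koebe_composite_cdiff (F : C -> C) (b : C) (s : R) (t : C) : Cmod t < 1 -> 0 <= s <= 1 ->
  (forall z, hyp2F1_domain z -> cdiff F z) -> cdiff (fun t => Cpower (1 + t) (- b) * F (s * koebe t))%C t.
Proof.
  intros Ht Hs HF. destruct (koebe_cdiff t Ht) as [l Hl].
  destruct (HF _ (koebe_domain t s Ht Hs)) as [m Hm].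
  eexists. apply sdiff_mult.
  - apply (sdiff_comp (fun t => 1 + t)%C (fun x => Cpower x (- b))).
    + apply sdiff_plus; [apply sdiff_const|apply sdiff_id].
    + apply sdiff_Cpower, slit_Re_pos, disc_Re_pos_plus, Ht.
  - apply (sdiff_comp (fun t => s * koebe t)%C F); [|exact Hm].
    apply sdiff_mult; [apply sdiff_const|exact Hl].
Qed.

Lemma koebe_series (F : C -> C) (f : nat -> C) (b : C) (s : R) : 0 <= s <= 1 -> power_series_on 1 f F ->
  (forall z, hyp2F1_domain z -> cdiff F z) ->
  power_series_on 1 (moebius_coef f (s * 4) b (-1) 2) (fun t => Cpower (1 + t) (- b) * F (s * koebe t))%C.
Proof.
  intros Hs Hf HF z Hz.
  assert (E : forall t, (Cpower (1 + t) (- b) * F (s * koebe t))%C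
                      = (Cpower (1 - -1 * t) (- b) * F (s * 4 * t / (1 - -1 * t) ^ 2))%C).
  { intros t. replace (1 - -1 * t)%C with (1 + t)%C by ring. do 2 f_equal. unfold koebe, Cdiv.
    replace ((1 + t) ^ 2)%C with ((1 + t) * (1 + t))%C by ring. ring. }
  cbv beta. rewrite E. apply (moebius_series f F (s * 4)%C b (-1) 2); [rewrite Cmod_R, Rabs_left; lra|exact Hf| |exact Hz].
  intros t Ht. destruct (koebe_composite_cdiff F b s t Ht Hs HF) as [l Hl]. exists l.
  exact (sdiff_ext_near _ _ _ _ 1 Rlt_0_1 (fun x _ => E x) Hl).
Qed.

(** The Legendre-type function at -t/(1-t) and the function of argument 4t/(1+t)^2 are both
    elementary multiples of the same series in t. *)
Lemma quadratic_transformation (a c t : C) (F1 F2 : C -> C) : no_pole c -> Cmod t < 1 ->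
  is_hyp2F1 (1 + a - c) (c - a) c F1 -> is_hyp2F1 (a / 2) ((a + 1) / 2) c F2 ->
  F1 (- t / (1 - t))%C
  = (Cpower (1 - t) (1 + a - c) * Cpower (1 + t) (- a) * F2 (koebe t))%C.
Proof.
  intros Hc Ht H1 H2.
  pose proof (pfaff_series _ _ _ _ Hc H1 t Ht) as S1.
  pose proof (koebe_series F2 _ a 1 ltac:(lra) (is_hyp2F1_series _ _ _ _ H2)
                (fun z => is_hyp2F1_cdiff _ _ _ _ z H2) t Ht) as S2.
  cbv beta in S1, S2.
  assert (E : (Cpower (1 - t) (- (1 + a - c)) * F1 (- t / (1 - t)))%C
            = (Cpower (1 + t) (- a) * F2 (1 * koebe t))%C).
  { eapply cser_unique; [exact S1|]. eapply cser_ext; [|exact S2]. intros n. cbv beta.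
    replace (1 * 4)%C with (RtoC 4) by ring. rewrite koebe_coef by exact Hc.
    rewrite hyp2F1_coef_sym. replace (c - (c - a))%C with a by ring. reflexivity. }
  rewrite (Cmult_1_l (koebe t)) in E. rewrite <- Cmult_assoc, <- E, Cpower_opp. field.
  apply Cpower_neq_0.
Qed.

(** * Analytic continuation of the Gauss series *)

Lemma cderiv_segment (a b : C) (t : R) : cderiv (fun s => a + RtoC s * b)%C t b.
Proof.
  intros eps He. exists 1. split; [lra|]. intros s _.
  replace (a + s * b - (a + t * b) - RtoC (s - t) * b)%C with (RtoC 0) by (rewrite RtoC_minus; ring).
  rewrite Cmod_0. pose proof (Rabs_pos (s - t)). nra.
Qed.

(** Along the segment from p to pv the difference of the two logarithms has derivative 0. *)
Lemma Cln_mult_segment (p v : C) : 0 < Re v ->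
  (forall tau : R, 0 <= tau <= 1 -> slit (p * (1 + tau * (v - 1)))) -> Cln (p * v) = (Cln p + Cln v)%C.
Proof.
  intros Hv H.
  set (D := fun w => (Cln (p * w) - Cln w)%C).
  assert (E : D (1 + RtoC 0 * (v - 1))%C = D (1 + RtoC 1 * (v - 1))%C).
  { apply (eq_is_derive (V := C_R_NormedModule) (fun tau => D (1 + RtoC tau * (v - 1))%C) 0 1); [|lra].
    intros tau Ht. apply cderiv_is_derive. set (w := (1 + tau * (v - 1))%C).
    pose proof (H tau Ht) as Hs. fold w in Hs.
    assert (Hw : slit w).
    { apply slit_Re_pos. unfold w, Cminus. rewrite re_plus, re_scal_l, re_plus, re_opp. simpl (Re 1). nra. }
    pose proof (slit_neq_0 _ Hs) as Hpw. pose proof (slit_neq_0 _ Hw) as Hw0.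
    replace (zero : C_R_NormedModule) with ((/ (p * w) * (0 * w + p * 1) - / w) * (v - 1))%C.
    - apply (cderiv_comp (fun tau => 1 + RtoC tau * (v - 1))%C D); [apply cderiv_segment|]. fold w.
      apply sdiff_minus; [|now apply sdiff_Cln].
      apply (sdiff_comp (fun w => p * w)%C Cln); [|now apply sdiff_Cln].
      apply sdiff_mult; [apply sdiff_const|apply sdiff_id].
    - assert (Hp0 : p <> 0) by (intros E; apply Hpw; rewrite E; ring).
      change (zero : C_R_NormedModule) with (RtoC 0). field. split; assumption. }
  unfold D in E. rewrite Cmult_0_l, Cplus_0_r, Cmult_1_r, (Cln_RtoC 1), ln_1 in E by lra.
  replace (1 + 1 * (v - 1))%C with v in E by ring.
  replace (Cln (p * v)) with (Cln (p * v) - Cln v + Cln v)%C by ring. rewrite <- E. ring.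
Qed.

Lemma domain_slit (z : C) (s : R) : hyp2F1_domain z -> 0 <= s <= 1 -> slit (1 - z * s).
Proof.
  intros Hz Hs [H1 H2]. unfold Cminus in *. rewrite im_plus, im_opp, im_scal_r in H1.
  rewrite re_plus, re_opp, re_scal_r in H2. simpl (Im 1) in H1. simpl (Re 1) in H2.
  apply Hz. assert (s <> 0) by (intros ->; lra).
  assert (Im z * s = 0) by lra. apply Rmult_integral in H0. split; [lra|].
  destruct (Rle_or_lt 1 (Re z)); [assumption|nra].
Qed.

Lemma domain_open (z : C) : hyp2F1_domain z -> exists d, 0 < d /\ forall x, Cmod (x - z) < d -> hyp2F1_domain x.
Proof.
  intros Hz.
  assert (Hs : slit (1 - z)) by (replace (1 - z)%C with (1 - z * 1)%C by ring; apply (domain_slit z 1 Hz); lra).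
  destruct (slit_open _ Hs) as (d & Hd & H). exists d. split; [exact Hd|].
  intros x Hx [H1 H2]. apply (H (1 - x)%C).
  - replace (1 - x - (1 - z))%C with (- (x - z))%C by ring. now rewrite Cmod_opp.
  - unfold Cminus. rewrite im_plus, re_plus, im_opp, re_opp. simpl. simpl in *. lra.
Qed.

Definition euler_integral (w : R -> C) (a z : C) : C :=
  RInt (V := C_R_CompleteNormedModule) (fun s => w s * Cpower (1 - z * s) (- a))%C 0 1.

Lemma rcont_kernel (z s0 : C) (s : R) : slit (1 - z * s) -> rcont (fun s => Cpower (1 - z * s) s0) s.
Proof.
  intros H. apply (rcont_comp (fun s => 1 - z * s)%C (fun x => Cpower x s0)).
  - apply (rcont_ext (fun s => 1 + (- z) * s)%C); [intros; ring|].
    apply rcont_plus; [apply rcont_const|]. apply rcont_mult; [apply rcont_const|apply rcont_RtoC].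
  - eapply sdiff_ccont, sdiff_Cpower, H.
Qed.

(** Expanding the Euler kernel about an arbitrary point of the cut plane and integrating term by
    term gives the local power series. *)
Lemma euler_expansion (w : R -> C) (a z0 z : C) (kappa : R) :
  (forall s, 0 <= s <= 1 -> rcont w s) -> 0 <= kappa < 1 ->
  (forall s, 0 <= s <= 1 -> slit (1 - z0 * s)) -> (forall s, 0 <= s <= 1 -> slit (1 - z * s)) ->
  (forall s, 0 <= s <= 1 -> Cmod ((z - z0) * s / (1 - z0 * s)) <= kappa) ->
  (forall s, 0 <= s <= 1 -> Cln (1 - z * s) = (Cln (1 - z0 * s) + Cln (1 - (z - z0) * s / (1 - z0 * s)))%C) ->
  cser (fun n => RInt (V := C_R_CompleteNormedModule)
          (fun s => w s * (pochhammer a n / INR (fact n)) * (s ^ n * Cpower (1 - z0 * s) (- a - INR n)))%C 0 1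
        * (z - z0) ^ n)%C (euler_integral w a z).
Proof.
  intros Hw Hk Hs0 Hs Hbd Hln.
  set (rho := (1 + kappa) / 2).
  destruct (power_series_bound 1 rho _ _ ltac:(unfold rho; lra) (binomial_series a)) as (A & HA & HAn).
  destruct (rcont_bounded w 0 1 ltac:(lra) Hw) as (W & HW & HWb).
  destruct (rcont_bounded (fun s => Cpower (1 - z0 * s) (- a)) 0 1 ltac:(lra)) as (B & HB & HBb).
  { intros s Hs'. apply rcont_kernel, Hs0, Hs'. }
  set (g := fun n s => (w s * (pochhammer a n / INR (fact n)) * (s ^ n * Cpower (1 - z0 * s) (- a - INR n)))%C).
  assert (Hg : forall n s, 0 <= s <= 1 -> rcont (g n) s).
  { intros n s Hs'. unfold g. apply rcont_mult; [apply rcont_mult; [apply Hw, Hs'|apply rcont_const]|].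
    apply rcont_mult; [apply rcont_pow, rcont_RtoC|apply rcont_kernel, Hs0, Hs']. }
  assert (Hgv : forall n s, 0 <= s <= 1 -> (g n s * (z - z0) ^ n)%C =
     (w s * Cpower (1 - z0 * s) (- a) * (pochhammer a n / INR (fact n) * ((z - z0) * s / (1 - z0 * s)) ^ n))%C).
  { intros n s Hs'. unfold g. pose proof (slit_neq_0 _ (Hs0 s Hs')) as Hne.
    replace (- a - INR n)%C with (- a + - INR n)%C by ring.
    rewrite Cpower_plus, (Cpower_opp _ (INR n)), Cpower_nat by exact Hne.
    unfold Cdiv. rewrite !Cpow_mult_l, Cpow_inv by exact Hne. ring. }
  refine (cint_series (fun n s => g n s * (z - z0) ^ n)%C (fun s => w s * Cpower (1 - z * s) (- a))%C _ _
            0 1 (W * B * A) (kappa / rho) _ _ _ _ _ _ _).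
  - lra.
  - unfold rho. split; [apply Rdiv_le_0_compat; lra|]. apply Rlt_div_l; lra.
  - left. repeat apply Rmult_lt_0_compat; assumption.
  - intros n s Hs'. rewrite Hgv by exact Hs'. rewrite !Cmod_mult.
    specialize (HAn n). specialize (HWb s Hs'). specialize (HBb s Hs'). specialize (Hbd s Hs').
    replace (W * B * A * (kappa / rho) ^ n) with (W * B * (A / rho ^ n * kappa ^ n)).
    + rewrite Cmod_pow.
      repeat apply Rmult_le_compat; try apply Cmod_ge_0; try assumption;
        try (apply Rmult_le_pos; try apply Cmod_ge_0; apply pow_le, Cmod_ge_0); try apply pow_le, Cmod_ge_0;
        try (apply Rmult_le_pos; apply Cmod_ge_0).
      apply pow_incr. split; [apply Cmod_ge_0|exact Hbd].
    + unfold Rdiv. rewrite Rpow_mult_distr, pow_inv. ring.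
  - intros s Hs'. specialize (Hbd s Hs'). specialize (Hln s Hs').
    set (u := ((z - z0) * s / (1 - z0 * s))%C) in *.
    pose proof (cser_scal (w s * Cpower (1 - z0 * s) (- a))%C _ _ (binomial_series a u ltac:(lra))) as S.
    cbv beta in S.
    replace (w s * Cpower (1 - z * s) (- a))%C with (w s * Cpower (1 - z0 * s) (- a) * Cpower (1 - u) (- a))%C.
    + eapply cser_ext; [|exact S]. intros n. cbv beta. rewrite Hgv by exact Hs'. reflexivity.
    + unfold Cpower. rewrite Hln, Cmult_plus_distr_l, Cexp_plus. ring.
  - intros n. cbv beta. 
    assert (I : cint (g n) 0 1 (RInt (V := C_R_CompleteNormedModule) (g n) 0 1)).
    { apply (RInt_correct (V := C_R_CompleteNormedModule)). apply cint_ex; [lra|]. intros; now apply Hg. }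
    eapply cint_ext; [lra| |]. 2: { rewrite Cmult_comm. apply cint_scal. exact I. }
    intros s _. cbv beta. ring.
  - apply (RInt_correct (V := C_R_CompleteNormedModule)). apply cint_ex; [lra|].
    intros s Hs'. apply rcont_mult; [now apply Hw|apply rcont_kernel, Hs, Hs'].
Qed.

(** The radius is chosen so that the disc stays in the cut plane and the ratio of the expansion
    is at most 1/2 for every s. *)
Lemma euler_integral_analytic (w : R -> C) (a z0 : C) : (forall s, 0 <= s <= 1 -> rcont w s) ->
  hyp2F1_domain z0 -> analytic_at (euler_integral w a) z0.
Proof.
  intros Hw Hz0. destruct (domain_open z0 Hz0) as (d & Hd & Hop).
  destruct (rcont_bounded (fun s => / (1 - z0 * s))%C 0 1 ltac:(lra)) as (M & HM & HMb).
  { intros s Hs. apply (rcont_comp (fun s => 1 - z0 * s)%C (fun x => / x)%C).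
    - apply (rcont_ext (fun s => 1 + (- z0) * s)%C); [intros; ring|].
      apply rcont_plus; [apply rcont_const|]. apply rcont_mult; [apply rcont_const|apply rcont_RtoC].
    - eapply sdiff_ccont, sdiff_inv, slit_neq_0, domain_slit; assumption. }
  eexists. exists (Rmin d (/ (2 * M))). split; [apply Rmin_glb_lt; [exact Hd|]; apply Rinv_0_lt_compat; lra|].
  intros z Hz. assert (Hz1 := Rlt_le_trans _ _ _ Hz (Rmin_l _ _)). assert (Hz2 := Rlt_le_trans _ _ _ Hz (Rmin_r _ _)).
  apply is_pseries_cser.
  assert (Hbd : forall s, 0 <= s <= 1 -> Cmod ((z - z0) * s / (1 - z0 * s)) <= / 2).
  { intros s Hs. unfold Cdiv. rewrite !Cmod_mult, Cmod_R, Rabs_pos_eq by lra. specialize (HMb s Hs).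
    replace (/ 2) with (/ (2 * M) * 1 * M) by (field; lra).
    pose proof (Cmod_ge_0 (z - z0)). pose proof (Cmod_ge_0 (/ (1 - z0 * s))).
    repeat apply Rmult_le_compat; try lra; nra. }
  apply (euler_expansion w a z0 z (/ 2) Hw); [lra| | |exact Hbd|].
  - intros s Hs. now apply domain_slit.
  - intros s Hs. apply domain_slit; [|exact Hs]. now apply Hop.
  - intros s Hs. pose proof (slit_neq_0 _ (domain_slit z0 s Hz0 Hs)) as Hne.
    replace (1 - z * s)%C with ((1 - z0 * s) * (1 - (z - z0) * s / (1 - z0 * s)))%C by (field; exact Hne).
    apply Cln_mult_segment.
    + apply disc_Re_pos. specialize (Hbd s Hs). lra.
    + intros tau Ht.
      replace ((1 - z0 * s) * (1 + tau * (1 - (z - z0) * s / (1 - z0 * s) - 1)))%C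
        with (1 - (z0 + tau * (z - z0)) * s)%C by (field; exact Hne).
      apply domain_slit; [|exact Hs]. apply Hop.
      replace (z0 + tau * (z - z0) - z0)%C with (tau * (z - z0))%C by ring.
      rewrite Cmod_mult, Cmod_R, Rabs_pos_eq by lra. pose proof (Cmod_ge_0 (z - z0)). nra.
Qed.

Lemma euler_integral_series (w : R -> C) (a : C) (mom : nat -> C) : (forall s, 0 <= s <= 1 -> rcont w s) ->
  (forall n, cint (fun s => w s * s ^ n)%C 0 1 (mom n)) ->
  power_series_on 1 (fun n => pochhammer a n / INR (fact n) * mom n)%C (euler_integral w a).
Proof.
  intros Hw Hm z Hz.
  assert (Hz0 : forall s : R, (1 - 0 * s)%C = RtoC 1) by (intros; ring).
  assert (Hin : forall s, 0 <= s <= 1 -> Cmod (z * s) <= Cmod z).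
  { intros s Hs. rewrite Cmod_mult, Cmod_R, Rabs_pos_eq by lra. pose proof (Cmod_ge_0 z). nra. }
  assert (S := euler_expansion w a 0 z (Cmod z) Hw (conj (Cmod_ge_0 z) Hz)).
  eapply cser_ext; [|apply S].
  - intros n. cbv beta. replace (z - 0)%C with z by ring. f_equal.
    apply (is_RInt_unique (V := C_R_CompleteNormedModule)).
    eapply cint_ext; [lra| |apply (cint_scal (pochhammer a n / INR (fact n)) _ _ _ _ (Hm n))].
    intros s _. cbv beta. rewrite Hz0, Cpower_at_1. ring.
  - intros s Hs. rewrite Hz0. apply slit_Re_pos. simpl. lra.
  - intros s Hs. apply slit_Re_pos, disc_Re_pos. specialize (Hin s Hs). lra.
  - intros s Hs. rewrite Hz0. replace ((z - 0) * s / 1)%C with (z * s)%C by field. now apply Hin.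
  - intros s Hs. rewrite Hz0. replace ((z - 0) * s / 1)%C with (z * s)%C by field.
    rewrite (Cln_RtoC 1), ln_1 by lra. ring.
Qed.

(** * Complex powers on the half-line and their moments *)

(** Extended by 0, so that powers with positive real part are continuous on the whole line. *)
Definition rpow (s : R) (p : C) : C := if Rlt_dec 0 s then Cpower s p else 0.

Lemma rpow_pos (s : R) (p : C) : 0 < s -> rpow s p = Cpower s p.
Proof. intros H. unfold rpow. destruct Rlt_dec; [reflexivity|lra]. Qed.

Lemma rpow_nonpos (s : R) (p : C) : s <= 0 -> rpow s p = 0.
Proof. intros H. unfold rpow. destruct Rlt_dec; [lra|reflexivity]. Qed.

Lemma Cmod_rpow_pos (s : R) (p : C) : 0 < s -> Cmod (rpow s p) = Rpower s (Re p).
Proof.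
  intros H. rewrite rpow_pos by exact H. unfold Cpower. rewrite Cmod_Cexp, Cln_RtoC by exact H.
  unfold Rpower. f_equal. apply re_scal_r.
Qed.

Lemma rpow_mult_pow (s : R) (p : C) (n : nat) : 0 <= s -> (rpow s p * s ^ n)%C = rpow s (p + INR n).
Proof.
  intros H. destruct (Rlt_dec 0 s) as [Hs|Hs].
  - rewrite !rpow_pos, Cpower_plus, Cpower_nat by (assumption || (apply RtoC_neq_0; lra)). reflexivity.
  - rewrite !rpow_nonpos by lra. ring.
Qed.

Lemma Rpower_small (x eps : R) : 0 < x -> 0 < eps -> exists d, 0 < d /\ forall s, 0 < s < d -> Rpower s x < eps.
Proof.
  intros Hx He. exists (Rpower eps (/ x)). split; [apply exp_pos|]. intros s Hs.
  replace eps with (Rpower (Rpower eps (/ x)) x).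
  - apply Rlt_Rpower_l; lra.
  - rewrite Rpower_mult, Rinv_l, Rpower_1; lra.
Qed.

Lemma cderiv_ext_near (f g : R -> C) (t : R) (l : C) (d : R) : 0 < d ->
  (forall s, Rabs (s - t) < d -> f s = g s) -> cderiv f t l -> cderiv g t l.
Proof.
  intros Hd E H eps He. destruct (H eps He) as (d' & Hd' & Hf).
  exists (Rmin d d'). split; [now apply Rmin_glb_lt|]. intros s Hs.
  rewrite <- !E.
  - apply Hf. eapply Rlt_le_trans; [exact Hs|apply Rmin_r].
  - rewrite Rminus_diag, Rabs_R0. exact Hd.
  - eapply Rlt_le_trans; [exact Hs|apply Rmin_l].
Qed.

Lemma cderiv_rpow (p : C) (s : R) : 1 < Re p -> cderiv (fun s => rpow s p) s (p * rpow s (p - 1)).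
Proof.
  intros Hp. destruct (Rtotal_order s 0) as [Hs|[->|Hs]].
  - rewrite rpow_nonpos, Cmult_0_r by lra.
    apply (cderiv_ext_near (fun _ => RtoC 0) _ _ _ (- s)); [lra| |apply cderiv_const].
    intros u Hu. rewrite rpow_nonpos; [reflexivity|]. apply Rabs_def2 in Hu. lra.
  - rewrite (rpow_nonpos 0 (p - 1)), Cmult_0_r by lra. intros eps He.
    destruct (Rpower_small (Re p - 1) eps ltac:(lra) He) as (d & Hd & H).
    exists d. split; [exact Hd|]. intros u Hu. rewrite Rminus_0_r in *.
    rewrite (rpow_nonpos 0) by lra. replace (rpow u p - 0 - u * 0)%C with (rpow u p) by ring.
    destruct (Rlt_dec 0 u) as [Hu0|Hu0].
    + rewrite Cmod_rpow_pos by exact Hu0. rewrite Rabs_pos_eq in * by lra.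
      replace (Re p) with ((Re p - 1) + 1) by ring. rewrite Rpower_plus, Rpower_1 by exact Hu0.
      apply Rmult_le_compat_r; [lra|]. left. apply H. lra.
    + rewrite rpow_nonpos, Cmod_0 by lra. pose proof (Rabs_pos u). nra.
  - rewrite rpow_pos by exact Hs.
    apply (cderiv_ext_near (fun s => Cpower s p) _ _ _ s); [exact Hs| |].
    + intros u Hu. rewrite rpow_pos; [reflexivity|]. apply Rabs_def2 in Hu. lra.
    + replace (p * Cpower s (p - 1))%C with (p * Cpower s (p - 1) * 1)%C by ring.
      apply (cderiv_comp RtoC (fun x => Cpower x p)).
      * apply cderiv_pair; simpl; [apply derivable_pt_lim_id|apply derivable_pt_lim_const].
      * apply sdiff_Cpower, slit_Re_pos. exact Hs.
Qed.

Lemma rcont_rpow (p : C) (s : R) : 0 < Re p -> rcont (fun s => rpow s p) s.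
Proof.
  intros Hp. destruct (Rtotal_order s 0) as [Hs|[->|Hs]].
  - intros eps He. exists (- s). split; [lra|]. intros u Hu. apply Rabs_def2 in Hu.
    rewrite !rpow_nonpos, Cmod_diag by lra. exact He.
  - intros eps He. destruct (Rpower_small (Re p) eps Hp He) as (d & Hd & H).
    exists d. split; [exact Hd|]. intros u Hu. rewrite Rminus_0_r in Hu. apply Rabs_def2 in Hu.
    rewrite (rpow_nonpos 0) by lra. replace (rpow u p - 0)%C with (rpow u p) by ring.
    destruct (Rlt_dec 0 u) as [Hu0|Hu0].
    + rewrite Cmod_rpow_pos by exact Hu0. apply H. lra.
    + rewrite rpow_nonpos, Cmod_0 by lra. exact He.
  - intros eps He.
    assert (Hc : rcont (fun s => Cpower s p) s).
    { apply (rcont_comp RtoC (fun x => Cpower x p)); [apply rcont_RtoC|].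
      eapply sdiff_ccont, sdiff_Cpower, slit_Re_pos. exact Hs. }
    destruct (Hc eps He) as (d & Hd & H). exists (Rmin d s). split; [now apply Rmin_glb_lt|].
    intros u Hu. rewrite !rpow_pos; [apply H| |].
    + eapply Rlt_le_trans; [exact Hu|apply Rmin_l].
    + exact Hs.
    + assert (Hu2 := Rlt_le_trans _ _ _ Hu (Rmin_r _ _)). apply Rabs_def2 in Hu2. lra.
Qed.

Lemma cderiv_reflect (g : R -> C) (s : R) (l : C) : cderiv g (1 - s) l -> cderiv (fun s => g (1 - s)) s (- l).
Proof.
  intros H eps He. destruct (H eps He) as (d & Hd & Hg). exists d. split; [exact Hd|]. intros u Hu.
  specialize (Hg (1 - u)). replace (1 - u - (1 - s)) with (- (u - s)) in Hg by ring.
  rewrite Rabs_Ropp in Hg. specialize (Hg Hu). rewrite RtoC_opp in Hg.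
  replace (RtoC (u - s) * - l)%C with (- RtoC (u - s) * l)%C by ring. exact Hg.
Qed.

Lemma rcont_reflect (g : R -> C) (s : R) : rcont g (1 - s) -> rcont (fun s => g (1 - s)) s.
Proof.
  intros H eps He. destruct (H eps He) as (d & Hd & Hg). exists d. split; [exact Hd|]. intros u Hu.
  apply Hg. replace (1 - u - (1 - s)) with (- (u - s)) by ring. now rewrite Rabs_Ropp.
Qed.

Definition beta_weight (b c : C) (s : R) : C := (rpow s (b - 1) * rpow (1 - s) (c - b - 1))%C.

Lemma rcont_beta_weight (b c : C) (s : R) : 1 < Re b -> 1 < Re (c - b) -> rcont (beta_weight b c) s.
Proof.
  intros Hb Hc. apply rcont_mult.
  - apply rcont_rpow. unfold Cminus. rewrite re_plus, re_opp. simpl. lra.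
  - apply (rcont_reflect (fun s => rpow s (c - b - 1))), rcont_rpow.
    unfold Cminus in *. rewrite !re_plus, !re_opp in *. simpl. lra.
Qed.

(** The integral of the derivative of s^(b+n) (1-s)^(c-b) is 0. *)
Lemma beta_weight_moment_step (b c m m' : C) (n : nat) : 1 < Re b -> 1 < Re (c - b) ->
  cint (fun s => beta_weight b c s * s ^ n)%C 0 1 m ->
  cint (fun s => beta_weight b c s * s ^ S n)%C 0 1 m' ->
  ((c + INR n) * m' = (b + INR n) * m)%C.
Proof.
  intros Hb Hc Hm Hm'.
  assert (Hbn : 1 < Re (b + INR n)).
  { rewrite re_plus, re_RtoC. pose proof (pos_INR n). lra. }
  pose proof (cint_minus _ _ _ _ _ _ (cint_scal (b + INR n) _ _ _ _ Hm) (cint_scal (c + INR n) _ _ _ _ Hm')) as I1.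
  set (G := fun s => (rpow s (b + INR n) * rpow (1 - s) (c - b))%C).
  set (dG := fun s => ((b + INR n) * rpow s (b + INR n - 1) * rpow (1 - s) (c - b)
                       + rpow s (b + INR n) * - ((c - b) * rpow (1 - s) (c - b - 1)))%C).
  assert (I2 : cint dG 0 1 (G 1 - G 0)).
  { apply cint_FTC; [lra| |]; intros s _.
    - apply (cderiv_mult (fun s => rpow s (b + INR n)) (fun s => rpow (1 - s) (c - b))); [now apply cderiv_rpow|].
      apply (cderiv_reflect (fun s => rpow s (c - b))). now apply cderiv_rpow.
    - assert (R1 : forall p, 0 < Re p -> rcont (fun s => rpow (1 - s) p) s).
      { intros p Hp. apply (rcont_reflect (fun s => rpow s p)). now apply rcont_rpow. }
      unfold dG. apply rcont_plus.
      + apply rcont_mult; [apply rcont_mult; [apply rcont_const|apply rcont_rpow]|apply R1; lra].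
        unfold Cminus. rewrite re_plus, re_opp. simpl in *. lra.
      + apply rcont_mult; [apply rcont_rpow; lra|].
        apply (rcont_ext (fun s => - (c - b) * rpow (1 - s) (c - b - 1))%C); [intros; ring|].
        apply rcont_mult; [apply rcont_const|apply R1].
        unfold Cminus in *. rewrite !re_plus, !re_opp in *. simpl. lra. }
  assert (E0 : (G 1 - G 0)%C = 0).
  { unfold G. rewrite (rpow_nonpos 0), (rpow_nonpos (1 - 1)) by lra. ring. }
  rewrite E0 in I2. apply Ceq_minus.
  replace ((c + INR n) * m' - (b + INR n) * m)%C with (- ((b + INR n) * m - (c + INR n) * m'))%C by ring.
  replace ((b + INR n) * m - (c + INR n) * m')%C with (RtoC 0); [ring|].
  eapply cint_unique; [exact I2|]. eapply cint_ext; [lra| |exact I1].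
  intros s Hs. cbv beta. unfold beta_weight, dG.
  assert (E1 : rpow s (b + INR n - 1) = (rpow s (b - 1) * s ^ n)%C).
  { rewrite rpow_mult_pow by lra. f_equal. ring. }
  assert (E2 : rpow s (b + INR n) = (rpow s (b - 1) * s ^ S n)%C).
  { rewrite rpow_mult_pow by lra. f_equal. rewrite INR_S_C. ring. }
  assert (E3 : rpow (1 - s) (c - b) = (rpow (1 - s) (c - b - 1) * (1 - s))%C).
  { rewrite <- (Cpow_1_r (1 - s)%C), <- RtoC_minus, rpow_mult_pow by lra. f_equal. simpl. ring. }
  rewrite E1, E2, E3, Cpow_S. ring.
Qed.

Lemma is_RInt_const_real (v a b : R) : is_RInt (fun _ => v) a b ((b - a) * v).
Proof. exact (is_RInt_const (V := R_NormedModule) a b v). Qed.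

(** Integrating the derivative of (s - 1/2) (4s(1-s))^(n+1) gives the ratio (2n+2)/(2n+3) of
    consecutive means. *)
Lemma landau_kernel_mean (n : nat) :
  exists A : R, is_RInt (fun s => (4 * s * (1 - s)) ^ n) 0 1 A /\ / (2 * INR n + 1) <= A.
Proof.
  induction n as [|n (A & IA & HA)].
  - exists 1. split; [|simpl; lra].
    pose proof (is_RInt_const_real 1 0 1) as Z. rewrite Rmult_1_r, Rminus_0_r in Z. exact Z.
  - exists ((2 * INR n + 2) / (2 * INR n + 3) * A). pose proof (pos_INR n) as Nn. split.
    + assert (IB : is_RInt (fun s => (2 * INR n + 3) * (4 * s * (1 - s)) ^ S n
                                     - (2 * INR n + 2) * (4 * s * (1 - s)) ^ n) 0 1 0).
      { replace 0 with (minus ((1 - 1 / 2) * (4 * 1 * (1 - 1)) ^ S n) ((0 - 1 / 2) * (4 * 0 * (1 - 0)) ^ S n)) at 2.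
        - apply (is_RInt_derive (fun s => (s - 1 / 2) * (4 * s * (1 - s)) ^ S n)).
          + intros s _. auto_derive; [auto|].
            replace (match n with O => 1 | S _ => INR n + 1 end) with (INR n + 1)
              by (destruct n; simpl; ring). unfold Rminus. simpl pow.
            generalize ((4 * s * (1 + - s)) ^ n); intros P. field.
          + intros s _. apply (ex_derive_continuous (V := R_NormedModule)). auto_derive. auto.
        - unfold minus, plus, opp; simpl. ring. }
      pose proof (is_RInt_scal _ _ _ (/ (2 * INR n + 3)) _
        (is_RInt_plus _ _ _ _ _ _ IB (is_RInt_scal _ _ _ (2 * INR n + 2) _ IA))) as IC.
      replace ((2 * INR n + 2) / (2 * INR n + 3) * A)
        with (scal (/ (2 * INR n + 3)) (plus 0 (scal (2 * INR n + 2) A)))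
        by (unfold scal, plus; simpl; unfold mult; simpl; field; lra).
      eapply is_RInt_ext; [|exact IC]. intros s _. unfold scal, plus; simpl; unfold mult; simpl. field. lra.
    + rewrite S_INR. apply Rle_trans with ((2 * INR n + 2) / (2 * INR n + 3) * / (2 * INR n + 1)).
      * apply Rminus_le.
        replace (/ (2 * (INR n + 1) + 1) - (2 * INR n + 2) / (2 * INR n + 3) * / (2 * INR n + 1))
          with (- / ((2 * INR n + 3) * (2 * INR n + 1))) by (field; lra).
        assert (0 < / ((2 * INR n + 3) * (2 * INR n + 1))) by (apply Rinv_0_lt_compat; nra). lra.
      * apply Rmult_le_compat_l; [apply Rdiv_le_0_compat; lra|exact HA].
Qed.

Lemma geometric_beats_linear (r K e : R) : 0 < r < 1 -> 0 < K -> 0 < e ->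
  exists n, K * r ^ n * (2 * INR n + 1) < e.
Proof.
  intros Hr HK He.
  (* Bernoulli's inequality for the base 1/r, squared *)
  set (x := / r - 1). assert (Hx : 0 < x).
  { unfold x. assert (1 < / r) by (rewrite <- Rinv_1; apply Rinv_lt_contravar; lra). lra. }
  destruct (INR_unbounded (1 + 5 * K / (e * (x * x)))) as [n Hn]. exists (2 * n)%nat.
  rewrite mult_INR. simpl (INR 2). set (N := INR n) in *.
  assert (Hexx : 0 < e * (x * x)) by (repeat apply Rmult_lt_0_compat; lra).
  assert (0 < 5 * K / (e * (x * x))) by (apply Rdiv_lt_0_compat; lra).
  pose proof (poly n x Hx) as Hp. fold N in Hp. replace (1 + x) with (/ r) in Hp by (unfold x; ring).
  rewrite pow_inv in Hp. pose proof (pow_lt r n (proj1 Hr)) as Prn.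
  assert (HNx : 0 < N * x) by (apply Rmult_lt_0_compat; lra).
  assert (Q : N * x * r ^ n <= 1).
  { apply (Rmult_le_compat_r (r ^ n)) in Hp; [|lra]. rewrite Rinv_l in Hp; lra. }
  assert (HN : 5 * K < N * (e * (x * x))) by (apply Rlt_div_l; lra).
  replace (2 * n)%nat with (n + n)%nat by lia. rewrite pow_add.
  apply (Rmult_lt_reg_r (N * x * (N * x))); [apply Rmult_lt_0_compat; lra|].
  assert (QQ : (N * x * r ^ n) * (N * x * r ^ n) <= 1).
  { assert (0 <= N * x * r ^ n) by (left; apply Rmult_lt_0_compat; lra). nra. }
  apply Rle_lt_trans with (K * (4 * N + 1) * 1).
  - replace (K * (r ^ n * r ^ n) * (2 * ((1 + 1) * N) + 1) * (N * x * (N * x)))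
      with (K * (4 * N + 1) * ((N * x * r ^ n) * (N * x * r ^ n))) by ring.
    apply Rmult_le_compat_l; [|exact QQ]. apply Rmult_le_pos; lra.
  - apply Rle_lt_trans with (N * (5 * K)); [nra|].
    replace (e * (N * x * (N * x))) with (N * (N * (e * (x * x)))) by ring.
    apply Rmult_lt_compat_l; lra.
Qed.

(** The powers of 4s(1-s) concentrate at 1/2 and are only polynomially small in mean, so a weight
    with vanishing moments cannot be nonzero there. *)
Lemma landau_nonvanishing (w : R -> C) : (forall s, 0 <= s <= 1 -> rcont w s) ->
  (forall n, cint (fun s => w s * s ^ n)%C 0 1 0) -> w (1 / 2) = 0.
Proof.
  intros Hw Hm. destruct (Ceq_dec (w (1 / 2)) 0) as [|Hne]; [assumption|exfalso].
  set (w0 := w (1 / 2)) in *. pose proof (proj1 (Cmod_gt_0 w0) Hne) as Hw0.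
  set (phi := fun s : R => 4 * s * (1 - s)).
  assert (HP : forall n m, cint (fun s => w s * (s ^ m * RtoC (phi s) ^ n))%C 0 1 0).
  { induction n as [|n IH]; intros m.
    - eapply cint_ext; [lra| |apply (Hm m)]. intros s _. simpl. ring.
    - pose proof (cint_plus _ _ _ _ _ _ (cint_scal 4 _ _ _ _ (IH (S m))) (cint_scal (-4) _ _ _ _ (IH (S (S m))))) as I.
      replace (4 * 0 + -4 * 0)%C with (RtoC 0) in I by ring.
      eapply cint_ext; [lra| |exact I]. intros s _. cbv beta. rewrite !Cpow_S. unfold phi at 3.
      rewrite !RtoC_mult, RtoC_minus. ring. }
  destruct (Hw (1 / 2) ltac:(lra) (Cmod w0 / 2) ltac:(lra)) as (d & Hd & Hnear).
  destruct (rcont_bounded w 0 1 ltac:(lra) Hw) as (M & HM & HMb).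
  set (dd := Rmin d (1 / 4)). assert (Hdd : 0 < dd) by (apply Rmin_glb_lt; lra).
  assert (Hdd1 : dd <= d) by apply Rmin_l. assert (Hdd2 : dd <= 1 / 4) by apply Rmin_r.
  set (r := 1 - 4 * (dd * dd)). assert (Hr : 0 < r < 1) by (unfold r; nra).
  set (K := M + Cmod w0).
  assert (Hkey : forall n, Cmod w0 / 2 * / (2 * INR n + 1) <= K * r ^ n).
  { intros n. destruct (landau_kernel_mean n) as (A & IA & HAn). change (is_RInt (fun s => phi s ^ n) 0 1 A) in IA.
    assert (IAc : cint (fun s => RtoC (phi s ^ n)) 0 1 (RtoC A)).
    { apply (is_RInt_fct_extend_pair (U := R_NormedModule) (V := R_NormedModule)); simpl; [exact IA|].
      pose proof (is_RInt_const_real 0 0 1) as Z. rewrite Rmult_0_r in Z. exact Z. }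
    pose proof (cint_minus _ _ _ _ _ _ (cint_scal w0 _ _ _ _ IAc) (HP n O)) as I.
    assert (HApos : 0 <= A).
    { pose proof (pos_INR n). assert (0 < / (2 * INR n + 1)) by (apply Rinv_0_lt_compat; lra). lra. }
    assert (Hle : Cmod (w0 * A - 0) <= Cmod w0 / 2 * A + K * r ^ n).
    { rewrite <- norm_CR.
      apply (norm_RInt_le (V := C_R_NormedModule) _ (fun s => Cmod w0 / 2 * phi s ^ n + K * r ^ n) 0 1 _ _ ltac:(lra)) with (2 := I).
      - intros s Hs. rewrite norm_CR.
        replace (w0 * RtoC (phi s ^ n) - w s * (s ^ 0 * RtoC (phi s) ^ n))%C with ((w0 - w s) * RtoC (phi s ^ n))%C
          by (rewrite RtoC_pow; simpl; ring).
        assert (Hphi : 0 <= phi s <= 1).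
        { unfold phi. pose proof (Rle_0_sqr (2 * s - 1)) as Sq. unfold Rsqr in Sq. split; [|lra].
          apply Rmult_le_pos; lra. }
        assert (Hpn : 0 <= phi s ^ n) by (apply pow_le; lra).
        assert (Hrn : 0 <= r ^ n) by (apply pow_le; lra).
        rewrite Cmod_mult, Cmod_R, (Rabs_pos_eq _ Hpn).
        destruct (Rlt_dec (Rabs (s - 1 / 2)) dd) as [Hs1|Hs1].
        + specialize (Hnear s ltac:(lra)). fold w0 in Hnear. rewrite Cmod_sub_comm in Hnear.
          assert (0 <= K * r ^ n) by (unfold K; apply Rmult_le_pos; lra). nra.
        + assert (phi s <= r).
          { unfold phi, r. assert (dd * dd <= (s - 1 / 2) * (s - 1 / 2)); [|lra].
            rewrite <- (Rabs_pos_eq ((s - 1 / 2) * (s - 1 / 2))) by apply Rle_0_sqr. rewrite Rabs_mult.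
            apply Rmult_le_compat; lra. }
          assert (phi s ^ n <= r ^ n) by (apply pow_incr; lra).
          assert (Cmod (w0 - w s) <= K).
          { unfold K. eapply Rle_trans; [apply Cmod_triangle_sub|]. specialize (HMb s Hs). lra. }
          assert (0 <= Cmod w0 / 2 * phi s ^ n) by (apply Rmult_le_pos; lra).
          pose proof (Cmod_ge_0 (w0 - w s)).
          assert (Cmod (w0 - w s) * phi s ^ n <= K * r ^ n) by (apply Rmult_le_compat; lra). lra.
      - replace (Cmod w0 / 2 * A + K * r ^ n) with (plus (scal (Cmod w0 / 2) A) (scal (1 - 0) (K * r ^ n)))
          by (unfold scal, plus; simpl; unfold mult; simpl; ring).
        apply (is_RInt_plus (V := R_NormedModule)).
        + apply (is_RInt_scal (V := R_NormedModule)). exact IA.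
        + apply (is_RInt_const (V := R_NormedModule)). }
    replace (w0 * A - 0)%C with (w0 * A)%C in Hle by ring.
    rewrite Cmod_mult, Cmod_R, (Rabs_pos_eq A HApos) in Hle.
    assert (Cmod w0 / 2 * / (2 * INR n + 1) <= Cmod w0 / 2 * A) by (apply Rmult_le_compat_l; lra). lra. }
  destruct (geometric_beats_linear r K (Cmod w0 / 2) Hr ltac:(unfold K; lra) ltac:(lra)) as [n Hn].
  specialize (Hkey n). pose proof (pos_INR n).
  apply (Rmult_le_compat_r (2 * INR n + 1)) in Hkey; [|lra].
  rewrite Rmult_assoc, Rinv_l in Hkey by lra. lra.
Qed.

(** The moments of the weight are proportional to (b)_n / (c)_n; the factor is nonzero, since
    otherwise all moments of a nonvanishing weight would be 0. *)
Lemma euler_hypergeometric (a b c : C) : no_pole c -> 1 < Re b -> 1 < Re (c - b) ->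
  exists F, is_hyp2F1 a b c F.
Proof.
  intros Hc Hb Hcb.
  assert (Hw : forall s, 0 <= s <= 1 -> rcont (beta_weight b c) s) by (intros; now apply rcont_beta_weight).
  assert (Hex : exists mom : nat -> C, forall n, cint (fun s => beta_weight b c s * s ^ n)%C 0 1 (mom n)).
  { exists (fun n => RInt (V := C_R_CompleteNormedModule) (fun s => beta_weight b c s * s ^ n)%C 0 1).
    intros n. apply (RInt_correct (V := C_R_CompleteNormedModule)). apply cint_ex; [lra|].
    intros s Hs. apply rcont_mult; [now apply Hw|apply rcont_pow, rcont_RtoC]. }
  destruct Hex as [mom Hm].
  assert (Hp : forall n, pochhammer c n <> 0) by (intros; now apply pochhammer_neq_0).
  assert (Hrec : forall n, mom n = (mom O * (pochhammer b n / pochhammer c n))%C).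
  { induction n as [|n IH].
    - change (mom O = (mom O * (1 / 1))%C). field.
    - pose proof (beta_weight_moment_step b c _ _ n Hb Hcb (Hm n) (Hm (S n))) as E.
      rewrite IH in E. rewrite !pochhammer_S.
      pose proof (Hc n) as Hcn. specialize (Hp n).
      transitivity ((c + INR n) * mom (S n) / (c + INR n))%C; [field; exact Hcn|]. rewrite E. field. auto. }
  assert (H0 : mom O <> 0).
  { intros E0.
    assert (E : beta_weight b c (1 / 2) = 0).
    { apply landau_nonvanishing; [exact Hw|]. intros n. replace (RtoC 0) with (mom n); [apply Hm|].
      rewrite Hrec, E0. ring. }
    revert E. unfold beta_weight. rewrite !rpow_pos by lra. apply Cmult_neq_0; apply Cpower_neq_0. }
  exists (fun z => / mom O * euler_integral (beta_weight b c) a z)%C. split.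
  - intros z Hz. destruct (euler_integral_analytic _ a z Hw Hz) as (al & r & Hr & H).
    exists (fun n => / mom O * al n)%C, r. split; [exact Hr|]. intros x Hx. specialize (H x Hx).
    apply is_pseries_cser. apply is_pseries_cser in H.
    eapply cser_ext; [|apply (cser_scal (/ mom O) _ _ H)]. intros n. cbv beta. ring.
  - intros z Hz. apply is_pseries_cser.
    eapply cser_ext; [|apply (cser_scal (/ mom O) _ _ (euler_integral_series _ a mom Hw Hm z Hz))].
    intros n. cbv beta. rewrite (Hrec n). unfold hyp2F1_coef.
    pose proof (fact_C_neq_0 n). specialize (Hp n). field. auto.
Qed.

Lemma analytic_at_plus_id_mult (f g : C -> C) (k z0 : C) : analytic_at f z0 -> analytic_at g z0 ->
  analytic_at (fun z => f z + k * (z * g z))%C z0.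
Proof.
  intros (a & r & Hr & Ha) (b & r' & Hr' & Hb).
  exists (fun n => a n + k * (z0 * b n + match n with O => 0 | S m => b m end))%C, (Rmin r r').
  split; [now apply Rmin_glb_lt|]. intros z Hz.
  specialize (Ha z (Rlt_le_trans _ _ _ Hz (Rmin_l _ _))). specialize (Hb z (Rlt_le_trans _ _ _ Hz (Rmin_r _ _))).
  apply is_pseries_cser. apply is_pseries_cser in Ha, Hb.
  set (u := (z - z0)%C) in *.
  assert (Hs : cser (fun n => match n with O => 0 | S m => b m end * u ^ n)%C (u * g z)).
  { apply cser_decr_1. replace (u * g z - 0 * u ^ 0)%C with (u * g z)%C by ring.
    eapply cser_ext; [|apply (cser_scal u _ _ Hb)]. intros n. rewrite Cpow_S. ring. }
  replace (f z + k * (z * g z))%C with (f z + k * (z0 * g z + u * g z))%C by (unfold u; ring).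
  eapply cser_ext; [|apply (cser_plus _ _ _ _ Ha (cser_scal k _ _ (cser_plus _ _ _ _ (cser_scal z0 _ _ Hb) Hs)))].
  intros n. cbv beta. ring.
Qed.

Lemma contiguous_continuation (a b c a1 b1 c1 a2 b2 c2 k : C) :
  (forall n, hyp2F1_coef a b c (S n) = hyp2F1_coef a1 b1 c1 (S n) + k * hyp2F1_coef a2 b2 c2 n)%C ->
  (exists F, is_hyp2F1 a1 b1 c1 F) -> (exists F, is_hyp2F1 a2 b2 c2 F) -> exists F, is_hyp2F1 a b c F.
Proof.
  intros E (F1 & A1 & S1) (F2 & A2 & S2).
  exists (fun z => F1 z + k * (z * F2 z))%C. split.
  - intros z Hz. apply analytic_at_plus_id_mult; auto.
  - intros z Hz. specialize (S1 z Hz). specialize (S2 z Hz).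
    apply is_pseries_cser. apply is_pseries_cser in S1, S2.
    assert (E0 : forall x y w, hyp2F1_coef x y w 0 = RtoC 1) by (intros; unfold hyp2F1_coef; simpl; field).
    apply cser_decr_1.
    replace (F1 z + k * (z * F2 z) - hyp2F1_coef a b c 0 * z ^ 0)%C
      with ((F1 z - hyp2F1_coef a1 b1 c1 0 * z ^ 0) + k * z * F2 z)%C by (rewrite !E0; ring).
    eapply cser_ext; [|apply (cser_plus _ _ _ _ (cser_incr_1 _ _ S1) (cser_scal (k * z) _ _ S2))].
    intros n. cbv beta. rewrite E, Cpow_S. ring.
Qed.

Lemma continuation_from_b_plus_1 (a b c : C) : no_pole c ->
  (exists F, is_hyp2F1 a (b + 1) c F) -> (exists F, is_hyp2F1 (a + 1) (b + 1) (c + 1) F) ->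
  exists F, is_hyp2F1 a b c F.
Proof.
  intros Hc. apply (contiguous_continuation _ _ _ _ _ _ _ _ _ (- (a / c))). intros n.
  unfold hyp2F1_coef.
  rewrite (pochhammer_S_l a), (pochhammer_S_l b), (pochhammer_S_l c), fact_S_C, (pochhammer_S (b + 1)), INR_S_C.
  pose proof (no_pole_0 c Hc). pose proof (fact_C_neq_0 n).
  pose proof (pochhammer_neq_0 _ n (no_pole_S c Hc)).
  pose proof (INR_S_C_neq_0 n) as Hn. rewrite INR_S_C in Hn. field. auto.
Qed.

Lemma continuation_from_c_plus_1 (a b c : C) : no_pole c ->
  (exists F, is_hyp2F1 a b (c + 1) F) -> (exists F, is_hyp2F1 (a + 1) (b + 1) (c + 1 + 1) F) ->
  exists F, is_hyp2F1 a b c F.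
Proof.
  intros Hc. apply (contiguous_continuation _ _ _ _ _ _ _ _ _ (a * b / (c * (c + 1)))). intros n.
  unfold hyp2F1_coef. pose proof (no_pole_S c Hc) as Hc1. pose proof (no_pole_S _ Hc1) as Hc2.
  assert (E : (pochhammer (c + 1) n * (c + 1 + INR n))%C = ((c + 1) * pochhammer (c + 1 + 1) n)%C)
    by (rewrite <- pochhammer_S_l; reflexivity).
  assert (E' : pochhammer (c + 1) n = ((c + 1) * pochhammer (c + 1 + 1) n / (c + 1 + INR n))%C).
  { rewrite <- E. field. apply Hc1. }
  rewrite (pochhammer_S_l a), (pochhammer_S_l b), (pochhammer_S_l c), (pochhammer_S_l (c + 1)), fact_S_C, INR_S_C, E'.
  pose proof (no_pole_0 c Hc). pose proof (no_pole_0 _ Hc1). pose proof (fact_C_neq_0 n).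
  pose proof (pochhammer_neq_0 _ n Hc2). pose proof (Hc1 n).
  pose proof (INR_S_C_neq_0 n) as Hn. rewrite INR_S_C in Hn. field. repeat split; auto.
Qed.

(** Euler's integral needs the real parts of b and c - b to be large; contiguous relations descend
    from there to arbitrary parameters. *)
Lemma hyp2F1_continuation_exists (a b c : C) : no_pole c -> exists F, is_hyp2F1 a b c F.
Proof.
  assert (H1 : forall N a b c, no_pole c -> 1 < Re b -> 1 < Re c - Re b + INR N -> exists F, is_hyp2F1 a b c F).
  { induction N as [|N IH]; intros a0 b0 c0 Hc Hb HN.
    - apply euler_hypergeometric; [exact Hc|exact Hb|]. unfold Cminus. rewrite re_plus, re_opp. simpl in HN. lra.
    - rewrite S_INR in HN. apply continuation_from_c_plus_1; [exact Hc| |].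
      + apply IH; [now apply no_pole_S|exact Hb|]. rewrite re_plus. simpl (Re 1). lra.
      + apply IH; [now apply no_pole_S, no_pole_S| |]; rewrite !re_plus; simpl (Re 1); lra. }
  assert (H2 : forall N a b c, no_pole c -> 1 < Re b + INR N -> exists F, is_hyp2F1 a b c F).
  { induction N as [|N IH]; intros a0 b0 c0 Hc HN.
    - simpl in HN. destruct (INR_unbounded (1 - Re c0 + Re b0)) as [M HM].
      apply (H1 M); [exact Hc|lra|lra].
    - rewrite S_INR in HN. apply continuation_from_b_plus_1; [exact Hc| |].
      + apply IH; [exact Hc|]. rewrite re_plus. simpl (Re 1). lra.
      + apply IH; [now apply no_pole_S|]. rewrite re_plus. simpl (Re 1). lra. }
  intros Hc. destruct (INR_unbounded (1 - Re b)) as [N HN]. apply (H2 N); [exact Hc|lra].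
Qed.

Lemma hyp2F1_spec (a b c : C) : no_pole c -> is_hyp2F1 a b c (hyp2F1 a b c).
Proof. intros Hc. unfold hyp2F1. apply epsilon_spec. now apply hyp2F1_continuation_exists. Qed.

(** * Improper integrals over (-1,1) *)

(** Convergence of the integral over (u,v) as u and v tend to the end points, in epsilon-delta
    form and together with integrability. *)
Definition impint (f : R -> C) (l : C) : Prop :=
  forall eps, 0 < eps -> exists d, 0 < d <= 1 /\ forall u v, -1 < u < -1 + d -> 1 - d < v < 1 ->
    exists y, cint f u v y /\ Cmod (y - l) < eps.

Lemma impint_is_RInt_gen (f : R -> C) (l : C) : impint f l ->
  is_RInt_gen (V := C_R_NormedModule) f (at_right (-1)) (at_left 1) l.
Proof.
  intros H P [eps HP]. destruct (H eps (cond_pos eps)) as (d & Hd & Hf).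
  apply (Filter_prod _ _ _ (fun u => -1 < u < -1 + d) (fun v => 1 - d < v < 1)).
  - exists (mkposreal d (proj1 Hd)). intros u Hu Hu1. apply Rabs_def2 in Hu. simpl in Hu.
    unfold minus, plus, opp in Hu; simpl in Hu. lra.
  - exists (mkposreal d (proj1 Hd)). intros v Hv Hv1. apply Rabs_def2 in Hv. simpl in Hv.
    unfold minus, plus, opp in Hv; simpl in Hv. lra.
  - intros u v Hu Hv. destruct (Hf u v Hu Hv) as (y & Hy & Hyl). exists y. split; [exact Hy|].
    apply HP. apply C_NormedModule_mixin_compat1. exact Hyl.
Qed.

Lemma impint_ext (f g : R -> C) (l : C) : (forall x, -1 < x < 1 -> f x = g x) -> impint f l -> impint g l.
Proof.
  intros E H eps He. destruct (H eps He) as (d & Hd & Hf). exists d. split; [exact Hd|].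
  intros u v Hu Hv. destruct (Hf u v Hu Hv) as (y & Hy & Hyl). exists y. split; [|exact Hyl].
  eapply cint_ext; [lra| |exact Hy]. intros t Ht. apply E. lra.
Qed.

Lemma impint_plus (f g : R -> C) (l m : C) : impint f l -> impint g m -> impint (fun x => f x + g x)%C (l + m).
Proof.
  intros Hf Hg eps He. destruct (Hf (eps / 2) ltac:(lra)) as (d1 & Hd1 & H1).
  destruct (Hg (eps / 2) ltac:(lra)) as (d2 & Hd2 & H2).
  exists (Rmin d1 d2). pose proof (Rmin_l d1 d2) as M1. pose proof (Rmin_r d1 d2) as M2.
  split; [split; [apply Rmin_glb_lt|]; lra|]. intros u v Hu Hv.
  destruct (H1 u v ltac:(lra) ltac:(lra)) as (y1 & Y1 & E1). destruct (H2 u v ltac:(lra) ltac:(lra)) as (y2 & Y2 & E2).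
  exists (y1 + y2)%C. split; [now apply cint_plus|].
  replace (y1 + y2 - (l + m))%C with ((y1 - l) + (y2 - m))%C by ring.
  eapply Rle_lt_trans; [apply Cmod_triangle|]. lra.
Qed.

Lemma impint_scal (c : C) (f : R -> C) (l : C) : impint f l -> impint (fun x => c * f x)%C (c * l).
Proof.
  intros Hf eps He. pose proof (Cmod_ge_0 c).
  destruct (Hf (eps / (Cmod c + 1)) ltac:(apply Rdiv_lt_0_compat; lra)) as (d & Hd & H1).
  exists d. split; [exact Hd|]. intros u v Hu Hv. destruct (H1 u v Hu Hv) as (y & Y & E).
  exists (c * y)%C. split; [now apply cint_scal|].
  replace (c * y - c * l)%C with (c * (y - l))%C by ring. rewrite Cmod_mult.
  apply Rlt_div_r in E; [|lra]. pose proof (Cmod_ge_0 (y - l)). nra.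
Qed.

Lemma impint_unique (f : R -> C) (l m : C) : impint f l -> impint f m -> l = m.
Proof.
  intros H1 H2. apply Ceq_minus. destruct (Ceq_dec (l - m) 0) as [|Hne]; [assumption|exfalso].
  apply Cmod_gt_0 in Hne. set (e := Cmod (l - m)) in *.
  destruct (H1 (e / 2) ltac:(lra)) as (d1 & Hd1 & E1). destruct (H2 (e / 2) ltac:(lra)) as (d2 & Hd2 & E2).
  pose proof (Rmin_l d1 d2) as M1. pose proof (Rmin_r d1 d2) as M2.
  assert (M0 : 0 < Rmin d1 d2) by (apply Rmin_glb_lt; lra).
  destruct (E1 (-1 + Rmin d1 d2 / 2) (1 - Rmin d1 d2 / 2) ltac:(lra) ltac:(lra)) as (y1 & Y1 & D1).
  destruct (E2 (-1 + Rmin d1 d2 / 2) (1 - Rmin d1 d2 / 2) ltac:(lra) ltac:(lra)) as (y2 & Y2 & D2).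
  rewrite (cint_unique _ _ _ _ _ Y2 Y1) in D2.
  assert (e < e); [|lra]. unfold e at 1. replace (l - m)%C with ((y1 - m) - (y1 - l))%C by ring.
  eapply Rle_lt_trans; [apply Cmod_triangle_sub|]. lra.
Qed.

Lemma impint_csum (f : nat -> R -> C) (l : nat -> C) (n : nat) : (forall k, impint (f k) (l k)) ->
  impint (fun x => csum (fun k => f k x) n) (csum l n).
Proof.
  intros H. induction n as [|n IH].
  - rewrite csum_0. eapply impint_ext; [|apply (H O)]. intros x _. now rewrite csum_0.
  - rewrite csum_S. eapply impint_ext; [|apply (impint_plus _ _ _ _ IH (H (S n)))].
    intros x _. cbv beta. now rewrite csum_S.
Qed.

Lemma cint_Chasles (f : R -> C) (a b c : R) (l m : C) : cint f a b l -> cint f b c m -> cint f a c (l + m).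
Proof. apply (is_RInt_Chasles (V := C_R_NormedModule)). Qed.

Lemma impint_continuous (f : R -> C) : (forall x, -1 <= x <= 1 -> rcont f x) -> exists l, impint f l.
Proof.
  intros H. destruct (cint_ex f (-1) 1 ltac:(lra) H) as [l Hl]. exists l.
  destruct (rcont_bounded f (-1) 1 ltac:(lra) H) as (M & HM & HMb).
  intros eps He. set (d := Rmin 1 (eps / (3 * M))).
  assert (Hd0 : 0 < d) by (apply Rmin_glb_lt; [lra|]; apply Rdiv_lt_0_compat; lra).
  assert (Hd1 : d <= 1) by apply Rmin_l. assert (Hd2 : d <= eps / (3 * M)) by apply Rmin_r.
  exists d. split; [lra|]. intros u v Hu Hv.
  destruct (cint_ex f (-1) u) as [y1 Y1]; [lra|intros; apply H; lra|].
  destruct (cint_ex f u v) as [y Y]; [lra|intros; apply H; lra|].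
  destruct (cint_ex f v 1) as [y2 Y2]; [lra|intros; apply H; lra|].
  exists y. split; [exact Y|].
  rewrite (cint_unique _ _ _ _ _ Hl (cint_Chasles _ _ _ _ _ _ (cint_Chasles _ _ _ _ _ _ Y1 Y) Y2)).
  assert (B1 := cint_norm f (-1) u M y1 ltac:(lra) (fun t Ht => HMb t ltac:(lra)) Y1).
  assert (B2 := cint_norm f v 1 M y2 ltac:(lra) (fun t Ht => HMb t ltac:(lra)) Y2).
  replace (y - (y1 + y + y2))%C with (- (y1 + y2))%C by ring. rewrite Cmod_opp.
  eapply Rle_lt_trans; [apply Cmod_triangle|].
  apply Rle_div_r in Hd2; [|lra]. nra.
Qed.

Lemma impint_derivative (G g : R -> C) : (forall x, -1 < x < 1 -> cderiv G x (g x)) ->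
  (forall x, -1 < x < 1 -> rcont g x) -> rcont G (-1) -> rcont G 1 -> impint g (G 1 - G (-1)).
Proof.
  intros H1 H2 Ha Hb eps He.
  destruct (Ha (eps / 2) ltac:(lra)) as (d1 & Hd1 & E1). destruct (Hb (eps / 2) ltac:(lra)) as (d2 & Hd2 & E2).
  set (d := Rmin 1 (Rmin d1 d2)).
  assert (Hdd : 0 < d /\ d <= 1 /\ d <= d1 /\ d <= d2).
  { unfold d. repeat split; unfold Rmin; repeat destruct Rle_dec; lra. }
  exists d. split; [lra|]. intros u v Hu Hv. exists (G v - G u)%C. split.
  - apply cint_FTC; [lra| |]; intros t Ht; [apply H1|apply H2]; lra.
  - specialize (E1 u ltac:(apply Rabs_def1; lra)). specialize (E2 v ltac:(apply Rabs_def1; lra)).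
    replace (G v - G u - (G 1 - G (-1)))%C with ((G v - G 1) - (G u - G (-1)))%C by ring.
    eapply Rle_lt_trans; [apply Cmod_triangle_sub|]. lra.
Qed.

(** * The Jacobi weight *)

Definition rrpow (s p : R) : R := if Rlt_dec 0 s then Rpower s p else 0.

Lemma rpow_real (s p : R) : rpow s p = RtoC (rrpow s p).
Proof.
  unfold rpow, rrpow. destruct Rlt_dec; [now apply Cpower_pos_real|reflexivity].
Qed.

Lemma rrpow_pos (s p : R) : 0 < s -> rrpow s p = Rpower s p.
Proof. intros H. unfold rrpow. destruct Rlt_dec; [reflexivity|lra]. Qed.

Lemma rrpow_ge_0 (s p : R) : 0 <= rrpow s p.
Proof. unfold rrpow. destruct Rlt_dec; [left; apply exp_pos|lra]. Qed.

Definition jweight (p q x : R) : R := rrpow (1 + x) (p - 1) * rrpow (1 - x) (q - 1).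

Lemma jweight_ge_0 (p q x : R) : 0 <= jweight p q x.
Proof. apply Rmult_le_pos; apply rrpow_ge_0. Qed.

Lemma jweight_pos (p q x : R) : -1 < x < 1 -> jweight p q x = Rpower (1 + x) (p - 1) * Rpower (1 - x) (q - 1).
Proof. intros H. unfold jweight. rewrite !rrpow_pos by lra. reflexivity. Qed.

Lemma jweight_rpow (p q x : R) : RtoC (jweight p q x) = (rpow (1 + x) (RtoC (p - 1)) * rpow (1 - x) (RtoC (q - 1)))%C.
Proof. unfold jweight. rewrite RtoC_mult, <- !rpow_real. reflexivity. Qed.

Lemma rcont_translate (g : R -> C) (s : R) : rcont g (1 + s) -> rcont (fun s => g (1 + s)) s.
Proof.
  intros H eps He. destruct (H eps He) as (d & Hd & Hg). exists d. split; [exact Hd|]. intros u Hu.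
  apply Hg. replace (1 + u - (1 + s)) with (u - s) by ring. exact Hu.
Qed.

Lemma cderiv_translate (g : R -> C) (s : R) (l : C) : cderiv g (1 + s) l -> cderiv (fun s => g (1 + s)) s l.
Proof.
  intros H eps He. destruct (H eps He) as (d & Hd & Hg). exists d. split; [exact Hd|]. intros u Hu.
  specialize (Hg (1 + u)). replace (1 + u - (1 + s)) with (u - s) in Hg by ring. exact (Hg Hu).
Qed.

Lemma cderiv_rpow_pos (p : C) (s : R) : 0 < s -> cderiv (fun s => rpow s p) s (p * rpow s (p - 1)).
Proof.
  intros Hs. rewrite rpow_pos by exact Hs.
  apply (cderiv_ext_near (fun s => Cpower s p) _ _ _ s); [exact Hs| |].
  - intros u Hu. rewrite rpow_pos; [reflexivity|]. apply Rabs_def2 in Hu. lra.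
  - replace (p * Cpower s (p - 1))%C with (p * Cpower s (p - 1) * 1)%C by ring.
    apply (cderiv_comp RtoC (fun x => Cpower x p)).
    + apply cderiv_pair; simpl; [apply derivable_pt_lim_id|apply derivable_pt_lim_const].
    + apply sdiff_Cpower, slit_Re_pos. exact Hs.
Qed.

Lemma rcont_jweight_interior (p q x : R) : -1 < x < 1 -> rcont (fun x => RtoC (jweight p q x)) x.
Proof.
  intros Hx. apply (rcont_ext (fun x => rpow (1 + x) (RtoC (p - 1)) * rpow (1 - x) (RtoC (q - 1)))%C).
  { intros s. now rewrite jweight_rpow. }
  apply rcont_mult.
  - apply (rcont_translate (fun s => rpow s (RtoC (p - 1)))). eapply cderiv_rcont, cderiv_rpow_pos. lra.
  - apply (rcont_reflect (fun s => rpow s (RtoC (q - 1)))). eapply cderiv_rcont, cderiv_rpow_pos. lra.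
Qed.

Lemma cint_real_part (h : R -> R) (u v : R) (y : C) : cint (fun x => RtoC (h x)) u v y ->
  is_RInt h u v (Re y) /\ Im y = 0.
Proof.
  intros H.
  pose proof (is_RInt_fct_extend_fst _ u v y H) as H1. pose proof (is_RInt_fct_extend_snd _ u v y H) as H2.
  split; [exact H1|]. simpl in H2.
  pose proof (is_RInt_const_real 0 u v) as H3. rewrite Rmult_0_r in H3.
  rewrite <- (is_RInt_unique _ _ _ _ H3). symmetry. apply (is_RInt_unique _ _ _ _ H2).
Qed.

Lemma impint_real (h : R -> R) (l : C) : impint (fun x => RtoC (h x)) l -> l = RtoC (Re l).
Proof.
  intros H. apply C_ext; [reflexivity|]. simpl. apply Rminus_diag_uniq_sym.
  destruct (Req_dec (Im l) 0) as [->|Hne]; [ring|exfalso].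
  destruct (H (Rabs (Im l)) (Rabs_pos_lt _ Hne)) as (d & Hd & E).
  destruct (E (-1 + d / 2) (1 - d / 2) ltac:(lra) ltac:(lra)) as (y & Y & D).
  destruct (cint_real_part _ _ _ _ Y) as [_ H0].
  pose proof (im_le_Cmod (y - l)) as B. unfold Cminus in B. rewrite im_plus, im_opp, H0, Rplus_0_l, Rabs_Ropp in B.
  unfold Cminus in D. lra.
Qed.

Lemma impint_le (h g : R -> R) (a b : R) : (forall x, -1 < x < 1 -> h x <= g x) ->
  impint (fun x => RtoC (h x)) a -> impint (fun x => RtoC (g x)) b -> a <= b.
Proof.
  intros Hle Ha Hb. apply le_epsilon. intros eps He.
  destruct (Ha (eps / 2) ltac:(lra)) as (d1 & Hd1 & E1). destruct (Hb (eps / 2) ltac:(lra)) as (d2 & Hd2 & E2).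
  pose proof (Rmin_l d1 d2) as M1. pose proof (Rmin_r d1 d2) as M2.
  assert (M0 : 0 < Rmin d1 d2) by (apply Rmin_glb_lt; lra).
  destruct (E1 (-1 + Rmin d1 d2 / 2) (1 - Rmin d1 d2 / 2) ltac:(lra) ltac:(lra)) as (y1 & Y1 & D1).
  destruct (E2 (-1 + Rmin d1 d2 / 2) (1 - Rmin d1 d2 / 2) ltac:(lra) ltac:(lra)) as (y2 & Y2 & D2).
  apply cint_real_part in Y1, Y2. destruct Y1 as [Y1 _], Y2 as [Y2 _].
  assert (L : Re y1 <= Re y2).
  { apply (is_RInt_le h g (-1 + Rmin d1 d2 / 2) (1 - Rmin d1 d2 / 2)); [lra|exact Y1|exact Y2|].
    intros x Hx. apply Hle. lra. }
  pose proof (re_le_Cmod (y1 - a)) as B1. pose proof (re_le_Cmod (y2 - b)) as B2.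
  unfold Cminus in B1, B2. rewrite re_plus, re_opp, re_RtoC in B1, B2. unfold Cminus in D1, D2.
  assert (Q1 := Rabs_def2 _ _ (Rle_lt_trans _ _ _ B1 D1)). assert (Q2 := Rabs_def2 _ _ (Rle_lt_trans _ _ _ B2 D2)).
  lra.
Qed.

Lemma impint_jweight_partial (p q J u v y : R) : impint (fun x => RtoC (jweight p q x)) J ->
  -1 < u -> u <= v -> v < 1 -> is_RInt (jweight p q) u v y -> y <= J.
Proof.
  intros HJ Hu Huv Hv Hy. apply le_epsilon. intros eps He.
  destruct (HJ eps He) as (d & Hd & E).
  set (u' := Rmin u (-1 + d / 2)). set (v' := Rmax v (1 - d / 2)).
  assert (Hu' : -1 < u' /\ u' <= u /\ u' <= -1 + d / 2) by (unfold u', Rmin; destruct Rle_dec; lra).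
  assert (Hv' : v' < 1 /\ v <= v' /\ 1 - d / 2 <= v') by (unfold v', Rmax; destruct Rle_dec; lra).
  destruct (E u' v' ltac:(lra) ltac:(lra)) as (z & Z & D).
  apply cint_real_part in Z. destruct Z as [Z _].
  assert (Hsub : forall s t, -1 < s -> s <= t -> t < 1 -> exists w, is_RInt (jweight p q) s t w /\ 0 <= w).
  { intros s t Hs Hst Ht. destruct (cint_ex (fun x => RtoC (jweight p q x)) s t Hst) as [w Hw].
    { intros x Hx. apply rcont_jweight_interior. lra. }
    apply cint_real_part in Hw. destruct Hw as [Hw _]. exists (Re w). split; [exact Hw|].
    apply (is_RInt_ge_0 (jweight p q) s t); [exact Hst|exact Hw|]. intros; apply jweight_ge_0. }
  destruct (Hsub u' u) as (w1 & W1 & P1); [lra|lra|lra|]. destruct (Hsub v v') as (w2 & W2 & P2); [lra|lra|lra|].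
  pose proof (is_RInt_Chasles _ _ _ _ _ _ (is_RInt_Chasles _ _ _ _ _ _ W1 Hy) W2) as W.
  assert (Ez : Re z = w1 + y + w2).
  { rewrite <- (is_RInt_unique _ _ _ _ Z). apply (is_RInt_unique _ _ _ _ W). }
  pose proof (re_le_Cmod (z - J)) as B. unfold Cminus in B. rewrite re_plus, re_opp, re_RtoC in B. unfold Cminus in D.
  assert (Q := Rabs_def2 _ _ (Rle_lt_trans _ _ _ B D)). lra.
Qed.

(** The total mass of the weight turns uniform convergence of the factors into convergence of the
    improper integrals. *)
Lemma impint_uniform_limit (p q J : R) (h : R -> C) (hn : nat -> R -> C) (e : nat -> R) (ln : nat -> C) (l : C) :
  impint (fun x => RtoC (jweight p q x)) J -> (forall x, -1 < x < 1 -> rcont h x) ->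
  (forall n x, -1 < x < 1 -> Cmod (h x - hn n x) <= e n) -> is_lim_seq e 0 ->
  (forall n, impint (fun x => jweight p q x * hn n x)%C (ln n)) ->
  (forall eps, 0 < eps -> exists N, forall n, (N <= n)%nat -> Cmod (ln n - l) < eps) ->
  impint (fun x => jweight p q x * h x)%C l.
Proof.
  intros HJ Hh He Hlim Hn Hl eps Heps.
  assert (HJ0 : 0 <= J).
  { apply (impint_le (fun _ => 0) (jweight p q)); [intros; apply jweight_ge_0| |exact HJ].
    intros ep Hep. exists 1. split; [lra|]. intros u v _ _. exists 0. split.
    - pose proof (cint_const 0 u v) as Z. rewrite Cmult_0_r in Z. exact Z.
    - rewrite Cmod_diag. exact Hep. }
  destruct (Hl (eps / 3) ltac:(lra)) as [N1 HN1].
  apply is_lim_seq_spec in Hlim.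
  assert (Hq0 : 0 < eps / 3 / (J + 1)) by (repeat apply Rdiv_lt_0_compat; lra).
  destruct (Hlim (mkposreal _ Hq0)) as [N2 HN2]. simpl in HN2.
  set (n := (N1 + N2)%nat). specialize (HN1 n ltac:(unfold n; lia)). specialize (HN2 n ltac:(unfold n; lia)).
  rewrite Rminus_0_r in HN2. apply Rabs_def2 in HN2.
  destruct (Hn n (eps / 3) ltac:(lra)) as (d & Hd & E). exists d. split; [exact Hd|].
  intros u v Hu Hv. destruct (E u v Hu Hv) as (yn & Yn & Dn).
  destruct (cint_ex (fun x => jweight p q x * h x)%C u v) as [y Y]; [lra| |].
  { intros x Hx. apply rcont_mult; [apply rcont_jweight_interior; lra|apply Hh; lra]. }
  exists y. split; [exact Y|].
  destruct (cint_ex (fun x => RtoC (jweight p q x)) u v) as [w W]; [lra|intros; apply rcont_jweight_interior; lra|].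
  apply cint_real_part in W. destruct W as [W _].
  pose proof (impint_jweight_partial p q J u v (Re w) HJ ltac:(lra) ltac:(lra) ltac:(lra) W) as HwJ.
  assert (He0 : 0 <= e n).
  { eapply Rle_trans; [apply Cmod_ge_0|apply (He n 0); lra]. }
  assert (B : Cmod (y - yn) <= e n * Re w).
  { rewrite <- norm_CR.
    apply (norm_RInt_le (V := C_R_NormedModule) (fun x => jweight p q x * h x - jweight p q x * hn n x)%C
             (fun x => e n * jweight p q x) u v); [lra| | |].
    - intros x Hx. rewrite norm_CR.
      replace (jweight p q x * h x - jweight p q x * hn n x)%C with ((h x - hn n x) * jweight p q x)%C by ring.
      rewrite Cmod_mult, Cmod_R, Rabs_pos_eq by apply jweight_ge_0.
      apply Rmult_le_compat_r; [apply jweight_ge_0|]. apply He. lra.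
    - exact (cint_minus _ _ _ _ _ _ Y Yn).
    - exact (is_RInt_scal _ _ _ (e n) _ W). }
  assert (B2 : e n * Re w < eps / 3).
  { apply Rle_lt_trans with (e n * J); [apply Rmult_le_compat_l; lra|].
    destruct HN2 as [HN2 _]. apply Rlt_div_r in HN2; [|lra]. nra. }
  replace (y - l)%C with ((y - yn) + (yn - ln n) + (ln n - l))%C by ring.
  eapply Rle_lt_trans; [apply Cmod_triangle|]. 
  assert (Cmod (y - yn + (yn - ln n)) <= Cmod (y - yn) + Cmod (yn - ln n)) by apply Cmod_triangle. lra.
Qed.

(** * Beta integrals and the Gamma function *)

Lemma rpow_S (s : R) (p : C) : 0 < s -> rpow s p = (rpow s (p - 1) * s)%C.
Proof.
  intros Hs. rewrite <- (Cpow_1_r s), rpow_mult_pow by lra. f_equal. simpl. ring.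
Qed.

Lemma jweight_S_l (p q x : R) : -1 < x < 1 -> RtoC (jweight (p + 1) q x) = (jweight p q x * (1 + x))%C.
Proof.
  intros Hx. rewrite !jweight_rpow, (rpow_S (1 + x) (RtoC (p + 1 - 1))) by lra.
  rewrite RtoC_plus, <- RtoC_minus. replace (p + 1 - 1 - 1) with (p - 1) by ring. ring.
Qed.

Lemma jweight_S_r (p q x : R) : -1 < x < 1 -> RtoC (jweight p (q + 1) x) = (jweight p q x * (1 - x))%C.
Proof.
  intros Hx. rewrite !jweight_rpow, (rpow_S (1 - x) (RtoC (q + 1 - 1))) by lra.
  rewrite (RtoC_minus 1 x), <- RtoC_minus. replace (q + 1 - 1 - 1) with (q - 1) by ring. ring.
Qed.

Lemma rcont_rpow_1p (p x : R) : 0 < p -> rcont (fun x => rpow (1 + x) p) x.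
Proof. intros Hp. apply (rcont_translate (fun s => rpow s p)), rcont_rpow. exact Hp. Qed.

Lemma rcont_rpow_1m (p x : R) : 0 < p -> rcont (fun x => rpow (1 - x) p) x.
Proof. intros Hp. apply (rcont_reflect (fun s => rpow s p)), rcont_rpow. exact Hp. Qed.

(** The integrand is the derivative of (1 + x)^p (1 - x)^q, which vanishes at both ends. *)
Lemma jweight_by_parts (p q : R) : 0 < p -> 0 < q ->
  impint (fun x => jweight p q x * (p * (1 - x) - q * (1 + x)))%C 0.
Proof.
  intros Hp Hq.
  set (G := fun x => (rpow (1 + x) p * rpow (1 - x) q)%C).
  replace (RtoC 0) with (G 1 - G (-1))%C.
  - apply impint_derivative.
    + intros x Hx.
      replace (jweight p q x * (p * (1 - x) - q * (1 + x)))%C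
        with (p * rpow (1 + x) (p - 1) * rpow (1 - x) q + rpow (1 + x) p * - (q * rpow (1 - x) (q - 1)))%C.
      * apply (cderiv_mult (fun x => rpow (1 + x) p) (fun x => rpow (1 - x) q)).
        -- apply (cderiv_translate (fun s => rpow s p)), cderiv_rpow_pos. lra.
        -- apply (cderiv_reflect (fun s => rpow s q)), cderiv_rpow_pos. lra.
      * rewrite jweight_rpow, (rpow_S (1 + x) p), (rpow_S (1 - x) q) by lra.
        rewrite !RtoC_minus, RtoC_plus. ring.
    + intros x Hx. apply rcont_mult; [now apply rcont_jweight_interior|].
      apply (rcont_ext (fun x => (p - q) + (- (p + q)) * x)%C); [intros; ring|].
      apply rcont_plus; [apply rcont_const|]. apply rcont_mult; [apply rcont_const|apply rcont_RtoC].
    + apply rcont_mult; [now apply rcont_rpow_1p|now apply rcont_rpow_1m].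
    + apply rcont_mult; [now apply rcont_rpow_1p|now apply rcont_rpow_1m].
  - unfold G. rewrite (rpow_nonpos (1 + -1)), (rpow_nonpos (1 - 1)) by lra. ring.
Qed.

Lemma jweight_step_l (p q : R) (I : C) : 0 < p -> 0 < q ->
  impint (fun x => RtoC (jweight (p + 1) q x)) I ->
  impint (fun x => RtoC (jweight p q x)) (RtoC ((p + q) / (2 * p)) * I).
Proof.
  intros Hp Hq H.
  assert (Hp0 : RtoC p <> 0) by (apply RtoC_neq_0; lra).
  pose proof (impint_plus _ _ _ _ (impint_scal (RtoC (/ (2 * p))) _ _ (jweight_by_parts p q Hp Hq))
               (impint_scal (RtoC ((p + q) / (2 * p))) _ _ H)) as P.
  rewrite Cmult_0_r, Cplus_0_l in P. eapply impint_ext; [|exact P].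
  intros x Hx. cbv beta. rewrite (jweight_S_l p q x Hx).
  rewrite RtoC_div, RtoC_inv, RtoC_plus, RtoC_mult by lra. field. exact Hp0.
Qed.

Lemma jweight_step_r (p q : R) (I : C) : 0 < p -> 0 < q ->
  impint (fun x => RtoC (jweight p (q + 1) x)) I ->
  impint (fun x => RtoC (jweight p q x)) (RtoC ((p + q) / (2 * q)) * I).
Proof.
  intros Hp Hq H.
  assert (Hq0 : RtoC q <> 0) by (apply RtoC_neq_0; lra).
  pose proof (impint_plus _ _ _ _ (impint_scal (RtoC (- / (2 * q))) _ _ (jweight_by_parts p q Hp Hq))
               (impint_scal (RtoC ((p + q) / (2 * q))) _ _ H)) as P.
  rewrite Cmult_0_r, Cplus_0_l in P. eapply impint_ext; [|exact P].
  intros x Hx. cbv beta. rewrite (jweight_S_r p q x Hx).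
  rewrite RtoC_div, RtoC_opp, RtoC_inv, RtoC_plus, RtoC_mult by lra. field. exact Hq0.
Qed.

Definition jacobi_mass (p q : R) : R :=
  Re (epsilon (inhabits (RtoC 0)) (impint (fun x => RtoC (jweight p q x)))).

Lemma jacobi_mass_spec (p q : R) : 0 < p -> 0 < q ->
  impint (fun x => RtoC (jweight p q x)) (jacobi_mass p q).
Proof.
  intros Hp Hq.
  assert (Hex : exists I, impint (fun x => RtoC (jweight p q x)) I).
  { destruct (impint_continuous (fun x => RtoC (jweight (p + 1) (q + 1) x))) as [I HI].
    - intros x _. apply (rcont_ext (fun x => rpow (1 + x) (RtoC (p + 1 - 1)) * rpow (1 - x) (RtoC (q + 1 - 1)))%C).
      { intros s. now rewrite jweight_rpow. }
      apply rcont_mult; [apply rcont_rpow_1p|apply rcont_rpow_1m]; lra.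
    - eexists. apply jweight_step_r; [exact Hp|exact Hq|]. apply jweight_step_l; [exact Hp|lra|exact HI]. }
  pose proof (epsilon_spec (inhabits (RtoC 0)) _ Hex) as H.
  unfold jacobi_mass. rewrite <- (impint_real _ _ H). exact H.
Qed.

Lemma jacobi_mass_unique (p q : R) (l : R) : 0 < p -> 0 < q ->
  impint (fun x => RtoC (jweight p q x)) l -> jacobi_mass p q = l.
Proof.
  intros Hp Hq H. apply RtoC_inj. exact (impint_unique _ _ _ (jacobi_mass_spec p q Hp Hq) H).
Qed.

Lemma jacobi_mass_l (p q : R) : 0 < p -> 0 < q ->
  jacobi_mass p q = (p + q) / (2 * p) * jacobi_mass (p + 1) q.
Proof.
  intros Hp Hq. apply jacobi_mass_unique; [exact Hp|exact Hq|]. rewrite RtoC_mult.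
  apply jweight_step_l; [exact Hp|exact Hq|]. apply jacobi_mass_spec; lra.
Qed.

Lemma jacobi_mass_r (p q : R) : 0 < p -> 0 < q ->
  jacobi_mass p q = (p + q) / (2 * q) * jacobi_mass p (q + 1).
Proof.
  intros Hp Hq. apply jacobi_mass_unique; [exact Hp|exact Hq|]. rewrite RtoC_mult.
  apply jweight_step_r; [exact Hp|exact Hq|]. apply jacobi_mass_spec; lra.
Qed.

Lemma jacobi_mass_1 (p : R) : 0 < p -> jacobi_mass p 1 = Rpower 2 p / p.
Proof.
  intros Hp. apply jacobi_mass_unique; [exact Hp|lra|].
  assert (Hp0 : RtoC p <> 0) by (apply RtoC_neq_0; lra).
  set (G := fun x => (/ p * rpow (1 + x) p)%C).
  replace (RtoC (Rpower 2 p / p)) with (G 1 - G (-1))%C.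
  - apply (impint_ext (fun x => 0 * rpow (1 + x) p + / p * (p * rpow (1 + x) (p - 1)))%C).
    + intros x Hx. rewrite jweight_rpow, RtoC_minus, (rpow_pos (1 - x)) by lra.
      rewrite Rminus_diag, Cpower_0. field. exact Hp0.
    + apply impint_derivative.
      * intros x Hx. apply (cderiv_mult (fun _ => (/ p)%C) (fun x => rpow (1 + x) p)); [apply cderiv_const|].
        apply (cderiv_translate (fun s => rpow s p)), cderiv_rpow_pos. lra.
      * intros x Hx. apply rcont_plus.
        -- apply rcont_mult; [apply rcont_const|now apply rcont_rpow_1p].
        -- apply rcont_mult; [apply rcont_const|]. apply rcont_mult; [apply rcont_const|].
           apply (rcont_translate (fun s => rpow s (p - 1))). eapply cderiv_rcont, cderiv_rpow_pos. lra.
      * apply rcont_mult; [apply rcont_const|now apply rcont_rpow_1p].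
      * apply rcont_mult; [apply rcont_const|now apply rcont_rpow_1p].
  - unfold G. rewrite (rpow_nonpos (1 + -1)), rpow_real, rrpow_pos by lra.
    replace (1 + 1) with 2 by ring. rewrite RtoC_div by lra. field. exact Hp0.
Qed.

Fixpoint rpoch (x : R) (n : nat) : R :=
  match n with
  | O => 1
  | S m => rpoch x m * (x + INR m)
  end.

Lemma pochhammer_real (x : R) (n : nat) : pochhammer x n = RtoC (rpoch x n).
Proof.
  induction n as [|n IH]; [reflexivity|]. simpl. rewrite IH, RtoC_mult, RtoC_plus. reflexivity.
Qed.

Lemma rpoch_pos (x : R) (n : nat) : 0 < x -> 0 < rpoch x n.
Proof.
  intros Hx. induction n as [|n IH]; simpl; [lra|]. pose proof (pos_INR n). apply Rmult_lt_0_compat; lra.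
Qed.

Lemma jacobi_mass_l_iter (p q : R) (n : nat) : 0 < p -> 0 < q ->
  jacobi_mass (p + INR n) q = 2 ^ n * rpoch p n / rpoch (p + q) n * jacobi_mass p q.
Proof.
  intros Hp Hq. induction n as [|n IH].
  - simpl. rewrite Rplus_0_r. field.
  - pose proof (pos_INR n). pose proof (rpoch_pos (p + q) n ltac:(lra)). pose proof (rpoch_pos p n Hp).
    rewrite S_INR. pose proof (jacobi_mass_l (p + INR n) q ltac:(lra) Hq) as E.
    rewrite IH in E. replace (p + (INR n + 1)) with (p + INR n + 1) by ring.
    replace (jacobi_mass (p + INR n + 1) q)
      with (2 * (p + INR n) / (p + INR n + q) * ((p + INR n + q) / (2 * (p + INR n)) * jacobi_mass (p + INR n + 1) q))
      by (field; lra).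
    rewrite <- E. simpl. field. lra.
Qed.

Lemma jacobi_mass_r_iter (p q : R) (n : nat) : 0 < p -> 0 < q ->
  jacobi_mass p (q + INR n) = 2 ^ n * rpoch q n / rpoch (p + q) n * jacobi_mass p q.
Proof.
  intros Hp Hq. induction n as [|n IH].
  - simpl. rewrite Rplus_0_r. field.
  - pose proof (pos_INR n). pose proof (rpoch_pos (p + q) n ltac:(lra)). pose proof (rpoch_pos q n Hq).
    rewrite S_INR. pose proof (jacobi_mass_r p (q + INR n) Hp ltac:(lra)) as E.
    rewrite IH in E. replace (q + (INR n + 1)) with (q + INR n + 1) by ring.
    replace (jacobi_mass p (q + INR n + 1))
      with (2 * (q + INR n) / (p + (q + INR n)) * ((p + (q + INR n)) / (2 * (q + INR n)) * jacobi_mass p (q + INR n + 1)))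
      by (field; lra).
    rewrite <- E. simpl. field. lra.
Qed.

Lemma rpoch_1 (n : nat) : rpoch 1 n = INR (fact n).
Proof.
  induction n as [|n IH]; [reflexivity|]. simpl rpoch. rewrite IH. change (fact (S n)) with (S n * fact n)%nat.
  rewrite mult_INR, S_INR. ring.
Qed.

Lemma rpoch_S_l (x : R) (n : nat) : rpoch x (S n) = x * rpoch (x + 1) n.
Proof.
  apply RtoC_inj. rewrite RtoC_mult, <- !pochhammer_real, RtoC_plus. apply pochhammer_S_l.
Qed.

Lemma jacobi_mass_nat_pos (p : R) (n : nat) : 0 < p -> 0 < jacobi_mass p (1 + INR n).
Proof.
  intros Hp. rewrite jacobi_mass_r_iter, jacobi_mass_1 by lra.
  pose proof (rpoch_pos 1 n Rlt_0_1). pose proof (rpoch_pos (p + 1) n ltac:(lra)).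
  pose proof (pow_lt 2 n ltac:(lra)). assert (0 < Rpower 2 p) by apply exp_pos.
  apply Rmult_lt_0_compat; apply Rdiv_lt_0_compat; try lra. apply Rmult_lt_0_compat; lra.
Qed.

Definition gamma_seq (x : R) (n : nat) : R := INR (fact n) * Rpower (INR n) x / rpoch x (S n).

Lemma gamma_seq_pos (x : R) (n : nat) : 0 < x -> 0 < gamma_seq x n.
Proof.
  intros Hx. unfold gamma_seq. apply Rdiv_lt_0_compat; [|now apply rpoch_pos].
  apply Rmult_lt_0_compat; [apply INR_fact_lt_0|apply exp_pos].
Qed.

Lemma gamma_seq_ratio (x : R) (n : nat) : 0 < x -> (0 < n)%nat ->
  gamma_seq x (S n) = gamma_seq x n * (Rpower (1 + / INR n) x * / (1 + x / (INR n + 1))).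
Proof.
  intros Hx Hn. assert (Hn0 : 0 < INR n) by now apply lt_0_INR.
  unfold gamma_seq. change (fact (S n)) with (S n * fact n)%nat. rewrite mult_INR.
  assert (E : Rpower (INR (S n)) x = Rpower (INR n) x * Rpower (1 + / INR n) x).
  { assert (0 < / INR n) by now apply Rinv_0_lt_compat.
    rewrite Rpower_mult_distr by lra. f_equal. rewrite S_INR. field. lra. }
  rewrite E. change (rpoch x (S (S n))) with (rpoch x (S n) * (x + INR (S n))).
  pose proof (rpoch_pos x (S n) Hx). rewrite S_INR. field. repeat split; lra.
Qed.

Lemma exp_le_mono (x y : R) : x <= y -> exp x <= exp y.
Proof. intros [H|H]; [left; now apply exp_increasing|subst; lra]. Qed.

(** Bernoulli-type bounds show that the Euler sequence increases while its product with
    exp (x (x+1) / n) decreases. *)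
Lemma gamma_seq_converges (x : R) : 0 < x -> exists G, 0 < G /\ is_lim_seq (gamma_seq x) G.
Proof.
  intros Hx.
  assert (Hr : forall n, (0 < n)%nat -> 0 < INR n /\ 0 < / INR n /\ 0 < x / (INR n + 1)).
  { intros n Hn. assert (0 < INR n) by now apply lt_0_INR. repeat split; [assumption|now apply Rinv_0_lt_compat|].
    apply Rdiv_lt_0_compat; lra. }
  assert (Hinc : forall n, (0 < n)%nat -> gamma_seq x n <= gamma_seq x (S n)).
  { intros n Hn. rewrite gamma_seq_ratio by assumption. destruct (Hr n Hn) as (H1 & H2 & H3).
    pose proof (gamma_seq_pos x n Hx). rewrite <- (Rmult_1_r (gamma_seq x n)) at 1.
    apply Rmult_le_compat_l; [lra|]. apply Rle_div_r; [lra|]. rewrite Rmult_1_l.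
    assert (L : / (INR n + 1) <= ln (1 + / INR n)).
    { assert (Q : ln (1 + / INR n) = - ln (1 - / (INR n + 1))).
      { rewrite <- ln_Rinv.
        - f_equal. field. lra.
        - replace (1 - / (INR n + 1)) with (INR n / (INR n + 1)) by (field; lra). apply Rdiv_lt_0_compat; lra. }
      rewrite Q. pose proof (exp_ineq1_le (- / (INR n + 1))) as P.
      assert (P2 : ln (1 - / (INR n + 1)) <= - / (INR n + 1)); [|lra].
      rewrite <- (ln_exp (- / (INR n + 1))). apply ln_le; [|exact P].
      replace (1 - / (INR n + 1)) with (INR n / (INR n + 1)) by (field; lra). apply Rdiv_lt_0_compat; lra. }
    unfold Rpower. eapply Rle_trans; [apply exp_ineq1_le|]. apply exp_le_mono. unfold Rdiv. nra. }
  set (K := x * (x + 1)).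
  assert (Hdec : forall n, (0 < n)%nat ->
     gamma_seq x (S n) * exp (K / (INR n + 1)) <= gamma_seq x n * exp (K / INR n)).
  { intros n Hn. rewrite gamma_seq_ratio by assumption. destruct (Hr n Hn) as (H1 & H2 & H3).
    pose proof (gamma_seq_pos x n Hx). rewrite Rmult_assoc. apply Rmult_le_compat_l; [lra|].
    assert (A1 : Rpower (1 + / INR n) x <= exp (x * / INR n)).
    { unfold Rpower. apply exp_le_mono. apply Rmult_le_compat_l; [lra|].
      rewrite <- (ln_exp (/ INR n)) at 2. apply ln_le; [lra|]. apply exp_ineq1_le. }
    assert (A2 : / (1 + x / (INR n + 1)) <= exp (- (x / (INR n + 1 + x)))).
    { eapply Rle_trans; [|apply exp_ineq1_le]. right. field. lra. }
    assert (A3 : 0 < / (1 + x / (INR n + 1))) by (apply Rinv_0_lt_compat; lra).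
    apply Rle_trans with (exp (x * / INR n) * exp (- (x / (INR n + 1 + x))) * exp (K / (INR n + 1))).
    - apply Rmult_le_compat_r; [left; apply exp_pos|]. apply Rmult_le_compat; try lra. left; apply exp_pos.
    - rewrite <- !exp_plus. apply exp_le_mono.
      assert (Q : x * / INR n + - (x / (INR n + 1 + x)) + K / (INR n + 1) - K / INR n
                = - (K * x / (INR n * (INR n + 1) * (INR n + 1 + x)))) by (unfold K; field; lra).
      assert (0 < K * x / (INR n * (INR n + 1) * (INR n + 1 + x))); [|lra].
      unfold K. apply Rdiv_lt_0_compat; repeat apply Rmult_lt_0_compat; lra. }
  assert (Hub : forall n, gamma_seq x (S n) * exp (K / INR (S n)) <= gamma_seq x 1 * exp (K / INR 1)).
  { induction n as [|n IH]; [lra|]. eapply Rle_trans; [|exact IH].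
    rewrite (S_INR (S n)). apply Hdec. lia. }
  destruct (ex_finite_lim_seq_incr (fun n => gamma_seq x (S n)) (gamma_seq x 1 * exp (K / INR 1))) as [G HG].
  - intros n. apply Hinc. lia.
  - intros n. eapply Rle_trans; [|apply Hub]. pose proof (gamma_seq_pos x (S n) Hx).
    rewrite <- (Rmult_1_r (gamma_seq x (S n))) at 1. apply Rmult_le_compat_l; [lra|].
    eapply Rle_trans; [|apply exp_ineq1_le].
    assert (0 < K / INR (S n)); [|lra]. unfold K. apply Rdiv_lt_0_compat; [nra|apply lt_0_INR; lia].
  - exists G. split.
    + assert (Hlow : forall n, gamma_seq x 1 <= gamma_seq x (S n)).
      { induction n as [|n IH]; [lra|]. eapply Rle_trans; [exact IH|]. apply Hinc. lia. }
      pose proof (is_lim_seq_le _ _ _ _ Hlow (is_lim_seq_const (gamma_seq x 1)) HG) as L. simpl in L.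
      pose proof (gamma_seq_pos x 1 Hx). lra.
    + apply is_lim_seq_incr_1. exact HG.
Qed.

Definition rgamma (x : R) : R := real (Lim_seq (gamma_seq x)).

Lemma rgamma_lim (x : R) : 0 < x -> is_lim_seq (gamma_seq x) (rgamma x).
Proof.
  intros Hx. destruct (gamma_seq_converges x Hx) as (G & _ & HG). unfold rgamma.
  rewrite (is_lim_seq_unique _ _ HG). exact HG.
Qed.

Lemma rgamma_pos (x : R) : 0 < x -> 0 < rgamma x.
Proof.
  intros Hx. destruct (gamma_seq_converges x Hx) as (G & HG0 & HG). unfold rgamma.
  rewrite (is_lim_seq_unique _ _ HG). exact HG0.
Qed.

Lemma Cgamma_pos_real (x : R) : 0 < x -> Cgamma x = RtoC (rgamma x).
Proof.
  intros Hx.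
  assert (E : forall n, (1 <= n)%nat -> Cgamma_seq x n = RtoC (gamma_seq x n)).
  { intros n Hn. unfold Cgamma_seq, gamma_seq.
    rewrite Cpower_pos_real by (apply lt_0_INR; lia). rewrite pochhammer_real.
    pose proof (rpoch_pos x (S n) Hx). rewrite RtoC_div, RtoC_mult by lra. reflexivity. }
  unfold Cgamma, rgamma.
  rewrite (Lim_seq_ext_loc (fun n => Re (Cgamma_seq x n)) (gamma_seq x)).
  2: { exists 1%nat. intros n Hn. now rewrite E. }
  rewrite (Lim_seq_ext_loc (fun n => Im (Cgamma_seq x n)) (fun _ => 0)).
  2: { exists 1%nat. intros n Hn. now rewrite E. }
  rewrite Lim_seq_const. reflexivity.
Qed.

Lemma rpoch_ratio_lim (p : R) (k : nat) : 0 < p ->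
  is_lim_seq (fun n => rpoch (1 + INR n) k / rpoch (p + (1 + INR n)) k) 1.
Proof.
  intros Hp. induction k as [|k IH].
  - simpl. apply (is_lim_seq_ext (fun _ => 1)); [intros; field|apply is_lim_seq_const].
  - apply (is_lim_seq_ext (fun n => (rpoch (1 + INR n) k / rpoch (p + (1 + INR n)) k) * (1 - p * / (INR n + (p + 1 + INR k))))).
    + intros n. pose proof (pos_INR n). pose proof (pos_INR k). pose proof (rpoch_pos (p + (1 + INR n)) k ltac:(lra)).
      simpl. field. lra.
    + replace (Finite 1) with (Finite (1 * (1 - p * 0))) by (f_equal; ring).
      apply is_lim_seq_mult'; [exact IH|]. apply is_lim_seq_minus'; [apply is_lim_seq_const|].
      apply (is_lim_seq_scal_l _ p 0).
      replace (Finite 0) with (Rbar_inv p_infty) by reflexivity.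
      apply is_lim_seq_inv; [|discriminate].
      eapply is_lim_seq_plus; [apply is_lim_seq_INR|apply is_lim_seq_const|reflexivity].
Qed.

(** The quotient of the Beta integral by the Euler products is the ratio of two masses
    concentrating at -1, where 1 - x is close to 2. *)
Lemma jacobi_mass_gamma (p q : R) : 0 < p -> 0 < q ->
  jacobi_mass p q = Rpower 2 (p + q - 1) * rgamma p * rgamma q / rgamma (p + q).
Proof.
  intros Hp Hq.
  set (r := fun n => jacobi_mass p (q + INR (S n)) / (Rpower 2 q * jacobi_mass p (1 + INR n))).
  assert (H2q : 0 < Rpower 2 q) by apply exp_pos.
  assert (Hm : forall n : nat, 0 < jacobi_mass p (1 + INR n)).
  { intros n. now apply jacobi_mass_nat_pos. }
  destruct (INR_unbounded q) as [k Hk].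
  assert (Hr : is_lim_seq r 1).
  { apply (is_lim_seq_le_le (fun n => rpoch (1 + INR n) k / rpoch (p + (1 + INR n)) k) _ (fun _ => 1)).
    - intros n. pose proof (pos_INR n) as Nn. pose proof (pos_INR k) as Nk. specialize (Hm n).
      assert (Hprod : 0 < Rpower 2 q * jacobi_mass p (1 + INR n)) by nra.
      assert (Hsplit : forall x, -1 < x < 1 ->
                Rpower (1 - x) (q + INR (S n) - 1) = Rpower (1 - x) q * Rpower (1 - x) (INR n)).
      { intros x Hx. rewrite S_INR, <- Rpower_plus. f_equal. ring. }
      split.
      + unfold r. apply (proj1 (Rle_div_r _ _ _ Hprod)).
        pose proof (rpoch_pos (1 + INR n) k ltac:(lra)). pose proof (rpoch_pos (p + (1 + INR n)) k ltac:(lra)).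
        pose proof (jacobi_mass_r_iter p (1 + INR n) k Hp ltac:(lra)) as E.
        assert (H2k : 0 < 2 ^ k) by (apply pow_lt; lra).
        replace (rpoch (1 + INR n) k / rpoch (p + (1 + INR n)) k * (Rpower 2 q * jacobi_mass p (1 + INR n)))
          with (Rpower 2 (q - INR k) * jacobi_mass p (1 + INR n + INR k)).
        * apply (impint_le (fun x => Rpower 2 (q - INR k) * jweight p (1 + INR n + INR k) x) (jweight p (q + INR (S n)))).
          -- intros x Hx. rewrite !jweight_pos by exact Hx. rewrite Hsplit by exact Hx.
             replace (Rpower (1 - x) q) with (Rpower (1 - x) (q - INR k) * Rpower (1 - x) (INR k))
               by (rewrite <- Rpower_plus; f_equal; ring).
             replace (1 + INR n + INR k - 1) with (INR k + INR n) by ring. rewrite Rpower_plus.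
             assert (L : Rpower 2 (q - INR k) <= Rpower (1 - x) (q - INR k)).
             { replace (q - INR k) with (- (INR k - q)) by ring. rewrite !Rpower_Ropp.
               apply Rinv_le_contravar; [apply exp_pos|]. apply Rle_Rpower_l; lra. }
             assert (P1 : 0 < Rpower (1 + x) (p - 1)) by apply exp_pos.
             assert (P2 : 0 < Rpower (1 - x) (INR k)) by apply exp_pos.
             assert (P3 : 0 < Rpower (1 - x) (INR n)) by apply exp_pos.
             set (A := Rpower (1 + x) (p - 1)) in *. set (B := Rpower (1 - x) (INR k)) in *. set (D := Rpower (1 - x) (INR n)) in *.
             replace (Rpower 2 (q - INR k) * (A * (B * D))) with (Rpower 2 (q - INR k) * (A * B * D)) by ring.
             replace (A * (Rpower (1 - x) (q - INR k) * B * D)) with (Rpower (1 - x) (q - INR k) * (A * B * D)) by ring.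
             apply Rmult_le_compat_r; [|exact L]. left. repeat apply Rmult_lt_0_compat; assumption.
          -- rewrite RtoC_mult. eapply impint_ext; [|apply (impint_scal (RtoC (Rpower 2 (q - INR k))) _ _ (jacobi_mass_spec p (1 + INR n + INR k) Hp ltac:(lra)))].
             intros x _. cbv beta. now rewrite RtoC_mult.
          -- apply jacobi_mass_spec; [exact Hp|]. pose proof (pos_INR (S n)). lra.
        * rewrite E. unfold Rminus. rewrite Rpower_plus, Rpower_Ropp, Rpower_pow by lra. field. lra.
      + unfold r. apply Rle_div_l; [exact Hprod|]. rewrite Rmult_1_l.
        apply (impint_le (jweight p (q + INR (S n))) (fun x => Rpower 2 q * jweight p (1 + INR n) x)).
        * intros x Hx. rewrite !jweight_pos by exact Hx. rewrite Hsplit by exact Hx.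
          replace (1 + INR n - 1) with (INR n) by ring.
          assert (L : Rpower (1 - x) q <= Rpower 2 q) by (apply Rle_Rpower_l; lra).
          assert (P1 : 0 < Rpower (1 + x) (p - 1)) by apply exp_pos.
          assert (P3 : 0 < Rpower (1 - x) (INR n)) by apply exp_pos.
          set (A := Rpower (1 + x) (p - 1)) in *. set (D := Rpower (1 - x) (INR n)) in *.
          replace (A * (Rpower (1 - x) q * D)) with (Rpower (1 - x) q * (A * D)) by ring.
          apply Rmult_le_compat_r; [|exact L]. left. apply Rmult_lt_0_compat; assumption.
        * apply jacobi_mass_spec; [exact Hp|]. pose proof (pos_INR (S n)). lra.
        * rewrite RtoC_mult. eapply impint_ext; [|apply (impint_scal (RtoC (Rpower 2 q)) _ _ (jacobi_mass_spec p (1 + INR n) Hp ltac:(lra)))].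
          intros x _. cbv beta. now rewrite RtoC_mult.
    - now apply rpoch_ratio_lim.
    - apply is_lim_seq_const. }
  assert (Hid : forall n, (1 <= n)%nat -> jacobi_mass p q =
     Rpower 2 (p + q - 1) * (gamma_seq p n * gamma_seq q n / gamma_seq (p + q) n) * r n).
  { intros n Hn. unfold r. rewrite !jacobi_mass_r_iter, jacobi_mass_1 by lra.
    unfold gamma_seq. rewrite Rpower_plus. rewrite rpoch_1.
    pose proof (rpoch_pos (p + q) (S n) ltac:(lra)). pose proof (rpoch_pos q (S n) Hq). pose proof (rpoch_pos (p + 1) n ltac:(lra)).
    rewrite (rpoch_S_l p n).
    assert (0 < Rpower (INR n) p) by apply exp_pos. assert (0 < Rpower (INR n) q) by apply exp_pos.
    assert (0 < Rpower 2 p) by apply exp_pos.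
    pose proof (INR_fact_lt_0 n). pose proof (pow_lt 2 n ltac:(lra)).
    replace (Rpower 2 (p + q - 1)) with (Rpower 2 p * Rpower 2 q / 2).
    - simpl (2 ^ S n). field. repeat split; lra.
    - unfold Rminus. rewrite !Rpower_plus, Rpower_Ropp, Rpower_1 by lra. field. }
  assert (L : is_lim_seq (fun n => Rpower 2 (p + q - 1) * (gamma_seq p n * gamma_seq q n / gamma_seq (p + q) n) * r n)
                (Rpower 2 (p + q - 1) * (rgamma p * rgamma q / rgamma (p + q)) * 1)).
  { apply is_lim_seq_mult'; [|exact Hr]. apply (is_lim_seq_scal_l _ (Rpower 2 (p + q - 1)) (rgamma p * rgamma q / rgamma (p + q))).
    apply is_lim_seq_div'; [apply is_lim_seq_mult'; now apply rgamma_lim|apply rgamma_lim; lra|].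
    pose proof (rgamma_pos (p + q) ltac:(lra)). lra. }
  assert (L2 : is_lim_seq (fun _ : nat => jacobi_mass p q) (Rpower 2 (p + q - 1) * (rgamma p * rgamma q / rgamma (p + q)) * 1)).
  { eapply is_lim_seq_ext_loc; [|exact L]. exists 1%nat. intros n Hn. symmetry. now apply Hid. }
  apply is_lim_seq_unique in L2. rewrite Lim_seq_const in L2. injection L2 as L2. rewrite L2.
  pose proof (rgamma_pos (p + q) ltac:(lra)). field. lra.
Qed.

(** * Moments of Jacobi polynomials *)

Lemma jweight_add (p q x : R) (m j : nat) : -1 < x < 1 ->
  RtoC (jweight (p + INR m) (q + INR j) x) = (jweight p q x * (1 + x) ^ m * (1 - x) ^ j)%C.
Proof.
  intros Hx. induction m as [|m IH].
  - rewrite Rplus_0_r. induction j as [|j IHj].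
    + rewrite Rplus_0_r. simpl. ring.
    + rewrite S_INR. replace (q + (INR j + 1)) with (q + INR j + 1) by ring.
      rewrite jweight_S_r, IHj, (Cpow_S (1 - x)) by exact Hx. ring.
  - rewrite S_INR. replace (p + (INR m + 1)) with (p + INR m + 1) by ring.
    rewrite jweight_S_l, IH, (Cpow_S (1 + x)) by exact Hx. ring.
Qed.

Definition jacobi_moment (k : nat) (p q : R) (m : nat) : C :=
  (jacobi_mass p q * (pochhammer q k / INR (fact k))
   * (pochhammer (INR m + 1 - INR k) k * pochhammer p m / pochhammer (p + q) (m + k)))%C.

Lemma jacobiP_csum (k : nat) (a b z : C) : jacobiP k a b z =
  (pochhammer (a + 1) k / INR (fact k) *
   csum (fun j => hyp2F1_coef (- INR k) (INR k + a + b + 1) (a + 1) j * ((1 - z) / 2) ^ j) k)%C.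
Proof. reflexivity. Qed.

(** Expanding P_k in powers of (1 - x)/2 gives Beta integrals whose ratios are Pochhammer
    symbols; their sum is Chu-Vandermonde again. *)
Lemma impint_jacobi_moment (k m : nat) (beta gamma : R) : -1 < beta -> -1 < gamma ->
  impint (fun x => jweight (beta + 1) (gamma + 1) x * (((1 + x) / 2) ^ m * jacobiP k gamma beta x))%C
    (jacobi_moment k (beta + 1) (gamma + 1) m).
Proof.
  intros Hb Hg. set (p := beta + 1). set (q := gamma + 1).
  assert (Hp : 0 < p) by (unfold p; lra). assert (Hq : 0 < q) by (unfold q; lra).
  set (co := hyp2F1_coef (- INR k) (INR k + gamma + beta + 1) (gamma + 1)).
  pose proof (pos_INR m) as Nm.
  pose proof (no_pole_pos q Hq) as Pq. pose proof (no_pole_pos (p + q) ltac:(lra)) as Ppq.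
  pose proof (no_pole_pos (p + q + INR m) ltac:(lra)) as Ppqm.
  set (K := (pochhammer (gamma + 1) k / INR (fact k))%C).
  assert (Hterm : forall j, impint (fun x => K * co j * / (2 ^ m * 2 ^ j) * RtoC (jweight (p + INR m) (q + INR j) x))%C
            (K * co j * / (2 ^ m * 2 ^ j) * jacobi_mass (p + INR m) (q + INR j))%C).
  { intros j. pose proof (pos_INR j). apply impint_scal, jacobi_mass_spec; lra. }
  pose proof (impint_csum _ _ k Hterm) as S. cbv beta in S.
  assert (H2 : RtoC 2 <> 0) by (apply RtoC_neq_0; lra).
  replace (jacobi_moment k p q m) with
    (csum (fun j => K * co j * / (2 ^ m * 2 ^ j) * jacobi_mass (p + INR m) (q + INR j))%C k).
  - eapply impint_ext; [|exact S]. intros x Hx. cbv beta.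
    rewrite jacobiP_csum. fold K co.
    transitivity (jweight p q x * ((1 + x) / 2) ^ m * K * csum (fun j => co j * ((1 - x) / 2) ^ j) k)%C; [|ring].
    rewrite <- csum_scal. apply csum_ext_le. intros j _.
    rewrite jweight_add by exact Hx. unfold Cdiv.
    rewrite !Cpow_mult_l, !Cpow_inv by exact H2.
    pose proof (Cpow_nz 2 m H2). pose proof (Cpow_nz 2 j H2). field. auto.
  - transitivity (csum (fun j => K * jacobi_mass p q * (pochhammer p m / pochhammer (RtoC (p + q)) m) *
        hyp2F1_coef (- INR k) (INR k + gamma + beta + 1) (RtoC (p + q + INR m)) j)%C k).
    + apply csum_ext_le. intros j _. rewrite jacobi_mass_r_iter, jacobi_mass_l_iter by lra.
      rewrite !RtoC_mult.
      pose proof (rpoch_pos (p + q) m ltac:(lra)). pose proof (rpoch_pos (p + INR m + q) j ltac:(lra)).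
      rewrite !RtoC_div, !RtoC_mult, <- !pochhammer_real, !RtoC_pow by lra.
      replace (p + INR m + q) with (p + q + INR m) by ring.
      unfold co, hyp2F1_coef. replace (gamma + 1)%C with (RtoC q) by (unfold q; now rewrite RtoC_plus).
      pose proof (pochhammer_neq_0 _ j Pq). pose proof (pochhammer_neq_0 _ m Ppq).
      pose proof (pochhammer_neq_0 _ j Ppqm). pose proof (fact_C_neq_0 j).
      pose proof (Cpow_nz 2 m H2). pose proof (Cpow_nz 2 j H2).
      field. repeat split; auto.
    + rewrite csum_scal, chu_vandermonde by exact Ppqm. unfold jacobi_moment, K.
      replace (gamma + 1)%C with (RtoC q) by (unfold q; now rewrite RtoC_plus).
      replace (RtoC (p + q + INR m) - (INR k + gamma + beta + 1))%C with (INR m + 1 - INR k)%C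
        by (unfold p, q; rewrite !RtoC_plus; ring).
      rewrite (pochhammer_add (p + q) m k).
      replace (RtoC p + RtoC q)%C with (RtoC (p + q)) by apply RtoC_plus.
      rewrite (RtoC_plus (p + q) (INR m)) in *.
      pose proof (pochhammer_neq_0 _ m Ppq). pose proof (pochhammer_neq_0 _ k Ppqm). pose proof (fact_C_neq_0 k).
      field. auto.
Qed.

Lemma pochhammer_shifted_fact (j k : nat) :
  (pochhammer (INR (k + j) + 1 - INR k) k * INR (fact j))%C = INR (fact (k + j)).
Proof.
  replace (INR (k + j) + 1 - INR k)%C with (1 + INR j)%C by (rewrite INR_plus_C; ring).
  replace (RtoC (INR (fact j))) with (pochhammer 1 j).
  - rewrite Cmult_comm, <- pochhammer_add. rewrite pochhammer_real, rpoch_1. do 3 f_equal. lia.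
  - rewrite pochhammer_real, rpoch_1. reflexivity.
Qed.

Lemma pochhammer_vanishes (m k : nat) : (m < k)%nat -> pochhammer (INR m + 1 - INR k) k = 0.
Proof.
  intros H. replace (INR m + 1 - INR k)%C with (- INR (k - S m))%C.
  - apply pochhammer_neg_nat_0. lia.
  - rewrite minus_INR by lia. rewrite RtoC_minus, INR_S_C. ring.
Qed.

(** The moment vanishes for m < k, and for m = k + j the factor (m + 1 - k)_k = m! / j! moves the
    factorial of the Gauss coefficient from m to j. *)
Lemma moment_series (k m : nat) (a : C) (p q : R) : 0 < p -> 0 < q ->
  (hyp2F1_coef (a / 2) ((a + 1) / 2) p m * jacobi_moment k p q m)%C
  = (jacobi_mass p q * (pochhammer q k / INR (fact k)) * (pochhammer a (2 * k) / (4 ^ k * pochhammer (p + q) (2 * k)))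
     * pshift k (hyp2F1_coef ((a + INR (2 * k)) / 2) ((a + INR (2 * k) + 1) / 2) (p + q + INR (2 * k))) m)%C.
Proof.
  intros Hp Hq. unfold pshift. destruct (le_dec k m) as [Hkm|Hkm].
  2: { unfold jacobi_moment. rewrite pochhammer_vanishes by lia. unfold Cdiv. ring. }
  set (j := (m - k)%nat). replace m with (k + j)%nat by (unfold j; lia). clearbody j. clear Hkm m.
  unfold jacobi_moment, hyp2F1_coef.
  assert (H4 : RtoC 4 <> 0) by (apply RtoC_neq_0; lra).
  assert (H2k : RtoC (INR (2 * k)) = (2 * INR k)%C) by (rewrite mult_INR, RtoC_mult; reflexivity).
  assert (E1 : pochhammer (a / 2) (k + j) = (pochhammer (a / 2) k * pochhammer ((a + INR (2 * k)) / 2) j)%C).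
  { rewrite pochhammer_add. do 2 f_equal. rewrite H2k. field. }
  assert (E2 : pochhammer ((a + 1) / 2) (k + j)
             = (pochhammer ((a + 1) / 2) k * pochhammer ((a + INR (2 * k) + 1) / 2) j)%C).
  { rewrite pochhammer_add. do 2 f_equal. rewrite H2k. field. }
  assert (E3 : pochhammer (p + q) (k + j + k) = (pochhammer (p + q) (2 * k) * pochhammer (p + q + INR (2 * k)) j)%C).
  { rewrite <- pochhammer_add. f_equal. lia. }
  rewrite E1, E2, E3, <- (pochhammer_double a k), <- pochhammer_shifted_fact.
  assert (P : no_pole (p + q)) by (rewrite <- RtoC_plus; apply no_pole_pos; lra).
  pose proof (pochhammer_neq_0 _ (2 * k) P). pose proof (pochhammer_neq_0 _ j (no_pole_shift _ (2 * k) P)).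
  pose proof (pochhammer_neq_0 _ (k + j) (no_pole_pos p Hp)).
  pose proof (fact_C_neq_0 k). pose proof (fact_C_neq_0 j). pose proof (Cpow_nz 4 k H4).
  assert (Hf : pochhammer (INR (k + j) + 1 - INR k) k <> 0).
  { intros E. pose proof (pochhammer_shifted_fact j k) as Q. rewrite E, Cmult_0_l in Q.
    apply (fact_C_neq_0 (k + j)). now symmetry. }
  field. repeat split; assumption.
Qed.

(** * Integration of the Koebe composite against a Jacobi polynomial *)

(** The local radius is made to control the local bound as well, so that one uniform radius from
    compactness yields one bound. *)
Lemma bounded_2d (f : R -> R -> C) (a b a' b' : R) :
  (forall u v, a <= u <= b -> a' <= v <= b' -> exists d, 0 < d /\
     forall x y, Rabs (x - u) < d -> Rabs (y - v) < d -> Cmod (f x y) <= / d) ->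
  exists M, forall x y, a <= x <= b -> a' <= y <= b' -> Cmod (f x y) <= M.
Proof.
  intros H.
  assert (H' : forall u v, exists d : posreal, a <= u <= b -> a' <= v <= b' ->
     forall x y, Rabs (x - u) < d -> Rabs (y - v) < d -> Cmod (f x y) <= / d).
  { intros u v. destruct (classic (a <= u <= b /\ a' <= v <= b')) as [[Hu Hv]|Hn].
    - destruct (H u v Hu Hv) as (d & Hd & E). exists (mkposreal d Hd). intros _ _. exact E.
    - exists (mkposreal 1 Rlt_0_1). tauto. }
  set (delta := fun u v => proj1_sig (constructive_indefinite_description _ (H' u v))).
  assert (Hdelta : forall u v, a <= u <= b -> a' <= v <= b' ->
     forall x y, Rabs (x - u) < delta u v -> Rabs (y - v) < delta u v -> Cmod (f x y) <= / delta u v).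
  { intros u v. unfold delta. destruct constructive_indefinite_description. simpl. assumption. }
  destruct (compactness_value_2d a b a' b' delta) as [d Hd]. exists (/ d). intros x y Hx Hy.
  apply NNPP. intros Hn. apply (Hd x y Hx Hy). intros (u & v & Hu & Hv & H1 & H2 & H3). apply Hn.
  eapply Rle_trans; [apply (Hdelta u v Hu Hv x y H1 H2)|].
  apply Rinv_le_contravar; [apply cond_pos|exact H3].
Qed.

Lemma koebe_composite_bounded (F : C -> C) (b : C) (q : R) : 0 < q < 1 ->
  (forall z, hyp2F1_domain z -> cdiff F z) ->
  exists M, forall s t, 0 <= s <= 1 -> 0 <= t <= 2 * PI ->
    Cmod (Cpower (1 + q * cis t) (- b) * F (s * koebe (q * cis t)))%C <= M.
Proof.
  intros Hq HF.
  assert (Hin : forall t, Cmod (q * cis t) < 1) by (intros; rewrite Cmod_mult, Cmod_cis, Cmod_R, Rabs_pos_eq; lra).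
  assert (Hc : forall t, rcont (fun t => q * cis t)%C t) by (intros; apply rcont_mult; [apply rcont_const|apply rcont_cis1]).
  apply (bounded_2d (fun s t => Cpower (1 + q * cis t) (- b) * F (s * koebe (q * cis t)))%C).
  intros s0 t0 Hs0 Ht0. set (k0 := koebe (q * cis t0)).
  destruct (HF _ (koebe_domain _ s0 (Hin t0) Hs0)) as [l Hl]. fold k0 in Hl.
  destruct (sdiff_ccont _ _ _ Hl 1 Rlt_0_1) as (d1 & Hd1 & H1).
  assert (Rk : rcont (fun t => koebe (q * cis t)) t0).
  { apply (rcont_comp (fun t => q * cis t)%C koebe); [apply Hc|].
    destruct (koebe_cdiff _ (Hin t0)) as [m Hm]. eapply sdiff_ccont, Hm. }
  assert (Rp : rcont (fun t => Cpower (1 + q * cis t) (- b)) t0).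
  { apply (rcont_comp (fun t => 1 + q * cis t)%C (fun x => Cpower x (- b))).
    - apply rcont_plus; [apply rcont_const|apply Hc].
    - eapply sdiff_ccont, sdiff_Cpower, slit_Re_pos, disc_Re_pos_plus, Hin. }
  destruct (Rk (d1 / 4) ltac:(lra)) as (d2 & Hd2 & H2). fold k0 in H2.
  destruct (Rp 1 Rlt_0_1) as (d3 & Hd3 & H3).
  set (A := Cmod (Cpower (1 + q * cis t0) (- b)) + 1) in *. set (B := Cmod (F (s0 * k0)%C) + 1).
  assert (HA : 0 < A) by (unfold A; pose proof (Cmod_ge_0 (Cpower (1 + q * cis t0) (- b))); lra).
  assert (HB : 0 < B) by (unfold B; pose proof (Cmod_ge_0 (F (s0 * k0)%C)); lra).
  pose proof (Cmod_ge_0 k0) as Nk.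
  set (d := Rmin (Rmin (Rmin 1 (d1 / (4 * (Cmod k0 + 1)))) (Rmin d2 d3)) (/ (A * B))).
  assert (HAB : 0 < / (A * B)) by (apply Rinv_0_lt_compat; nra).
  assert (Hd4 : 0 < d1 / (4 * (Cmod k0 + 1))) by (apply Rdiv_lt_0_compat; lra).
  assert (Hdd : 0 < d /\ d <= 1 /\ d <= d1 / (4 * (Cmod k0 + 1)) /\ d <= d2 /\ d <= d3 /\ d <= / (A * B)).
  { unfold d. repeat split; unfold Rmin; repeat destruct Rle_dec; lra. }
  exists d. split; [lra|]. intros s t Hs Ht.
  specialize (H2 t ltac:(lra)). specialize (H3 t ltac:(lra)).
  apply Rle_trans with (A * B).
  - rewrite Cmod_mult. apply Rmult_le_compat; try apply Cmod_ge_0.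
    + replace (Cpower (1 + q * cis t) (- b))
        with ((Cpower (1 + q * cis t) (- b) - Cpower (1 + q * cis t0) (- b)) + Cpower (1 + q * cis t0) (- b))%C by ring.
      eapply Rle_trans; [apply Cmod_triangle|]. unfold A. lra.
    + specialize (H1 (s * koebe (q * cis t))%C).
      replace (F (s * koebe (q * cis t))%C) with ((F (s * koebe (q * cis t))%C - F (s0 * k0)%C) + F (s0 * k0)%C)%C by ring.
      eapply Rle_trans; [apply Cmod_triangle|]. unfold B.
      assert (Hdist : Cmod (s * koebe (q * cis t) - s0 * k0) < d1); [|specialize (H1 Hdist); lra].
      replace (s * koebe (q * cis t) - s0 * k0)%C with (s * (koebe (q * cis t) - k0) + RtoC (s - s0) * k0)%C
        by (rewrite RtoC_minus; ring).
      eapply Rle_lt_trans; [apply Cmod_triangle|]. rewrite !Cmod_mult, !Cmod_R.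
      assert (Hs2 : Rabs s <= 2).
      { replace s with ((s - s0) + s0) by ring. eapply Rle_trans; [apply Rabs_triang|].
        rewrite (Rabs_pos_eq s0) by lra. lra. }
      assert (Rabs s * Cmod (koebe (q * cis t) - k0) <= 2 * (d1 / 4)).
      { apply Rmult_le_compat; try apply Cmod_ge_0; try apply Rabs_pos; lra. }
      assert (Rabs (s - s0) * Cmod k0 <= d1 / (4 * (Cmod k0 + 1)) * (Cmod k0 + 1)).
      { apply Rmult_le_compat; try apply Cmod_ge_0; try apply Rabs_pos; lra. }
      replace (d1 / (4 * (Cmod k0 + 1)) * (Cmod k0 + 1)) with (d1 / 4) in * by (field; lra). lra.
  - rewrite <- (Rinv_inv (A * B)). apply Rinv_le_contravar; lra.
Qed.

Lemma rcont_half (x : R) : rcont (fun x => (1 + x) / 2)%C x.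
Proof.
  apply (rcont_ext (fun x => / 2 + / 2 * x)%C); [intros; field|].
  apply rcont_plus; [apply rcont_const|]. apply rcont_mult; [apply rcont_const|apply rcont_RtoC].
Qed.

Lemma rcont_csum (f : nat -> R -> C) (n : nat) (x : R) : (forall k, rcont (f k) x) -> rcont (fun x => csum (fun k => f k x) n) x.
Proof.
  intros H. induction n as [|n IH].
  - apply (rcont_ext (f O)); [intros; now rewrite csum_0|apply H].
  - apply (rcont_ext (fun x => csum (fun k => f k x) n + f (S n) x)%C); [intros; now rewrite csum_S|].
    apply rcont_plus; [exact IH|apply H].
Qed.

Lemma rcont_jacobiP (k : nat) (a b : C) (x : R) : rcont (fun x => jacobiP k a b x) x.
Proof.
  unfold jacobiP. apply rcont_mult; [apply rcont_const|].
  apply (rcont_csum (fun j x => hyp2F1_coef (- INR k) (INR k + a + b + 1) (a + 1) j * ((1 - x) / 2) ^ j)%C).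
  intros j. apply rcont_mult; [apply rcont_const|]. apply rcont_pow.
  apply (rcont_ext (fun x => / 2 + (- / 2) * x)%C); [intros; field|].
  apply rcont_plus; [apply rcont_const|]. apply rcont_mult; [apply rcont_const|apply rcont_RtoC].
Qed.

(** For every rho in the unit disc the composite with the Koebe map is a power series in rho whose
    coefficients are polynomials in the integration variable, bounded uniformly by Cauchy's
    estimate; integrating it termwise multiplies the coefficients of F by the moments. *)
Lemma koebe_jacobi_integral (k : nat) (beta gamma : R) (b rho : C) (f : nat -> C) (F H : C -> C) :
  -1 < beta -> -1 < gamma -> Cmod rho < 1 ->
  power_series_on 1 f F -> (forall z, hyp2F1_domain z -> cdiff F z) ->
  power_series_on 1 (fun m => f m * jacobi_moment k (beta + 1) (gamma + 1) m)%C H ->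
  (forall z, hyp2F1_domain z -> cdiff H z) ->
  impint (fun x => jweight (beta + 1) (gamma + 1) x *
             (Cpower (1 + rho) (- b) * F (RtoC ((1 + x) / 2) * koebe rho) * jacobiP k gamma beta x))%C
    (Cpower (1 + rho) (- b) * H (koebe rho)).
Proof.
  intros Hb Hg Hrho Hf HF Hh HH.
  set (q := (1 + Cmod rho) / 2). pose proof (Cmod_ge_0 rho) as Nr.
  assert (Hq : 0 < q < 1) by (unfold q; lra). assert (Hrq : Cmod rho < q) by (unfold q; lra).
  destruct (koebe_composite_bounded F b q Hq HF) as [M0 HM0].
  set (M := Rmax M0 0). assert (HM : 0 <= M) by apply Rmax_r.
  assert (Hcoef : forall s n, 0 <= s <= 1 -> Cmod (moebius_coef f (s * 4) b (-1) 2 n) <= M / q ^ n).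
  { intros s n Hs. set (g := fun t => (Cpower (1 + t) (- b) * F (s * koebe t))%C).
    destruct (taylor_unit_disc g) as (a & Ha & Ia).
    { intros t Ht. now apply koebe_composite_cdiff. }
    rewrite <- (power_series_unique 1 a _ g Rlt_0_1 Ha (koebe_series F f b s Hs Hf HF) n).
    apply (cauchy_estimate (a n) g q M n (proj1 Hq) (Ia q n Hq)).
    intros t Ht. eapply Rle_trans; [apply HM0; assumption|apply Rmax_l]. }
  destruct (rcont_bounded (fun x => jacobiP k gamma beta x) (-1) 1 ltac:(lra)) as (P & HP & HPb).
  { intros x _. apply rcont_jacobiP. }
  set (u := Cmod rho / q).
  assert (Hu : 0 <= u < 1) by (unfold u; split; [apply Rdiv_le_0_compat; lra|apply Rlt_div_l; lra]).
  set (an := fun (x : R) n => (moebius_coef f (RtoC ((1 + x) / 2) * 4) b (-1) 2 n * rho ^ n)%C).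
  assert (Hhalf : forall x, -1 < x < 1 -> 0 <= (1 + x) / 2 <= 1) by (intros; lra).
  apply (impint_uniform_limit (beta + 1) (gamma + 1) (jacobi_mass (beta + 1) (gamma + 1))
          (fun x => Cpower (1 + rho) (- b) * F (RtoC ((1 + x) / 2) * koebe rho) * jacobiP k gamma beta x)%C
          (fun N x => csum (an x) N * jacobiP k gamma beta x)%C
          (fun N => M * u ^ S N / (1 - u) * P)
          (fun N => csum (fun n => moebius_coef (fun m => f m * jacobi_moment k (beta + 1) (gamma + 1) m) (1 * 4) b (-1) 2 n * rho ^ n)%C N)).
  - apply jacobi_mass_spec; lra.
  - intros x Hx. apply rcont_mult; [|apply rcont_jacobiP]. apply rcont_mult; [apply rcont_const|].
    apply (rcont_comp (fun x => RtoC ((1 + x) / 2) * koebe rho)%C F).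
    + apply rcont_mult; [|apply rcont_const].
      apply (rcont_ext (fun x => (1 + x) / 2)%C); [|apply rcont_half].
      intros s. rewrite RtoC_div, RtoC_plus by lra. reflexivity.
    + destruct (HF _ (koebe_domain rho ((1 + x) / 2) Hrho (Hhalf x Hx))) as [l Hl]. eapply sdiff_ccont, Hl.
  - intros N x Hx. specialize (Hhalf x Hx).
    pose proof (koebe_series F f b _ Hhalf Hf HF rho Hrho) as S. cbv beta in S.
    replace (Cpower (1 + rho) (- b) * F (RtoC ((1 + x) / 2) * koebe rho) * jacobiP k gamma beta x
             - csum (an x) N * jacobiP k gamma beta x)%C
      with (- (csum (an x) N - Cpower (1 + rho) (- b) * F (RtoC ((1 + x) / 2) * koebe rho)) * jacobiP k gamma beta x)%C by ring.
    rewrite Cmod_mult, Cmod_opp.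
    apply Rmult_le_compat; try apply Cmod_ge_0; [|apply HPb; lra].
    apply cser_tail; [exact Hu|exact HM| |exact S].
    intros n _. unfold an. rewrite Cmod_mult, Cmod_pow.
    replace (M * u ^ n) with (M / q ^ n * Cmod rho ^ n).
    + apply Rmult_le_compat_r; [apply pow_le, Cmod_ge_0|]. now apply Hcoef.
    + unfold u, Rdiv. rewrite Rpow_mult_distr, pow_inv. ring.
  - replace (Finite 0) with (Finite (M * 0 / (1 - u) * P)) by (f_equal; field; lra).
    apply is_lim_seq_mult'; [|apply is_lim_seq_const]. apply is_lim_seq_mult'; [|apply is_lim_seq_const].
    apply is_lim_seq_mult'; [apply is_lim_seq_const|].
    apply (is_lim_seq_incr_1 (fun n => u ^ n)). apply is_lim_seq_geom. rewrite Rabs_pos_eq; lra.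
  - intros N.
    assert (Hn : forall n, impint (fun x => jweight (beta + 1) (gamma + 1) x * (an x n * jacobiP k gamma beta x))%C
       (moebius_coef (fun m => f m * jacobi_moment k (beta + 1) (gamma + 1) m) (1 * 4) b (-1) 2 n * rho ^ n)%C).
    { intros n. unfold moebius_coef. rewrite Cmult_comm, <- csum_scal.
      pose proof (impint_csum (fun m x => (rho ^ n * (f m * 4 ^ m * (pochhammer (b + INR 2 * INR m) (n - m) / INR (fact (n - m)) * (-1) ^ (n - m))))
              * (jweight (beta + 1) (gamma + 1) x * (((1 + x) / 2) ^ m * jacobiP k gamma beta x)))%C _ n
              (fun m => impint_scal _ _ _ (impint_jacobi_moment k m beta gamma Hb Hg))) as S.
      cbv beta in S.
      erewrite csum_ext_le; [eapply impint_ext; [|exact S]|].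
      - intros x Hx. cbv beta. unfold an, moebius_coef.
        transitivity (rho ^ n * (jweight (beta + 1) (gamma + 1) x * jacobiP k gamma beta x) *
           csum (fun m => f m * (RtoC ((1 + x) / 2) * 4) ^ m *
             (pochhammer (b + INR 2 * INR m) (n - m) / INR (fact (n - m)) * (-1) ^ (n - m)))%C n)%C; [|ring].
        rewrite <- csum_scal. apply csum_ext_le. intros m _.
        rewrite Cpow_mult_l. replace (RtoC ((1 + x) / 2)) with ((1 + x) / 2)%C by (rewrite RtoC_div, RtoC_plus by lra; reflexivity).
        ring.
      - intros m _. cbv beta. replace (1 * 4)%C with (RtoC 4) by ring. ring. }
    eapply impint_ext; [|apply (impint_csum _ _ N Hn)]. intros x Hx. cbv beta.
    rewrite Cmult_assoc, (Cmult_comm (jweight _ _ _)), <- Cmult_assoc, Cmult_comm, <- csum_scal.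
    apply csum_ext_le. intros n _. ring.
  - pose proof (koebe_series H _ b 1 ltac:(lra) Hh HH rho Hrho) as S. cbv beta in S.
    rewrite (Cmult_1_l (koebe rho)) in S. apply cser_eps. exact S.
Qed.

Lemma rgamma_S (x : R) : 0 < x -> rgamma (x + 1) = x * rgamma x.
Proof.
  intros Hx.
  assert (L : is_lim_seq (fun n => gamma_seq x n * (x * (1 - (x + 1) * / (INR n + (x + 1))))) (rgamma x * (x * (1 - (x + 1) * 0)))).
  { apply is_lim_seq_mult'; [now apply rgamma_lim|]. apply is_lim_seq_mult'; [apply is_lim_seq_const|].
    apply is_lim_seq_minus'; [apply is_lim_seq_const|]. apply (is_lim_seq_scal_l _ (x + 1) 0).
    replace (Finite 0) with (Rbar_inv p_infty) by reflexivity.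
    apply is_lim_seq_inv; [|discriminate].
    eapply is_lim_seq_plus; [apply is_lim_seq_INR|apply is_lim_seq_const|reflexivity]. }
  assert (L2 : is_lim_seq (gamma_seq (x + 1)) (rgamma x * (x * (1 - (x + 1) * 0)))).
  { eapply is_lim_seq_ext_loc; [|exact L]. exists 1%nat. intros n Hn. unfold gamma_seq.
    assert (Hn0 : 0 < INR n) by (apply lt_0_INR; lia).
    pose proof (rpoch_pos (x + 1) n ltac:(lra)).
    rewrite (rpoch_S_l x n), Rpower_plus, Rpower_1 by exact Hn0. simpl (rpoch (x + 1) (S n)).
    field. lra. }
  pose proof (rgamma_lim (x + 1) ltac:(lra)) as L3.
  apply is_lim_seq_unique in L2, L3. rewrite L2 in L3. injection L3 as L3. lra.
Qed.

Lemma rgamma_add_nat (x : R) (n : nat) : 0 < x -> rgamma (x + INR n) = rpoch x n * rgamma x.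
Proof.
  intros Hx. induction n as [|n IH].
  - simpl. rewrite Rplus_0_r. ring.
  - pose proof (pos_INR n). rewrite S_INR. replace (x + (INR n + 1)) with (x + INR n + 1) by ring.
    rewrite rgamma_S, IH by lra. simpl. ring.
Qed.

(** * The uniformizing parameter of the Legendre functions *)

(** K(t) |1+t|^4 = 4 t conj(1+t)^2; hence inside the disc K preserves the sign of the imaginary
    part. *)
Lemma koebe_Im (t : C) : (1 + t)%C <> 0 ->
  Im (koebe t) * (Cmod (1 + t) * Cmod (1 + t) * (Cmod (1 + t) * Cmod (1 + t))) = 4 * Im t * (1 - Cmod t * Cmod t).
Proof.
  intros Hne.
  assert (E : (koebe t * RtoC (Cmod (1 + t) * Cmod (1 + t) * (Cmod (1 + t) * Cmod (1 + t))))%C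
            = (4 * t * (Cconj (1 + t) * Cconj (1 + t)))%C).
  { assert (H : RtoC (Cmod (1 + t) * Cmod (1 + t)) = ((1 + t) * Cconj (1 + t))%C).
    { rewrite <- Cmod2_conj. f_equal. ring. }
    rewrite RtoC_mult, H. unfold koebe. field. exact Hne. }
  apply (f_equal Im) in E. rewrite im_scal_r in E. rewrite E, (Cmod_sqr t). destruct t as [a b]. simpl. ring.
Qed.

Lemma koebe_slit (t : C) : Cmod t < 1 -> slit t -> slit (koebe t).
Proof.
  intros Ht Hs [H1 H2]. pose proof (disc_Re_pos_plus t Ht) as Hp.
  pose proof (slit_neq_0 _ (slit_Re_pos _ Hp)) as Hne.
  pose proof (koebe_Im t Hne) as E. rewrite H1, Rmult_0_l in E. pose proof (Cmod_ge_0 t) as N.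
  assert (Ht0 : Im t = 0).
  { symmetry in E. apply Rmult_integral in E. destruct E as [E|E]; [lra|nra]. }
  apply Hs. split; [exact Ht0|].
  assert (Et : t = RtoC (Re t)) by (apply C_ext; [reflexivity|exact Ht0]).
  set (a := Re t) in *. rewrite Et in Hp. simpl in Hp.
  assert (Ek : koebe t = RtoC (4 * a / ((1 + a) * (1 + a)))).
  { rewrite Et. unfold koebe. rewrite RtoC_div, !RtoC_mult, !RtoC_plus by nra. reflexivity. }
  rewrite Ek, re_RtoC in H2.
  destruct (Rle_or_lt a 0); [assumption|exfalso].
  assert (0 < 4 * a / ((1 + a) * (1 + a))) by (apply Rdiv_lt_0_compat; nra). lra.
Qed.

Lemma koebe_slit_inv (t : C) : slit (koebe t) -> Cmod t < 1 -> slit t.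
Proof.
  intros Hk Ht [H1 H2]. apply Hk.
  pose proof (disc_Re_pos_plus t Ht) as Hp.
  assert (Et : t = RtoC (Re t)) by (apply C_ext; [reflexivity|exact H1]).
  set (a := Re t) in *. rewrite Et in Hp. simpl in Hp.
  assert (Ek : koebe t = RtoC (4 * a / ((1 + a) * (1 + a)))).
  { rewrite Et. unfold koebe. rewrite RtoC_div, !RtoC_mult, !RtoC_plus by nra. reflexivity. }
  rewrite Ek. split; [reflexivity|]. rewrite re_RtoC. apply Rle_div_l; nra.
Qed.

Lemma Carg_real_pos (z : C) : Im z = 0 -> 0 < Re z -> Carg z = 0.
Proof.
  intros H1 H2. assert (E : z = RtoC (Re z)) by (apply C_ext; [reflexivity|exact H1]).
  change (Carg z) with (Im (Cln z)). rewrite E, Cln_RtoC by exact H2. reflexivity.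
Qed.

(** In the disc arg t - 2 arg (1 + t) never leaves (-pi, pi), so the logarithm of the Koebe map
    splits without correction. *)
Lemma Cln_koebe (t : C) : Cmod t < 1 -> slit t -> Cln (koebe t) = (ln 4 + Cln t - 2 * Cln (1 + t))%C.
Proof.
  intros Ht Hs. pose proof (disc_Re_pos_plus t Ht) as Hp. pose proof PI_RGT_0.
  pose proof (slit_neq_0 _ (slit_Re_pos _ Hp)) as Hne. pose proof (slit_neq_0 t Hs) as Ht0.
  apply Cln_unique.
  - replace (Im (ln 4 + Cln t - 2 * Cln (1 + t))) with (Carg t - 2 * Carg (1 + t))
      by (unfold Cminus; rewrite !im_plus, im_opp, im_scal_l; simpl; ring).
    pose proof (Carg_Re_pos _ Hp) as A1.
    destruct (Rtotal_order (Im t) 0) as [H0|[H0|H0]].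
    + pose proof (Carg_Im_neg t H0). pose proof (Carg_Im_neg (1 + t)) as A2.
      rewrite im_plus in A2. simpl (Im 1) in A2. lra.
    + assert (Hre : 0 < Re t) by (destruct (Rle_or_lt (Re t) 0); [exfalso; apply Hs; auto|assumption]).
      rewrite (Carg_real_pos t H0 Hre), (Carg_real_pos (1 + t)); [lra| |exact Hp].
      rewrite im_plus, H0. simpl. ring.
    + pose proof (Carg_Im_pos t H0). pose proof (Carg_Im_pos (1 + t)) as A2.
      rewrite im_plus in A2. simpl (Im 1) in A2. lra.
  - replace (ln 4 + Cln t - 2 * Cln (1 + t))%C with (ln 4 + Cln t + (- Cln (1 + t) + - Cln (1 + t)))%C by ring.
    rewrite !Cexp_plus, Cexp_opp, !Cexp_Cln by assumption.
    rewrite <- Cln_RtoC, Cexp_Cln by (lra || (apply RtoC_neq_0; lra)).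
    unfold koebe. field. exact Hne.
Qed.

Lemma cayley_disc (y : C) : 0 < Re y -> Cmod ((1 - y) / (1 + y)) < 1.
Proof.
  intros Hy.
  assert (Hne : (1 + y)%C <> 0).
  { apply slit_neq_0, slit_Re_pos. rewrite re_plus. simpl. lra. }
  pose proof (proj1 (Cmod_gt_0 _) Hne). rewrite Cmod_div by exact Hne. apply Rlt_div_l; [lra|].
  pose proof (Cmod_sqr (1 - y)) as A. pose proof (Cmod_sqr (1 + y)) as B. pose proof (Cmod_ge_0 (1 - y)).
  unfold Cminus in *. rewrite !re_plus, !im_plus, ?re_opp, ?im_opp in *. simpl (Re 1) in *. simpl (Im 1) in *.
  nra.
Qed.

Lemma Re_mult_pos (p y : C) : p <> 0 -> y <> 0 -> - (PI / 2) < Carg p + Carg y < PI / 2 -> 0 < Re (p * y).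
Proof.
  intros Hp Hy H. rewrite <- (Cexp_Cln p Hp), <- (Cexp_Cln y Hy), <- Cexp_plus.
  unfold Cexp, Cln; simpl. apply Rmult_lt_0_compat; [apply exp_pos|]. apply cos_gt_0; lra.
Qed.

(** With y^2 = 1 - s K(rho), where K is the Koebe map, the square root R of the
    generating function is (1 + rho) y: the arguments of 1 + rho and y have opposite signs, so their sum stays below pi/2. *)
Lemma generating_root (rho : C) (s : R) : Cmod rho < 1 -> slit rho -> 0 <= s <= 1 ->
  let y := Csqrt (1 - koebe rho * s) in
  (y * y)%C = (1 - koebe rho * s)%C /\ 0 < Re y /\ 0 < Re ((1 + rho) * y) /\
  Csqrt (1 + rho ^ 2 - 2 * rho * (2 * s - 1)%R) = ((1 + rho) * y)%C.
Proof.
  intros Hr Hs Hs01 y. pose proof (disc_Re_pos_plus rho Hr) as Hp.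
  pose proof (slit_neq_0 _ (slit_Re_pos _ Hp)) as Hne.
  assert (Hdom : hyp2F1_domain (koebe rho)).
  { replace (koebe rho) with (1 * koebe rho)%C by ring. apply (koebe_domain rho 1 Hr). lra. }
  pose proof (domain_slit _ s Hdom Hs01) as Hsl.
  assert (Hyy : (y * y)%C = (1 - koebe rho * s)%C) by (apply Csqrt_sqr, slit_neq_0, Hsl).
  assert (Hy : 0 < Re y) by (apply Csqrt_Re_pos, Hsl).
  destruct (Csqrt_arg _ Hsl) as [Hy0 Hya]. fold y in Hy0, Hya.
  assert (Hpy : 0 < Re ((1 + rho) * y)).
  { destruct (Req_dec (Im rho) 0) as [H0|H0].
    - rewrite re_mult, im_plus, H0. simpl (Im 1). rewrite Rplus_0_l, Rmult_0_l, Rminus_0_r. nra.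
    - apply Re_mult_pos; [exact Hne|exact Hy0|].
      pose proof (Carg_Re_pos _ Hp) as A1. pose proof (Carg_Re_pos _ Hy) as A2.
      pose proof (koebe_Im rho Hne) as E. pose proof (Cmod_ge_0 rho) as N.
      pose proof (proj1 (Cmod_gt_0 _) Hne) as M.
      set (m4 := Cmod (1 + rho) * Cmod (1 + rho) * (Cmod (1 + rho) * Cmod (1 + rho))) in *.
      assert (Hm4 : 0 < m4) by (unfold m4; repeat apply Rmult_lt_0_compat; lra).
      assert (Hr2 : 0 < 1 - Cmod rho * Cmod rho) by nra.
      assert (Him : Im (1 - koebe rho * s) = - (Im (koebe rho) * s)).
      { unfold Cminus. rewrite im_plus, im_opp, im_scal_r. simpl (Im 1). ring. }
      destruct (Req_dec s 0) as [Hs0|Hs0].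
      + assert (Hy00 : Carg y = 0).
        { rewrite Hya. rewrite Carg_real_pos; [field| |].
          - rewrite Him, Hs0. ring.
          - unfold Cminus. rewrite re_plus, re_opp, re_scal_r, Hs0. simpl. lra. }
        lra.
      + destruct (Rtotal_order (Im rho) 0) as [Hi|[Hi|Hi]]; [|lra|].
        * assert (Hk : Im (koebe rho) < 0) by nra.
          pose proof (Carg_Im_neg (1 + rho)) as B1. rewrite im_plus in B1. simpl (Im 1) in B1.
          pose proof (Carg_Im_pos (1 - koebe rho * s)) as B2. rewrite Him in B2. specialize (B2 ltac:(nra)). lra.
        * assert (Hk : 0 < Im (koebe rho)) by nra.
          pose proof (Carg_Im_pos (1 + rho)) as B1. rewrite im_plus in B1. simpl (Im 1) in B1.
          pose proof (Carg_Im_neg (1 - koebe rho * s)) as B2. rewrite Him in B2. specialize (B2 ltac:(nra)). lra. }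
  repeat split; try assumption.
  rewrite <- Csqrt_of_sqr by exact Hpy. f_equal.
  replace ((1 + rho) * y * ((1 + rho) * y))%C with ((1 + rho) * (1 + rho) * (y * y))%C by ring.
  rewrite Hyy. unfold koebe. rewrite RtoC_minus, RtoC_mult. field. exact Hne.
Qed.

Lemma legendreP_disc (nu a t : C) (c : R) : 0 < c -> Cmod t < 1 -> slit t ->
  is_hyp2F1 (1 + a - c) (c - a) c (hyp2F1 (- nu) (nu + 1) c) ->
  legendreP nu (1 - c) ((1 + t) / (1 - t))
  = (/ Cgamma c * Cpower t ((c - 1) / 2)
     * (Cpower (1 - t) (1 + a - c) * Cpower (1 + t) (- a) * hyp2F1 (a / 2) ((a + 1) / 2) c (koebe t)))%C.
Proof.
  intros Hc Ht Hs HF. pose proof (slit_neq_0 _ (slit_Re_pos _ (disc_Re_pos t Ht))) as Hne.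
  pose proof (slit_neq_0 t Hs) as Ht0.
  unfold legendreP. replace (1 - (1 - c))%C with (RtoC c) by ring.
  assert (E1 : (((1 + t) / (1 - t) + 1) / ((1 + t) / (1 - t) - 1))%C = (/ t)%C).
  { field. repeat split; auto. replace (1 + t - (1 - t))%C with (2 * t)%C by ring.
    apply Cmult_neq_0; [apply RtoC_neq_0; lra|exact Ht0]. }
  assert (E2 : ((1 - (1 + t) / (1 - t)) / 2)%C = (- t / (1 - t))%C) by (field; exact Hne).
  rewrite E1, E2.
  pose proof (no_pole_pos c Hc) as Pc.
  rewrite (quadratic_transformation a c t _ _ Pc Ht HF (hyp2F1_spec _ _ _ Pc)).
  assert (E3 : Cpower (/ t) ((1 - c) / 2) = Cpower t ((c - 1) / 2)).
  { unfold Cpower. rewrite (Cln_inv t Hs). f_equal. field. }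
  rewrite E3. reflexivity.
Qed.

(** At x = 2s - 1 the Legendre factor is evaluated through t with K(t) = s K(rho); all branch
    factors combine to powers of 1 + rho, rho and s. *)
Lemma generating_function (alpha rho : C) (beta s : R) : -1 < beta -> Cmod rho < 1 -> slit rho -> 0 < s < 1 ->
  let r := Csqrt (1 + rho ^ 2 - 2 * rho * (2 * s - 1)%R) in
  (/ Cpower r (alpha + 1) * legendreP alpha (- beta) ((1 + rho) / r))%C
  = (/ Cgamma (beta + 1)%R * Cpower rho (beta / 2) * RtoC (Rpower s (beta / 2)) *
     (Cpower (1 + rho) (- (alpha + beta + 1)) *
      hyp2F1 ((alpha + beta + 1) / 2) ((alpha + beta + 1 + 1) / 2) (beta + 1)%R (s * koebe rho)))%C.
Proof.
  intros Hb Hr Hs Hs01 r.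
  destruct (generating_root rho s Hr Hs ltac:(lra)) as (Hyy & Hy & Hpy & Er). fold r in Er.
  set (y := Csqrt (1 - koebe rho * s)) in *.
  set (c := beta + 1). set (a := (alpha + beta + 1)%C).
  assert (Hc : 0 < c) by (unfold c; lra).
  pose proof (disc_Re_pos_plus rho Hr) as Hp1. pose proof (slit_neq_0 _ (slit_Re_pos _ Hp1)) as Hp0.
  set (t := ((1 - y) / (1 + y))%C).
  assert (Ht : Cmod t < 1) by (now apply cayley_disc).
  assert (Hy1 : (1 + y)%C <> 0) by (apply slit_neq_0, slit_Re_pos; rewrite re_plus; simpl (Re 1); lra).
  assert (Hy0 : y <> 0) by (apply slit_neq_0, slit_Re_pos, Hy).
  assert (H2 : RtoC 2 <> 0) by (apply RtoC_neq_0; lra).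
  assert (Hkt : koebe t = (s * koebe rho)%C).
  { replace (s * koebe rho)%C with (1 - y * y)%C by (rewrite Hyy; ring). unfold koebe, t. field.
    split; [exact Hy1|]. replace (1 + y + (1 - y))%C with (RtoC 2) by ring. exact H2. }
  pose proof (koebe_slit rho Hr Hs) as Hks.
  assert (Hkts : slit (koebe t)).
  { rewrite Hkt. intros [H3 H4]. rewrite im_scal_l in H3. rewrite re_scal_l in H4.
    apply Hks. apply Rmult_integral in H3. split; [lra|nra]. }
  pose proof (koebe_slit_inv t Hkts Ht) as Hts.
  pose proof (disc_Re_pos t Ht) as Hm1. pose proof (disc_Re_pos_plus t Ht) as Ht1.
  pose proof (slit_neq_0 _ (slit_Re_pos _ Hm1)) as Hm0. pose proof (slit_neq_0 _ (slit_Re_pos _ Ht1)) as Ht0.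
  pose proof (Carg_Re_pos _ Hm1) as Am. pose proof (Carg_Re_pos _ Ht1) as At.
  pose proof (Carg_Re_pos _ Hp1) as Ap. pose proof (Carg_Re_pos _ Hy) as Ay.
  assert (Ey : y = ((1 - t) / (1 + t))%C).
  { unfold t. field. split; [exact Hy1|]. replace (1 + y + (1 - y))%C with (RtoC 2) by ring. exact H2. }
  assert (Ly : Cln y = (Cln (1 - t) - Cln (1 + t))%C).
  { apply Cln_unique; [simpl; lra|]. unfold Cminus at 1. rewrite Cexp_plus, Cexp_opp, !Cexp_Cln by assumption.
    rewrite Ey. reflexivity. }
  assert (Lr : Cln r = (Cln (1 + rho) + (Cln (1 - t) - Cln (1 + t)))%C).
  { rewrite Er, <- Ly. apply Cln_mult; [exact Hp0|exact Hy0|lra]. }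
  assert (Lt : (Cln t - 2 * Cln (1 + t))%C = (ln s + (Cln rho - 2 * Cln (1 + rho)))%C).
  { pose proof (Cln_koebe t Ht Hts) as K1. rewrite Hkt, Cln_scal, (Cln_koebe rho Hr Hs) in K1;
      [|lra|apply slit_neq_0, Hks].
    replace (Cln t - 2 * Cln (1 + t))%C with ((ln 4 + Cln t - 2 * Cln (1 + t)) - ln 4)%C by ring.
    rewrite <- K1. ring. }
  assert (Ez : ((1 + rho) / r)%C = ((1 + t) / (1 - t))%C).
  { rewrite Er. rewrite Ey. field. repeat split; assumption. }
  rewrite Ez. replace (- beta)%C with (1 - RtoC c)%C by (unfold c; rewrite RtoC_plus; ring).
  assert (Ha1 : (1 + a - c)%C = (alpha + 1)%C) by (unfold a, c; rewrite RtoC_plus; ring).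
  assert (Ha2 : (c - a)%C = (- alpha)%C) by (unfold a, c; rewrite RtoC_plus; ring).
  rewrite (legendreP_disc alpha a t c Hc Ht Hts); [|rewrite Ha1, Ha2; apply is_hyp2F1_sym, hyp2F1_spec, no_pole_pos, Hc].
  rewrite Ha1, Hkt. fold c.
  replace (RtoC c - 1)%C with (RtoC beta) by (unfold c; rewrite RtoC_plus; ring).
  set (Fv := hyp2F1 (a / 2) ((a + 1) / 2) c (s * koebe rho)%C).
  assert (Hpow : (/ Cpower r (alpha + 1) * (Cpower t (beta / 2) * Cpower (1 - t) (alpha + 1) * Cpower (1 + t) (- a)))%C
               = (Cpower rho (beta / 2) * RtoC (Rpower s (beta / 2)) * Cpower (1 + rho) (- a))%C).
  { replace (RtoC (Rpower s (beta / 2))) with (Cpower s (beta / 2))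
      by (replace (beta / 2)%C with (RtoC (beta / 2)) by (now rewrite RtoC_div by lra); apply Cpower_pos_real; lra).
    unfold Cpower. rewrite Lr, Cln_RtoC, <- Cexp_opp, <- !Cexp_plus by lra. f_equal.
    replace (Cln t) with (2 * Cln (1 + t) + (ln s + (Cln rho - 2 * Cln (1 + rho))))%C by (rewrite <- Lt; ring).
    unfold a. field. }
  transitivity (/ Cgamma c * (/ Cpower r (alpha + 1) * (Cpower t (beta / 2) * Cpower (1 - t) (alpha + 1) * Cpower (1 + t) (- a))) * Fv)%C.
  - ring.
  - rewrite Hpow. ring.
Qed.

(** * The integral *)

Theorem corollary15 (k : nat) (alpha : C) (beta gamma : R) (rho : C)
  (hbeta : -1 < beta) (hgamma : -1 < gamma)
  (hbg : beta < 0 -> gamma < 0 -> beta + gamma + 1 <> 0)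
  (hrho1 : Cmod rho < 1)
  (hrho2 : ~ (Im rho = 0 /\ -1 < Re rho <= 0)) :
  is_RInt_gen (V := C_R_NormedModule)
    (fun x : R =>
       let r := Csqrt (1 + rho ^ 2 - 2 * rho * x)%C in
       (Rpower (1 + x) (beta / 2) * Rpower (1 - x) gamma
          / Cpower r (alpha + 1)
        * legendreP alpha (- beta) ((1 + rho) / r)
        * jacobiP k gamma beta x)%C)
    (at_right (-1)) (at_left 1)
    (Rpower 2 (gamma + beta / 2 + 1) * Cgamma (gamma + INR k + 1)
       * pochhammer (alpha + beta + 1) (2 * k)
     / (Cpower (1 - rho) (alpha - gamma) * Cpower rho ((gamma + 1) / 2) * INR (fact k))
     * legendreP (gamma - alpha) (- gamma - beta - 2 * INR k - 1)
         ((1 + rho) / (1 - rho)))%C.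
Proof.
  assert (Hs : slit rho).
  { intros [H1 H2]. apply hrho2. split; [exact H1|]. split; [|exact H2].
    pose proof (re_le_Cmod rho) as B. rewrite Rabs_left1 in B by exact H2. lra. }
  set (a := (alpha + beta + 1)%C). set (p := beta + 1). set (q := gamma + 1).
  assert (Hp : 0 < p) by (unfold p; lra). assert (Hq : 0 < q) by (unfold q; lra).
  pose proof (pos_INR k) as Nk. pose proof (pos_INR (2 * k)) as N2k.
  set (c := p + q + INR (2 * k)). assert (Hc : 0 < c) by (unfold c; lra).
  pose proof (no_pole_pos p Hp) as Pp. pose proof (no_pole_pos c Hc) as Pc.
  set (F := hyp2F1 (a / 2) ((a + 1) / 2) p).
  set (a' := (a + INR (2 * k))%C). set (Fc := hyp2F1 (a' / 2) ((a' + 1) / 2) c).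
  pose proof (hyp2F1_spec (a / 2) ((a + 1) / 2) p Pp) as HF. fold F in HF.
  pose proof (hyp2F1_spec (a' / 2) ((a' + 1) / 2) c Pc) as HFc. fold Fc in HFc.
  set (K := (jacobi_mass p q * (pochhammer q k / INR (fact k)) * (pochhammer a (2 * k) / (4 ^ k * pochhammer (p + q) (2 * k))))%C).
  set (H := fun z => (K * (z ^ k * Fc z))%C).
  assert (Int : impint (fun x => jweight p q x *
      (Cpower (1 + rho) (- a) * F (RtoC ((1 + x) / 2) * koebe rho) * jacobiP k gamma beta x))%C
      (Cpower (1 + rho) (- a) * H (koebe rho))).
  { apply (koebe_jacobi_integral k beta gamma a rho (hyp2F1_coef (a / 2) ((a + 1) / 2) p) F H hbeta hgamma hrho1).
    - now apply is_hyp2F1_series.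
    - intros z Hz. exact (is_hyp2F1_cdiff _ _ _ _ _ HF Hz).
    - intros z Hz. unfold H.
      eapply cser_ext; [|apply (cser_scal K _ _ (power_series_shift 1 k _ _ (is_hyp2F1_series _ _ _ _ HFc) z Hz))].
      intros m. cbv beta. fold p q. rewrite moment_series by assumption. fold K. unfold a', c.
      rewrite !RtoC_plus. ring.
    - intros z Hz. destruct (is_hyp2F1_cdiff _ _ _ _ _ HFc Hz) as [l Hl].
      assert (Hpow : forall n, cdiff (fun x => x ^ n)%C z).
      { induction n as [|n [m IH]]; [exists 0; apply (sdiff_const 1)|].
        eexists. apply (sdiff_mult (fun x => x) (fun x => x ^ n)%C); [apply sdiff_id|exact IH]. }
      destruct (Hpow k) as [m Hm]. eexists. unfold H.
      apply sdiff_mult; [apply sdiff_const|]. apply sdiff_mult; [exact Hm|exact Hl]. }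
  set (K1 := (RtoC (Rpower 2 (- (beta / 2))) * Cpower rho (beta / 2) * / Cgamma p)%C).
  apply impint_is_RInt_gen.
  replace (Rpower 2 (gamma + beta / 2 + 1) * Cgamma (gamma + INR k + 1) * pochhammer a (2 * k)
     / (Cpower (1 - rho) (alpha - gamma) * Cpower rho ((gamma + 1) / 2) * INR (fact k))
     * legendreP (gamma - alpha) (- gamma - beta - 2 * INR k - 1) ((1 + rho) / (1 - rho)))%C
    with (K1 * (Cpower (1 + rho) (- a) * H (koebe rho)))%C.
  - eapply impint_ext; [|exact (impint_scal K1 _ _ Int)]. intros x Hx. cbv beta zeta.
    set (s := (1 + x) / 2). assert (Hs01 : 0 < s < 1) by (unfold s; lra).
    pose proof (generating_function alpha rho beta s hbeta hrho1 Hs Hs01) as G. cbv zeta in G.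
    replace (2 * s - 1) with x in G by (unfold s; field).
    set (r := Csqrt (1 + rho ^ 2 - 2 * rho * x)) in *. fold a p F in G.
    rewrite jweight_pos by exact Hx.
    assert (Ew : Rpower (1 + x) (beta / 2) * Rpower s (beta / 2) = Rpower 2 (- (beta / 2)) * Rpower (1 + x) (p - 1)).
    { rewrite Rpower_mult_distr by lra.
      replace ((1 + x) * s) with ((1 + x) * (1 + x) * / 2) by (unfold s; field).
      rewrite <- !Rpower_mult_distr by nra. unfold p.
      replace (beta + 1 - 1) with (beta / 2 + beta / 2) by field. rewrite Rpower_plus, Rpower_Ropp.
      unfold Rpower at 3. rewrite ln_Rinv by lra. 
      replace (beta / 2 * - ln 2) with (- (beta / 2 * ln 2)) by ring. rewrite exp_Ropp. fold (Rpower 2 (beta / 2)). ring. }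
    replace (q - 1) with gamma by (unfold q; ring).
    transitivity (RtoC (Rpower (1 + x) (beta / 2)) * RtoC (Rpower (1 - x) gamma) *
        (/ Cpower r (alpha + 1) * legendreP alpha (- beta) ((1 + rho) / r)) * jacobiP k gamma beta x)%C; [|unfold Cdiv; ring].
    rewrite G. unfold K1.
    transitivity ((RtoC (Rpower (1 + x) (beta / 2)) * RtoC (Rpower s (beta / 2))) * RtoC (Rpower (1 - x) gamma) *
        (/ Cgamma p * Cpower rho (beta / 2) * (Cpower (1 + rho) (- a) * F (s * koebe rho)%C)) * jacobiP k gamma beta x)%C; [|ring].
    rewrite <- RtoC_mult, Ew, !RtoC_mult. ring.
  - assert (EL := legendreP_disc (gamma - alpha) a' rho c Hc hrho1 Hs).
    assert (H2k : RtoC (INR (2 * k)) = (2 * INR k)%C) by (rewrite mult_INR, RtoC_mult; reflexivity).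
    assert (Ec : RtoC c = (gamma + beta + 2 * INR k + 2)%C) by (unfold c, p, q; rewrite !RtoC_plus, H2k; ring).
    assert (Ea1 : (1 + a' - c)%C = (- (gamma - alpha))%C) by (rewrite Ec; unfold a', a; rewrite H2k; ring).
    assert (Ea2 : (c - a')%C = (gamma - alpha + 1)%C) by (rewrite Ec; unfold a', a; rewrite H2k; ring).
    rewrite Ea1, Ea2 in EL. specialize (EL (hyp2F1_spec _ _ _ Pc)).
    replace (1 - RtoC c)%C with (- gamma - beta - 2 * INR k - 1)%C in EL by (rewrite Ec; ring).
    rewrite EL. fold Fc. unfold H, K1, K.
    replace (gamma + INR k + 1)%C with (RtoC (q + INR k)) by (unfold q; rewrite !RtoC_plus; ring).
    rewrite !Cgamma_pos_real by lra.
    replace (- (gamma - alpha))%C with (alpha - gamma)%C by ring.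
    assert (E1 : Cpower rho ((c - 1) / 2) = (Cpower rho ((gamma + 1) / 2) * Cpower rho (beta / 2) * rho ^ k)%C).
    { rewrite <- Cpower_nat by (apply slit_neq_0, Hs). rewrite <- !Cpower_plus. f_equal. rewrite Ec. field. }
    pose proof (slit_neq_0 _ (slit_Re_pos _ (disc_Re_pos_plus rho hrho1))) as Hne.
    assert (E2 : Cpower (1 + rho) (- a') = (Cpower (1 + rho) (- a) * / ((1 + rho) * (1 + rho)) ^ k)%C).
    { unfold a'. rewrite Copp_plus_distr, Cpower_plus, (Cpower_opp _ (INR (2 * k))), Cpower_nat by exact Hne.
      rewrite Cpow_mult_r. do 3 f_equal. rewrite !Cpow_S. simpl. ring. }
    assert (E3 : (koebe rho ^ k)%C = (4 ^ k * rho ^ k * / ((1 + rho) * (1 + rho)) ^ k)%C).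
    { unfold koebe, Cdiv. rewrite !Cpow_mult_l, Cpow_inv by (now apply Cmult_neq_0). rewrite Cpow_mult_l. reflexivity. }
    rewrite E1, E2, E3, jacobi_mass_gamma by assumption. fold a.
    unfold c. rewrite !rgamma_add_nat by lra.
    pose proof (rgamma_pos p Hp). pose proof (rgamma_pos q Hq). pose proof (rgamma_pos (p + q) ltac:(lra)).
    pose proof (rpoch_pos (p + q) (2 * k) ltac:(lra)).
    replace (pochhammer (p + q) (2 * k)) with (RtoC (rpoch (p + q) (2 * k))) by (now rewrite <- pochhammer_real, RtoC_plus).
    rewrite pochhammer_real.
    replace (Rpower 2 (gamma + beta / 2 + 1)) with (Rpower 2 (- (beta / 2)) * Rpower 2 (p + q - 1))
      by (rewrite <- Rpower_plus; f_equal; unfold p, q; field).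
    rewrite !RtoC_mult, RtoC_div, !RtoC_mult by lra.
    pose proof (Cpower_neq_0 (1 - rho) (alpha - gamma)). pose proof (Cpower_neq_0 rho ((gamma + 1) / 2)).
    assert (Hfour : RtoC 4 <> 0) by (apply RtoC_neq_0; lra). pose proof (Cpow_nz 4 k Hfour).
    pose proof (fact_C_neq_0 k).
    assert (Hsq : (((1 + rho) * (1 + rho)) ^ k)%C <> 0) by (apply Cpow_nz; now apply Cmult_neq_0).
    field. repeat split; try assumption; apply RtoC_neq_0; lra.
Qed.
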